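(* Let $G$ be a discrete measurable groupoid. Below, $\mu$ and $\nu$ denote probability measures on $G^{(0)}$. 1. If $\mu$ is a strong limit of a net of sofic measures, then $\mu$ is sofic. 2. A countable convex combination of sofic measures is sofic. 3. If $(G,\mu)$ is pmp and $\mu$ has a disintegration of the form $\mu=\int_{G^{(0)}}p_x\,d\nu(x)$, where for $\nu$-a.e. $x$, $p_x$ is a probability measure such that $(G,p_x)$ is sofic, then $(G,\mu)$ is sofic. In particular, if almost every ergodic component of $(G,\mu)$ is sofic, then so is $(G,\mu)$. 4. If $(G,\mu)$ is sofic and $H$ is a non-null subgroupoid of $G$, then $(H,\mu_H)$ is sofic. 5. If $\nu\ll\mu$, where $(G,\nu)$ is pmp, and $\mu$ is sofic, then $\nu$ is sofic. 6. If $(G,\mu)$ is pmp and $\{H_n\}$ is a countable Borel partition of $G$ by non-null subgroupoids, then $(G,\mu)$ is sofic if and only if each $(H_n,\mu_{H_n})$ is sofic.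
   Context: A groupoid is a small category with all arrows invertible, identified with its set of arrows $G$; $s(g)=g^{-1}g$, $r(g)=gg^{-1}$, the unit space is $G^{(0)}=s(G)=r(G)$, and $gh$ is defined iff $s(g)=r(h)$. A discrete measurable groupoid is a groupoid with a standard Borel structure for which product and inverse are Borel and $s^{-1}(x)$ is countable for all $x\in G^{(0)}$. Its Borel full semigroup $[[G]]_B$ is the set of Borel $\alpha\subseteq G$ such that $s|_\alpha$ and $r|_\alpha$ are injective; it is an inverse monoid with $\alpha\beta=\{ab:a\in\alpha,b\in\beta,s(a)=r(b)\}$, $\alpha^{-1}=\{a^{-1}:a\in\alpha\}$ and unit $G^{(0)}$. A pmp groupoid $(G,\mu)$ is a discrete measurable groupoid $G$ with a Borel probability measure $\mu$ on $G^{(0)}$ such that $\mu(s(\alpha))=\mu(r(\alpha))$ for all $\alpha\in[[G]]_B$. The full semigroup $[[G]]=[[G]]_\mu$ is the metric quotient of $[[G]]_B$ under the pseudometric $d_\mu(\alpha,\beta)=\mu(s(\alpha\triangle\beta))$; it inherits the inverse monoid structure. Fix a free ultrafilter $\mathcal U$ on $\mathbb N$. For metric spaces $(M_k,d_k)$ of diameter $\le 1$, $\prod_{\mathcal U}M_k$ is the metric quotient of $\prod_kM_k$ under $d_{\mathcal U}((x_k),(y_k))=\lim_{k\to\mathcal U}d_k(x_k,y_k)$. Ultraproducts of full semigroups are inverse monoids with coordinatewise operations. A pmp groupoid $(G,\mu)$ is sofic if there are a sequence $(G_k)$ of finite pmp groupoids and an isometric embedding (isometric semigroup homomorphism) $[[G]]\to\prod_{\mathcal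 U}[[G_k]]$. A measure $\mu$ on (the unit space of) $G$ is called sofic if $(G,\mu)$ is a pmp sofic groupoid. A net $(\mu_i)$ of measures on a measurable space converges strongly to $\mu$ if $\mu_i(A)\to\mu(A)$ for every measurable set $A$. A countable convex combination is $\sum_nt_n\mu_n$ with $t_n\ge0$, $\sum_nt_n=1$ (finite or countably infinite). The disintegration formula means that for every Borel $A\subseteq G^{(0)}$, $x\mapsto p_x(A)$ is measurable and $\mu(A)=\int p_x(A)\,d\nu(x)$. The ergodic components of a pmp groupoid $(G,\mu)$ are the measures occurring in the ergodic decomposition of $\mu$ into probability measures that make $G$ pmp and for which every Borel $A\subseteq G^{(0)}$ with $r(s^{-1}(A))\subseteq A$ has measure $0$ or $1$. Subgroupoids $H\subseteq G$ are Borel subsets closed under products and inverses, with unit space $H^{(0)}=H\cap G^{(0)}$; $H$ is non-null if $\mu(H^{(0)})>0$, and then $\mu_H(A)=\mu(A)/\mu(H^{(0)})$ for Borel $A\subseteq H^{(0)}$. *)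

(* Defs.v *)
From HB Require Import structures.
From mathcomp Require Import all_boot all_order all_algebra.
From mathcomp Require Import all_classical all_reals all_analysis.

Set Implicit Arguments.
Unset Strict Implicit.
Unset Printing Implicit Defensive.
Import Order.TTheory GRing.Theory Num.Theory.
Import numFieldNormedType.Exports.

Local Open Scope classical_set_scope.
Local Open Scope ring_scope.

Section arrows.
Context (G : Type) (mul : G -> G -> G) (inv : G -> G).
Definition src_arrow (g : G) := mul (inv g) g.
Definition rng_arrow (g : G) := mul g (inv g).
End arrows.

(** A groupoid is identified with its set of arrows.  [gmul] is a total
    function, but only its values at the pairs [(g, h)] with [s(g) = r(h)] are
    meaningful; nothing is assumed about the others. *)
HB.mixin Record isGroupoid (G : Type) := {
  gmul : G -> G -> G ;
  ginv : G -> G ;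
  src_ginv : forall g, src_arrow gmul ginv (ginv g) = rng_arrow gmul ginv g ;
  rng_ginv : forall g, rng_arrow gmul ginv (ginv g) = src_arrow gmul ginv g ;
  src_gmul : forall g h, src_arrow gmul ginv g = rng_arrow gmul ginv h ->
    src_arrow gmul ginv (gmul g h) = src_arrow gmul ginv h ;
  rng_gmul : forall g h, src_arrow gmul ginv g = rng_arrow gmul ginv h ->
    rng_arrow gmul ginv (gmul g h) = rng_arrow gmul ginv g ;
  gmulA : forall f g h,
    src_arrow gmul ginv f = rng_arrow gmul ginv g ->
    src_arrow gmul ginv g = rng_arrow gmul ginv h ->
    gmul f (gmul g h) = gmul (gmul f g) h ;
  gmul_src : forall g, gmul g (src_arrow gmul ginv g) = g ;
  rng_gmull : forall g, gmul (rng_arrow gmul ginv g) g = g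
}.

#[short(type="groupoidType")]
HB.structure Definition Groupoid := {G of isGroupoid G}.

#[short(type="measurableGroupoidType")]
HB.structure Definition MeasurableGroupoid d :=
  {G of Measurable d G & isGroupoid G}.

Definition gsrc (G : groupoidType) (g : G) : G := src_arrow gmul ginv g.
Definition grng (G : groupoidType) (g : G) : G := rng_arrow gmul ginv g.

Section groupoid_lemmas.
Context (G : groupoidType).
Implicit Types g : G.

Lemma gsrc_src g : gsrc (gsrc g) = gsrc g.
Proof. by rewrite {2}/gsrc [LHS]src_gmul// src_ginv. Qed.

Lemma gsrc_rng g : gsrc (grng g) = grng g.
Proof. by rewrite {1}/grng [LHS]src_gmul ?rng_ginv// src_ginv. Qed.

Lemma grng_src g : grng (gsrc g) = gsrc g.
Proof. by rewrite {2}/gsrc [LHS]rng_gmul ?rng_ginv// src_ginv. Qed.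

End groupoid_lemmas.

(** [x] is a unit iff [x = s(x)], as [s] is idempotent. *)
Definition unit_arrows (G : groupoidType) : set G := [set x | gsrc x = x].

Arguments unit_arrows : clear implicits.

Definition units (G : groupoidType) : Type := set_type (unit_arrows G).

Section units.
Context (G : groupoidType).

Definition unit_val (x : units G) : G := val x.

Definition src (g : G) : units G := SigSub (mem_set (gsrc_src g)).
Definition rng (g : G) : units G := SigSub (mem_set (gsrc_rng g)).

Definition composable : set (G * G) := [set gh | src gh.1 = rng gh.2].

Definition set_gmul (A B : set G) : set G :=
  [set g | exists a b, [/\ A a, B b, src a = rng b & g = gmul a b]].

End units.

Arguments src {G}.
Arguments rng {G}.
Arguments unit_val {G}.
Arguments composable : clear implicits.

Section measurable_units.
Context d (G : measurableGroupoidType d).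

HB.instance Definition _ := Choice.on (units G).
HB.instance Definition _ := isPointed.Build (units G) (src point).
HB.instance Definition _ := Measurable.copy (units G)
  (g_sigma_algebra_preimageType (unit_val : units G -> G)).

End measurable_units.

(** Nonemptiness is required because a [measurableType] is pointed; non-null
    subgroupoids are nonempty. *)
Record subgroupoid d (G : measurableGroupoidType d) := Subgroupoid {
  subgpd_set :> set G ;
  subgpd_nonempty : subgpd_set !=set0 ;
  subgpd_measurable : measurable subgpd_set ;
  subgpd_mul : forall g h, subgpd_set g -> subgpd_set h -> src g = rng h ->
    subgpd_set (gmul g h) ;
  subgpd_inv : forall g, subgpd_set g -> subgpd_set (ginv g)
}.

Definition subgpd_type d (G : measurableGroupoidType d) (H : subgroupoid G) :
  Type := set_type (subgpd_set H).

Section subgroupoid_type.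
Context d (G : measurableGroupoidType d) (H : subgroupoid G).
Local Notation HT := (subgpd_type H).
Implicit Types x y z : HT.

Definition subgpd_val x : G := val x.

Let hvalP x : subgpd_set H (subgpd_val x).
Proof. exact: set_mem (valP x). Qed.

Let hval_inj : injective subgpd_val.
Proof. exact: val_inj. Qed.

Definition subgpd_ginv x : HT := SigSub (mem_set (subgpd_inv (hvalP x))).

(* The value [x] at non-composable pairs is arbitrary. *)
Definition subgpd_gmul x y : HT :=
  if pselect (src (subgpd_val x) = rng (subgpd_val y)) is left e
  then SigSub (mem_set (subgpd_mul (hvalP x) (hvalP y) e)) else x.

Let srcE (g h : G) : src g = rng h <-> gsrc g = grng h.
Proof. by split => [[]//|e]; exact: (@val_inj _ _ (set_type (unit_arrows G))). Qed.

Let val_gmul x y : gsrc (subgpd_val x) = grng (subgpd_val y) ->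
  subgpd_val (subgpd_gmul x y) = gmul (subgpd_val x) (subgpd_val y).
Proof. by move=> /srcE e; rewrite /subgpd_gmul; case: pselect. Qed.

Lemma subgpd_val_src x :
  subgpd_val (src_arrow subgpd_gmul subgpd_ginv x) = gsrc (subgpd_val x).
Proof. by rewrite val_gmul//; exact: src_ginv. Qed.

Let val_rng x :
  subgpd_val (rng_arrow subgpd_gmul subgpd_ginv x) = grng (subgpd_val x).
Proof. by rewrite val_gmul//; exact/esym/rng_ginv. Qed.

Let comp x y :
  src_arrow subgpd_gmul subgpd_ginv x = rng_arrow subgpd_gmul subgpd_ginv y ->
  gsrc (subgpd_val x) = grng (subgpd_val y).
Proof. by move=> /(congr1 subgpd_val); rewrite subgpd_val_src val_rng. Qed.

Let src_ginv x : src_arrow subgpd_gmul subgpd_ginv (subgpd_ginv x) =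
  rng_arrow subgpd_gmul subgpd_ginv x.
Proof. by apply: hval_inj; rewrite subgpd_val_src val_rng; exact: src_ginv. Qed.

Let rng_ginv x : rng_arrow subgpd_gmul subgpd_ginv (subgpd_ginv x) =
  src_arrow subgpd_gmul subgpd_ginv x.
Proof. by apply: hval_inj; rewrite subgpd_val_src val_rng; exact: rng_ginv. Qed.

Let src_gmul x y :
  src_arrow subgpd_gmul subgpd_ginv x = rng_arrow subgpd_gmul subgpd_ginv y ->
  src_arrow subgpd_gmul subgpd_ginv (subgpd_gmul x y) =
  src_arrow subgpd_gmul subgpd_ginv y.
Proof.
move=> /comp e; apply: hval_inj; rewrite !subgpd_val_src val_gmul//.
exact: src_gmul.
Qed.

Let rng_gmul x y :
  src_arrow subgpd_gmul subgpd_ginv x = rng_arrow subgpd_gmul subgpd_ginv y ->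
  rng_arrow subgpd_gmul subgpd_ginv (subgpd_gmul x y) =
  rng_arrow subgpd_gmul subgpd_ginv x.
Proof.
move=> /comp e; apply: hval_inj; rewrite !val_rng val_gmul//.
exact: rng_gmul.
Qed.

Let gmulA x y z :
  src_arrow subgpd_gmul subgpd_ginv x = rng_arrow subgpd_gmul subgpd_ginv y ->
  src_arrow subgpd_gmul subgpd_ginv y = rng_arrow subgpd_gmul subgpd_ginv z ->
  subgpd_gmul x (subgpd_gmul y z) = subgpd_gmul (subgpd_gmul x y) z.
Proof.
move=> /comp xy /comp yz; apply: hval_inj; rewrite !val_gmul//.
- exact: gmulA.
- by rewrite [LHS]Defs.src_gmul.
- by rewrite [RHS]Defs.rng_gmul.
Qed.

Let gmul_src x :
  subgpd_gmul x (src_arrow subgpd_gmul subgpd_ginv x) = x.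
Proof.
apply: hval_inj; rewrite val_gmul subgpd_val_src; first exact: gmul_src.
by rewrite grng_src.
Qed.

Let rng_gmull x :
  subgpd_gmul (rng_arrow subgpd_gmul subgpd_ginv x) x = x.
Proof.
apply: hval_inj; rewrite val_gmul val_rng; first exact: rng_gmull.
by rewrite gsrc_rng.
Qed.

HB.instance Definition _ := Choice.on HT.
HB.instance Definition _ := isPointed.Build HT
  (SigSub (mem_set (projT2 (cid (subgpd_nonempty H))))).
HB.instance Definition _ := Measurable.copy HT
  (g_sigma_algebra_preimageType (subgpd_val : HT -> G)).
HB.instance Definition _ := isGroupoid.Build HT
  src_ginv rng_ginv src_gmul rng_gmul gmulA gmul_src rng_gmull.

End subgroupoid_type.

Definition borel (X : topologicalType) : set (set X) := <<s @open X >>.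

(** [T] is Borel isomorphic to a Borel subset (the range of [f]) of a Polish
    space [X]. *)
Definition standard_borel (R : realType) d (T : measurableType d) : Prop :=
  exists (X : completePseudoMetricType R) (f : T -> X),
    [/\ hausdorff_space X, @second_countable X, injective f &
        forall A : set T, measurable A <-> borel (f @` A)].

(** The composable pairs form a Borel set (the preimage of the diagonal under
    the Borel map [(g, h) |-> (s(g), r(h))]); this is stated explicitly because
    [measurable_fun D f] is vacuous when [D] is not measurable. *)
Definition discrete_measurable_groupoid (R : realType) d
    (G : measurableGroupoidType d) : Prop :=
  [/\ standard_borel R G,
      measurable (composable G),
      measurable_fun (composable G) (fun gh : G * G => gmul gh.1 gh.2),
      measurable_fun [set: G] (@ginv G) &
      forall x : units G, countable (src @^-1` [set x])].

Section pmp.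
Context (R : realType) d (G : measurableGroupoidType d).
Implicit Types (mu : probability (units G) R) (A : set (units G)).

Definition borel_full_semigroup : set (set G) :=
  [set a | [/\ measurable a, set_inj a src & set_inj a rng]].

Definition pmp mu : Prop :=
  discrete_measurable_groupoid R G /\
  forall a, borel_full_semigroup a -> mu (src @` a) = mu (rng @` a).

Definition ergodic mu : Prop :=
  forall A, measurable A -> rng @` (src @^-1` A) `<=` A ->
    mu A = 0%E \/ mu A = 1%E.

End pmp.

Arguments borel_full_semigroup {d} G.

(** A type with a distance and a product, without axioms: it serves both for
    pseudometric semigroups and for their quotients. *)
Record metric_magma (R : realType) := MetricMagma {
  mm_sort :> Type ;
  mm_dist : mm_sort -> mm_sort -> R ;
  mm_mul : mm_sort -> mm_sort -> mm_sort
}.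

Section metric_quotient.
Context (R : realType) (M : metric_magma R).

(** The points are the classes of the relation "at distance 0"; distance and
    product are computed on representatives, on which they do not depend when
    [mm_dist] is a pseudometric for which [mm_mul] is continuous. *)
Definition mclass (x : M) : set M := [set y | mm_dist x y = 0].

Definition mquot : Type := {C : set M | exists x, C = mclass x}.

Definition mquot_pi (x : M) : mquot :=
  exist _ (mclass x) (ex_intro _ x erefl).

Definition mquot_repr (c : mquot) : M := sval (cid (proj2_sig c)).

Definition metric_quotient : metric_magma R := {|
  mm_sort := mquot ;
  mm_dist := fun a b => mm_dist (mquot_repr a) (mquot_repr b) ;
  mm_mul := fun a b => mquot_pi (mm_mul (mquot_repr a) (mquot_repr b)) |}.

End metric_quotient.

Definition free_ultrafilter (U : set_system nat) : Prop :=
  UltraFilter U /\ \bigcap_(A in U) A = set0.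

Definition ultraproduct (R : realType) (U : set_system nat)
    (M : nat -> metric_magma R) : metric_magma R :=
  metric_quotient {|
    mm_sort := forall k, M k ;
    mm_dist := fun x y => lim ((fun k => mm_dist (x k) (y k)) @ U) ;
    mm_mul := fun x y k => mm_mul (x k) (y k) |}.

Definition isometric_embedding (R : realType) (M N : metric_magma R)
    (f : M -> N) : Prop :=
  (forall x y, mm_dist (f x) (f y) = mm_dist x y) /\
  (forall x y, f (mm_mul x y) = mm_mul (f x) (f y)).

Section full_semigroup.
Context (R : realType) d (G : measurableGroupoidType d).
Local Notation BG := (set_type (borel_full_semigroup G)).

Lemma borel_full_semigroup0 : borel_full_semigroup G set0.
Proof. by split => // x y; rewrite inE. Qed.

(** The element of the full semigroup whose underlying set is the product of
    those of [a] and [b].  In a discrete measurable groupoid this product is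
    Borel, by the Lusin-Souslin theorem, so that the default value [set0] is
    never used. *)
Definition bmul (a b : BG) : BG :=
  xget (SigSub (mem_set borel_full_semigroup0))
    [set c : BG | val c = set_gmul (val a) (val b)].

Definition full_semigroup (mu : probability (units G) R) : metric_magma R :=
  metric_quotient {|
    mm_sort := BG ;
    mm_dist := fun a b => fine (mu (src @` (val a `+` val b))) ;
    mm_mul := bmul |}.

End full_semigroup.

Definition sofic (R : realType) (U : set_system nat) d
    (G : measurableGroupoidType d) (mu : probability (units G) R) : Prop :=
  pmp mu /\
  exists (d_ : nat -> measure_display)
    (G_ : forall k, measurableGroupoidType (d_ k))
    (mu_ : forall k, probability (units (G_ k)) R),
    (forall k, finite_set [set: G_ k] /\ pmp (mu_ k)) /\
    exists f : full_semigroup mu ->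
               ultraproduct U (fun k => full_semigroup (mu_ k)),
      isometric_embedding f.

Definition directed (I : Type) (leI : I -> I -> Prop) : Prop :=
  [/\ inhabited I, forall i, leI i i,
      forall i j k, leI i j -> leI j k -> leI i k &
      forall i j, exists2 k, leI i k & leI j k].

Definition net_filter (I : Type) (leI : I -> I -> Prop) : set_system I :=
  [set P | exists i0, forall i, leI i0 i -> P i].

Section measures.
Context (R : realType) d (T : measurableType d).
Implicit Types mu : probability T R.

Definition strong_limit (I : Type) (leI : I -> I -> Prop)
    (mu_ : I -> probability T R) mu : Prop :=
  forall A, measurable A -> (fun i => mu_ i A) @ net_filter leI --> mu A.

Definition convex_combination (I : countType) (t : I -> R)
    (mu_ : I -> probability T R) mu : Prop :=
  [/\ forall i, 0 <= t i,
      \esum_(i in [set: I]) (t i)%:E = 1%E &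
      forall A, measurable A ->
        mu A = \esum_(i in [set: I]) ((t i)%:E * mu_ i A)%E].

Context d' (Z : measurableType d').
Implicit Types (nu : probability Z R) (p : R.-ker Z ~> T).

(** [R.-ker Z ~> T] is the type of families of measures [p] on [T] such that
    [z |-> p z A] is measurable for all measurable [A]. *)
Definition disintegration mu nu p : Prop :=
  forall A, measurable A -> mu A = (\int[nu]_z p z A)%E.

(** For almost every [z], [p z] is a probability measure satisfying [Q]. *)
Definition ae_probability nu p (Q : probability T R -> Prop) : Prop :=
  {ae nu, forall z, exists2 P : probability T R,
    (forall A, measurable A -> p z A = P A) & Q P}.

End measures.

(** The ergodic components are the measures [p z]. *)
Definition ergodic_decomposition (R : realType) d (G : measurableGroupoidType d)
    d' (Z : measurableType d') (mu : probability (units G) R)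
    (nu : probability Z R) (p : R.-ker Z ~> units G) : Prop :=
  disintegration mu nu p /\
  ae_probability nu p (fun P => pmp P /\ ergodic P).

Section subgroupoid_measure.
Context (R : realType) d (G : measurableGroupoidType d) (H : subgroupoid G).
Context (mu : probability (units G) R).

Definition subgpd_units : set (units G) :=
  [set x | subgpd_set H (unit_val x)].

Definition non_null : Prop := (0 < mu subgpd_units)%E.

Lemma subgpd_unit_subproof (x : units (subgpd_type H)) :
  unit_arrows G (subgpd_val (unit_val x)).
Proof.
by rewrite /unit_arrows/= -subgpd_val_src; congr subgpd_val; exact: set_mem (valP x).
Qed.

Definition subgpd_unit_incl (x : units (subgpd_type H)) : units G :=
  SigSub (mem_set (subgpd_unit_subproof x)).

(** [h] is not used by the formula, but it makes the result a probability. *)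
Definition subgpd_measure (h : non_null) (A : set (units (subgpd_type H))) :
  \bar R := (mu (subgpd_unit_incl @` A) * (fine (mu subgpd_units))^-1%:E)%E.

Let incl_inj : injective subgpd_unit_incl.
Proof.
move=> x y /(congr1 unit_val) e.
apply: (@val_inj _ _ (set_type (unit_arrows (subgpd_type H)))).
exact: (@val_inj _ _ (set_type (subgpd_set H))).
Qed.

Let measurable_units : measurable subgpd_units.
Proof.
by exists (subgpd_set H); [exact: subgpd_measurable|rewrite setTI].
Qed.

Let incl_setT : subgpd_unit_incl @` setT = subgpd_units.
Proof.
apply/seteqP; split => [_ [x _ <-]|x Hx]; first exact: set_mem (valP (unit_val x)).
pose y : subgpd_type H := SigSub (mem_set (Hx : subgpd_set H (unit_val x))).
have ux : unit_arrows (subgpd_type H) y.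
  apply: (@val_inj _ _ (set_type (subgpd_set H))).
  by rewrite [LHS]subgpd_val_src; exact: set_mem (valP x).
exists (SigSub (mem_set ux)) => //.
exact: (@val_inj _ _ (set_type (unit_arrows G))).
Qed.

Let measurable_incl A : measurable A -> measurable (subgpd_unit_incl @` A).
Proof.
case=> _ [B mB <-] <-.
rewrite (_ : _ @` _ = subgpd_units `&` unit_val @^-1` B).
  apply: measurableI => //; by exists B => //; rewrite setTI.
apply/seteqP; split => [_ [x [_ [_ Bx]] <-]|x [Hx Bx]].
  by split => //=; rewrite -incl_setT; exists x.
move: Hx; rewrite -{1}incl_setT => -[y _ yx]; exists y => //.
by split => //; split => //=; move: Bx; rewrite -yx.
Qed.

Context (h : non_null).

Let subgpd_measure0 : subgpd_measure h set0 = 0%E.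
Proof. by rewrite /subgpd_measure image_set0 measure0 mul0e. Qed.

Let inv_ge0 : (0 <= (fine (mu subgpd_units))^-1%:E)%E.
Proof. by rewrite lee_fin invr_ge0 fine_ge0. Qed.

Let subgpd_measure_ge0 A : (0 <= subgpd_measure h A)%E.
Proof. by rewrite /subgpd_measure mule_ge0. Qed.

Let subgpd_measure_sigma_additive : semi_sigma_additive (subgpd_measure h).
Proof.
move=> F mF tF mUF; rewrite /subgpd_measure.
rewrite (_ : (fun n => _) = (fun n =>
  (\sum_(0 <= i < n) mu (subgpd_unit_incl @` F i)) *
  (fine (mu subgpd_units))^-1%:E)%E); last first.
  by apply/funext => n; rewrite ge0_sume_distrl.
apply: cvgeZr => //.
rewrite image_bigcup; apply: measure_semi_sigma_additive.
- by move=> i; exact: measurable_incl.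
- move=> i j _ _ [_ [[x Fx <-] [y Fy /incl_inj yx]]].
  by apply: tF => //; exists x; split => //; rewrite -yx.
- by rewrite -image_bigcup; exact: measurable_incl.
Qed.

HB.instance Definition _ := isMeasure.Build _ _ _ (subgpd_measure h)
  subgpd_measure0 subgpd_measure_ge0 subgpd_measure_sigma_additive.

Let subgpd_measure_setT : subgpd_measure h setT = 1%E.
Proof.
rewrite /subgpd_measure incl_setT -[X in (X * _)%E]fineK ?fin_num_measure//.
rewrite -EFinM divff// gt_eqF// fine_gt0// h/=.
by rewrite (le_lt_trans (probability_le1 _ _))// ltry.
Qed.

HB.instance Definition _ := Measure_isProbability.Build _ _ _
  (subgpd_measure h) subgpd_measure_setT.

End subgroupoid_measure.

(* Main.v *)
(** By the Lusin-Novikov theorem, used modulo null sets, the full semigroup of a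
    pmp groupoid is separable, so that soficity amounts to a finitary condition:
    for every finite set [K] of bisections and every [e > 0], the distances
    [mu(s(a D b))], where [D] is the symmetric difference, and the products of
    elements of [K] are reproduced up to [e] in a finite groupoid with an
    invariant measure.  Stated for an arbitrary total mass and an arbitrary
    function instead of the distance, this condition is stable under uniform
    limits on finite sets, nonnegative multiples, sums (take disjoint unions of
    finite groupoids) and passage to a corner: an idempotent of the full
    semigroup is mapped close to a set of units of the finite groupoid, to which
    the latter can be reduced.

    Strong limits and convex combinations are then immediate.  For a
    disintegration, the space of parameters is cut into finitely many pieces on
    which the distances [p_x(s(a D b))], with [a, b] in [K], oscillate by at most
    [e], so that the distance of [mu] is close to a finite convex combination of
    distances of measures [p_x].  A subgroupoid [H] gives the corner over its
    units, and, conversely, for a partition into subgroupoids the distance is the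
    sum of those of the pieces.  Finally, if [nu << mu], then bisections preserve
    both measures, hence the density of [nu]; the corners over its level sets,
    weighted by its values there, add up to the distance of [nu]. *)

Require Import Defs.
From HB Require Import structures.
From mathcomp Require Import all_boot all_order all_algebra.
From mathcomp Require Import all_classical all_reals all_analysis.
From mathcomp Require Import measurable_realfun.
From mathcomp Require Import ring lra.

Set Implicit Arguments.
Unset Strict Implicit.
Unset Printing Implicit Defensive.
Import Order.TTheory GRing.Theory Num.Theory.
Import numFieldNormedType.Exports.

Local Open Scope classical_set_scope.
Local Open Scope ring_scope.

(** * Codings of Borel sets by sequences of integers *)

Section codes.
Local Open Scope nat_scope.
Implicit Types (n : nat) (s t : nat -> nat) (F P : set (nat -> nat)).

(** Separability is what lets an ultraproduct over the integers suffice: its k-th coordinate only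
    has to serve the first elements of a dense sequence. It needs almost all arrows to be covered by
    countably many Borel sets on which the source is injective, and already the measurability of
    products and of source images of bisections needs the Lusin-Souslin theorem; this is why
    descriptive set theory enters. The delicate point about corners is that an approximation is not
    assumed to send the empty bisection near the empty set, whereas the mass of a corner is only
    seen as a distance to the empty bisection. The remedy is that the unit and the empty bisection
    are at distance 1, which leaves almost no room for the image of the latter. Restriction to an
    almost invariant set is multiplicative only up to null sets, so the transport of approximations
    to corners is stated with distances 0 instead of equalities. *)

Lemma dependent_choice_nat (S : Type) (P : nat -> S -> Prop)
    (Q : nat -> S -> S -> Prop) (x0 : S) :
  P 0 x0 -> (forall n x, P n x -> exists2 y, P n.+1 y & Q n x y) ->
  exists f : nat -> S, forall n, P n (f n) /\ Q n (f n) (f n.+1).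
Proof.
move=> P0 PQ.
have /choice[g gP] : forall nx : nat * S, exists y,
    P nx.1 nx.2 -> P nx.1.+1 y /\ Q nx.1 nx.2 y.
  move=> [n x]; have [/(PQ n)[y Py Qy]|NP] := pselect (P n x); first by exists y.
  by exists x.
pose f := fix f n := if n is m.+1 then g (m, f m) else x0.
have Pf n : P n (f n) by elim: n => // n /(gP (n, f n))[].
by exists f => n; split => //; have [] := gP (n, f n) (Pf n).
Qed.

Definition agree n s t := forall i, (i < n) -> s i = t i.

Lemma agree_sym n s t : agree n s t -> agree n t s.
Proof. by move=> st i ni; rewrite st. Qed.

Lemma agree_trans n s t u : agree n s t -> agree n t u -> agree n s u.
Proof. by move=> st tu i ni; rewrite st// tu. Qed.

Lemma agree_le m n s t : (m <= n) -> agree n s t -> agree m s t.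
Proof. by move=> mn st i im; apply: st; apply: leq_trans mn. Qed.

(** The diagonal limit of a sequence of sequences, [h k] being the length up to which [u k] is
    frozen. The i-th term is read in [u i.+1], the first one guaranteed to have it frozen. *)
Lemma agree_limit (u : nat -> nat -> nat) (h : nat -> nat) :
  (forall k, k <= h k) -> (forall k, h k <= h k.+1) ->
  (forall k, agree (h k) (u k) (u k.+1)) ->
  forall k, agree (h k) (u k) (fun i => u i.+1 i).
Proof.
move=> hk hS uS.
have hD k l : h k <= h (k + l).
  by elim: l => [|l IH]; rewrite ?addn0// addnS (leq_trans IH).
have uD k l : agree (h k) (u k) (u (k + l)).
  elim: l => [|l IH]; first by rewrite addn0.
  by rewrite addnS; apply: agree_trans IH _; exact: agree_le (hD _ _) (uS _).
move=> k i ki; case: (leqP k i.+1) => [/subnKC <-|/ltnW/subnKC <-]; first exact: uD.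
by apply/esym/uD; exact: hk.
Qed.

Definition shift s : nat -> nat := fun i => s i.+1.

Definition scons k s : nat -> nat := fun i => if i is j.+1 then s j else k.

Lemma agree_shift n s t : agree n.+1 s t -> agree n (shift s) (shift t).
Proof. by move=> st i ni; exact: st. Qed.

Lemma agree0 n s t : agree n.+1 s t -> s 0 = t 0.
Proof. by move=> /(_ 0); exact. Qed.

Definition column (k : nat) s : nat -> nat := fun i : nat => s (pickle (k, i)).

Definition merge_columns (u : nat -> nat -> nat) : nat -> nat :=
  fun j => if @unpickle (nat * nat)%type j is Some ki then u ki.1 ki.2 else 0.

Lemma column_merge u k : column k (merge_columns u) = u k.
Proof. by apply/funext => i; rewrite /column /merge_columns pickleK. Qed.

Lemma agree_column k n :
  exists m, forall s t, agree m s t -> agree n (column k s) (column k t).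
Proof.
exists (\max_(i < n) (pickle (k, nat_of_ord i)).+1) => s t st i ni.
apply: st; exact: (leq_bigmax (Ordinal ni)).
Qed.

(** A closed subset of the Baire space of integer sequences, in terms of finite prefixes;
    [rel_closed] and [open_pre] are likewise closedness and openness relative to [F]. *)
Definition closed_code F :=
  forall s, (forall n, exists2 t, F t & agree n s t) -> F s.

Definition rel_closed F P :=
  forall s, F s -> (forall n, exists2 t, F t /\ P t & agree n s t) -> P s.

Definition open_pre (X : Type) F (phi : (nat -> nat) -> X) (E : set X) :=
  forall s, F s -> E (phi s) ->
    exists n, forall t, F t -> agree n s t -> E (phi t).

Definition clopen_pre (X : Type) F (phi : (nat -> nat) -> X) (E : set X) :=
  open_pre F phi E /\ open_pre F phi (~` E).

(** The new first term is an integer label; closedness survives because sequences that agree on a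
    nonempty prefix carry the same label. *)
Lemma closed_code_prefix F (P : nat -> set (nat -> nat)) :
  closed_code F -> (forall j, rel_closed F (P j)) ->
  closed_code [set s | F (shift s) /\ P (s 0) (shift s)].
Proof.
move=> cF cP s sP; have Fs : F (shift s).
  apply: cF => n; have [t [Ft _] st] := sP n.+1.
  by exists (shift t) => //; exact: agree_shift.
split => //; apply: cP => // n; have [t [Ft Pt] st] := sP n.+1.
by exists (shift t); [rewrite (agree0 st)|exact: agree_shift].
Qed.

Lemma open_pre_rel_closed (X : Type) F (phi : (nat -> nat) -> X) (E : set X) :
  open_pre F phi (~` E) -> rel_closed F (E \o phi).
Proof.
move=> oE s Fs sE; apply: contrapT => nE.
have [n /= nP] := oE _ Fs nE; have [t [Ft Et] st] := sE n.
exact: nP Ft st Et.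
Qed.

Lemma open_pre_shift (X : Type) F F' (phi : (nat -> nat) -> X) (E : set X) :
  (forall s, F' s -> F (shift s)) -> open_pre F phi E ->
  open_pre F' (phi \o shift) E.
Proof.
move=> FF' oE s Fs Es; have [n nP] := oE _ (FF' _ Fs) Es.
by exists n.+1 => t Ft st; apply: nP; [exact: FF'|exact: agree_shift].
Qed.

Lemma clopen_pre_prefix (X : Type) F' (phi : (nat -> nat) -> X) (E : set X) :
  (forall s, F' s -> (E (phi s) <-> s 0 <> 0)) -> clopen_pre F' phi E.
Proof.
move=> EP; split => s Fs Es; exists 1 => t Ft /agree0 st.
  by apply/(EP _ Ft); rewrite -st; exact/(EP _ Fs).
by move=> /(EP _ Ft); rewrite -st => /(EP _ Fs).
Qed.

End codes.

Section parametrization.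
Local Open Scope nat_scope.
Context (X : Type) (O : set (set X)).
Implicit Types (F : set (nat -> nat)) (phi : (nat -> nat) -> X).
Hypothesis separatedO : forall x y, x <> y ->
  exists A B, [/\ O A, O B, A x, B y & A `&` B = set0].

(** A surjection from a closed set of sequences, continuous for the topology generated by [O]. *)
Definition coding F phi := [/\ closed_code F, phi @` F = setT &
  forall A, O A -> open_pre F phi A].

Definition codable (E : set X) :=
  exists F phi, coding F phi /\ clopen_pre F phi E.

Lemma codable_setC E : codable E -> codable (~` E).
Proof.
by move=> [F [phi [c [e1 e2]]]]; exists F, phi; split => //; split; rewrite ?setCK.
Qed.

(** The label [s 0] certifies in which closed set [P j] the rest of the sequence lies. The image
    does not shrink as long as every sequence has a certificate. *)
Lemma coding_prefix F phi (P : nat -> set (nat -> nat)) :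
  coding F phi -> (forall j, rel_closed F (P j)) ->
  (forall s, F s -> exists j, P j s) ->
  coding [set s | F (shift s) /\ P (s 0) (shift s)] (phi \o shift).
Proof.
move=> [cF surj oF] cP exP; split; first exact: closed_code_prefix.
  apply/seteqP; split => // x _.
  have [s Fs <-] : (phi @` F) x by rewrite surj.
  have [j Pj] := exP _ Fs; by exists (scons j s).
by move=> A OA; apply: open_pre_shift (oF _ OA) => s [].
Qed.

Lemma codable_open F phi A : coding F phi -> O A -> codable A.
Proof.
move=> cd OA; have [cF surj oF] := cd.
pose P (j : nat) : set (nat -> nat) := fun s => if j is k.+1
  then forall t, F t -> agree k s t -> A (phi t) else ~ A (phi s).
exists [set s | F (shift s) /\ P (s 0) (shift s)], (phi \o shift); split.
  apply: coding_prefix => //.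
    case => [|j].
      by apply: (@open_pre_rel_closed _ _ _ (~` A)); rewrite setCK; exact: oF.
    move=> s Fs sP t Ft st; have [u [Fu /(_ t Ft)]] := sP j.
    by move=> + su; apply; exact: agree_trans (agree_sym su) st.
  move=> s Fs; have [As|nAs] := pselect (A (phi s)); last by exists 0.
  by have [n nP] := oF _ OA _ Fs As; exists n.+1.
apply: clopen_pre_prefix => s [/= Fs].
case: (s 0) => [|k] /= sP; split => //.
by move=> _; exact: sP.
Qed.

(** The codings are merged by a fiber product: column m is read by the m-th coding, and all columns
    must give the same point. This is a closed condition because [O] separates points. *)
Lemma codable_family (E : nat -> set X) : (forall n, codable (E n)) ->
  exists F phi, coding F phi /\ forall n, clopen_pre F phi (E n).
Proof.
move=> /choice[F_ /choice[phi_ cE]].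
pose F : set (nat -> nat) := [set s | forall m, F_ m (column m s) /\
  phi_ m (column m s) = phi_ 0 (column 0 s)].
pose phi s := phi_ 0 (column 0 s).
have preF m A : open_pre (F_ m) (phi_ m) A -> open_pre F phi A.
  move=> oA s Fs As; have [Fms eqs] := Fs m.
  have [|n nP] := oA _ Fms; first by rewrite eqs.
  have [k kP] := agree_column m n; exists k => t Ft /kP st.
  by rewrite /phi -(Ft m).2; apply: nP => //; exact: (Ft m).1.
exists F, phi; split; last first.
  by move=> n; have [_ [e1 e2]] := cE n; split; exact: (preF n).
split.
- move=> s sP; have Fs m : F_ m (column m s).
    have [[+ _ _] _] := cE m; apply => n.
    have [k kP] := agree_column m n; have [t Ft st] := sP k.
    by exists (column m t); [exact: (Ft m).1|exact: kP].
  move=> m; split => //; apply: contrapT => /separatedO[A [B [OA OB Am B0 AB]]].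
  have [[_ _ /(_ _ OA _ (Fs m) Am)[n nP]] _] := cE m.
  have [[_ _ /(_ _ OB _ (Fs 0) B0)[n' nP']] _] := cE 0.
  have [k kP] := agree_column m n; have [k' kP'] := agree_column 0 n'.
  have [t Ft st] := sP (maxn k k').
  have : (A `&` B) (phi t).
    split; last first.
      by apply: nP'; [exact: (Ft 0).1|apply/kP'/(agree_le (leq_maxr _ _) st)].
    rewrite /phi -(Ft m).2.
    by apply: nP; [exact: (Ft m).1|apply/kP/(agree_le (leq_maxl _ _) st)].
  by rewrite AB.
- apply/seteqP; split => // x _.
  have /choice[u uP] : forall m, exists s, F_ m s /\ phi_ m s = x.
    move=> m; have [[_ surj _] _] := cE m.
    have [s Fs <-] : (phi_ m @` F_ m) x by rewrite surj.
    by exists s.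
  exists (merge_columns u); last by rewrite /phi column_merge (uP 0).2.
  by move=> m; rewrite !column_merge (uP m).2 (uP 0).2; have [] := uP m.
- by move=> A OA; have [[_ _ /(_ _ OA) h] _] := cE 0; exact: (preF 0).
Qed.

(** Once all [E n] are clopen for one coding, the certificates are closed conditions: 0 for being in
    no [E m], k+1 for being in [E k]. *)
Lemma codable_bigcup (E : nat -> set X) :
  (forall n, codable (E n)) -> codable (\bigcup_n E n).
Proof.
move=> /codable_family[F [phi [cd cE]]].
pose P (j : nat) : set (nat -> nat) := fun s => if j is k.+1
  then E k (phi s) else forall m, ~ E m (phi s).
exists [set s | F (shift s) /\ P (s 0) (shift s)], (phi \o shift); split.
  apply: coding_prefix => //.
    case => [|j]; last by apply: open_pre_rel_closed; have [] := cE j.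
    move=> s Fs sP m; apply: (@open_pre_rel_closed _ F phi (~` E m)) => //.
      by rewrite setCK; have [] := cE m.
    by move=> n; have [t [Ft /(_ m) Pt] st] := sP n; exists t.
  move=> s Fs; have [[m _ Em]|nE] := pselect ((\bigcup_n E n) (phi s)).
    by exists m.+1.
  by exists 0 => m Em; apply: nE; exists m.
apply: clopen_pre_prefix => s [/= Fs].
case: (s 0) => [|k] /= sP; split => //; last by exists k.
by move=> [m _ /sP].
Qed.

Lemma codable_sigma F phi : coding F phi -> <<s O >> `<=` codable.
Proof.
move=> cd; apply: smallest_sub; last by move=> A; exact: codable_open cd.
split; last exact: codable_bigcup.
- exists F, phi; split => //; split => [s Fs []|s Fs _].
  by exists 0 => t _ _ [].
- by move=> A cA; rewrite setTD; exact: codable_setC.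
Qed.

End parametrization.

Lemma countable_enum (T : Type) (A : set T) : countable A -> A !=set0 ->
  exists u : nat -> T, (forall n, A (u n)) /\ forall x, A x -> exists n, u n = x.
Proof.
move=> /countable_injP[f f_inj] [a Aa].
have /choice[u uP] : forall n, exists x, A x /\ forall y, A y -> f y = n -> y = x.
  move=> n; have [[x [Ax fx]]|nx] := pselect (exists x, A x /\ f x = n).
    by exists x; split => // y Ay fy; apply: f_inj; rewrite ?inE// fy.
  by exists a; split => // y Ay fy; exfalso; apply: nx; exists y.
exists u; split => [n|x Ax]; first by have [] := uP n.
by exists (f x); apply/esym; apply: (uP (f x)).2.
Qed.

(** * Polish spaces *)

Section polish.
Context (R : realType) (X : completePseudoMetricType R).
Hypotheses (hX : hausdorff_space X) (cX : @second_countable X).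

Definition rad (n : nat) : R := 2^-1 ^+ n.

Lemma rad_gt0 n : 0 < rad n. Proof. by rewrite exprn_gt0. Qed.

Lemma radS n : rad n = rad n.+1 + rad n.+1.
Proof. by rewrite /rad exprS; lra. Qed.

Lemma rad_lt (e : R) : 0 < e -> exists n, rad n < e.
Proof.
move=> e0; exists (Num.bound e^-1); rewrite /rad exprVn invf_plt ?posrE//.
exact: upper_nthrootP.
Qed.

Lemma dense_sequence :
  exists x : nat -> X, forall y e, 0 < e -> exists i, ball (x i) e y.
Proof.
have [B cB [oB bB]] := cX.
have [u [uB uP]] : exists u : nat -> set X,
    (forall n, B (u n)) /\ forall V, B V -> exists n, u n = V.
  apply: countable_enum => //; have [V [BV _] _] := bB point _ (filterT); by exists V.
have /choice[x xP] : forall n, exists y, u n !=set0 -> u n y.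
  move=> n; have [[y uy]|nu] := pselect (u n !=set0); first by exists y.
  by exists point.
exists x => y e e0; have [V [BV Vy] Ve] := bB y _ (nbhsx_ballx y _ e0).
have [n un] := uP _ BV; exists n; apply/ball_sym/Ve.
by rewrite -un; apply: xP; exists y; rewrite un.
Qed.

Variable x : nat -> X.
Hypothesis dense_x : forall y e, 0 < e -> exists i, ball (x i) e y.

Definition cauchy_code : set (nat -> nat) :=
  [set s | forall n, ball (x (s n)) (rad n) (x (s n.+1))].

(** In a code the terms after the n-th stay within [2 * rad n] of it; the rest of the factor 4 is
    slack for the limit. *)
Definition names s p := forall n, ball (x (s n)) (rad n *+ 4) p.

Lemma names_uniq s p q : names s p -> names s q -> p = q.
Proof.
move=> sp sq; apply: contrapT => /eqP.
move: hX; rewrite ball_hausdorff => /[apply] -[[r1 r2]] /= /eqP r12.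
have [n nr] := @rad_lt (r1%:num / 8%:R) ltac:(by []).
have : (ball p r1%:num `&` ball q r2%:num) q.
  split => //; have := ball_triangle (ball_sym (sp n)) (sq n).
  by apply: le_ball; lra.
by rewrite r12.
Qed.

Lemma cauchy_code_names s : cauchy_code s -> exists p, names s p.
Proof.
move=> cs.
have near_tail k : forall n, ball (x (s n)) (rad n *+ 2) (x (s (n + k)%N)).
  elim: k => [|k IH] n.
    by rewrite addn0; apply: ballxx; rewrite mulrn_wgt0// rad_gt0.
  rewrite addnS -addSn mulr2n {2}(radS n).
  by apply: ball_triangle (cs n) _; rewrite -mulr2n.
have /cauchy_cvg/cvg_ex[p sp] : cauchy ((x \o s) @ \oo).
  apply: cauchy_exP => e e0; have [n nr] := @rad_lt (e / 2) ltac:(by lra).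
  exists (x (s n)); exists n => // m /= nm; rewrite -(subnKC nm).
  by apply: le_ball (near_tail _ _); lra.
exists p => n.
have /(cvg_ball sp)[m _ mP] : 0 < rad n by exact: rad_gt0.
have h1 := near_tail m n; have h2 := mP (n + m)%N (leq_addl _ _).
have := ball_triangle h1 (ball_sym h2).
by apply: le_ball; have := rad_gt0 n; lra.
Qed.

Lemma name_of p : exists2 s, cauchy_code s & names s p.
Proof.
have /choice[s sP] : forall n, exists i, ball (x i) (rad n.+1) p.
  by move=> n; apply: dense_x; exact: rad_gt0.
exists s => n.
  have := ball_triangle (sP n) (ball_sym (sP n.+1)).
  by apply: le_ball; have := radS n; have := radS n.+1; have := rad_gt0 n.+2; lra.
by apply: le_ball (sP n); have := radS n; have := rad_gt0 n.+1; lra.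
Qed.

Lemma open_coding : exists phi : (nat -> nat) -> X,
  (forall s, cauchy_code s -> names s (phi s)) /\
  coding (@open X) cauchy_code phi.
Proof.
have /choice[phi phiP] : forall s, exists p, cauchy_code s -> names s p.
  move=> s; have [/cauchy_code_names[p sp]|ns] := pselect (cauchy_code s).
    by exists p.
  by exists point.
exists phi; split => //; split.
- move=> s sP n; have [t tP st] := sP n.+2.
  by rewrite (st n)// (st n.+1)//; exact: tP.
- apply/seteqP; split => // p _; have [s cs sp] := name_of p.
  by exists s => //; exact: names_uniq (phiP _ cs) sp.
- move=> A oA s cs As.
  have /nbhs_ballP[e /= e0 eA] := open_nbhs_nbhs (conj oA As).
  (* Points named by sequences with the same n-th term are within [8 * rad n] of each other;
     agreement up to [n.+1] includes that term. *)
  have [n nr] := @rad_lt (e / 8%:R) ltac:(by lra).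
  exists n.+1 => t ct st; apply: eA.
  have := ball_triangle (ball_sym (phiP _ cs n)) _.
  move=> /(_ _ _); rewrite (st n)// => /(_ _ _ (phiP _ ct n)).
  by apply: le_ball; lra.
Qed.

Lemma hausdorff_separated (p q : X) : p <> q ->
  exists A B, [/\ open A, open B, A p, B q & A `&` B = set0].
Proof.
move=> /eqP; move: hX; rewrite open_hausdorff => /[apply].
by move=> [[A B] /= [/set_mem Ap /set_mem Bq] [oA oB /eqP AB]]; exists A, B.
Qed.

Lemma codable_borel (E : set X) : borel E -> codable (@open X) E.
Proof.
have [phi [_ cphi]] := open_coding.
exact: (codable_sigma hausdorff_separated cphi).
Qed.

(** The interior is taken because balls of a pseudometric structure need not be open. The radius
    [rad m.+1] makes any two of its points [rad m]-close. *)
Definition base_ball (i m : nat) : set X := (ball (x i) (rad m.+1))°.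

Lemma base_ball_open i m : open (base_ball i m).
Proof. exact: open_interior. Qed.

Lemma base_ball_cover p m : exists i, base_ball i m p.
Proof.
have [i xip] := dense_x p (rad_gt0 m.+2); exists i.
apply/nbhs_ballP; exists (rad m.+2); first exact: rad_gt0.
by move=> q pq; rewrite (radS m.+1); exact: ball_triangle xip pq.
Qed.

Lemma base_ball_sub i m p q : base_ball i m p -> base_ball i m q ->
  ball p (rad m) q.
Proof.
move=> /interior_subset ip /interior_subset iq; rewrite (radS m).
exact: ball_triangle (ball_sym ip) iq.
Qed.

Lemma base_ball_nbhs (A : set X) p : open A -> A p ->
  exists i m, base_ball i m p /\ base_ball i m `<=` A.
Proof.
move=> oA Ap; have /nbhs_ballP[e /= e0 eA] := open_nbhs_nbhs (conj oA Ap).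
have [m me] := rad_lt e0; have [i ip] := base_ball_cover p m.
exists i, m; split => // q iq; apply: eA; apply: le_ball (base_ball_sub ip iq).
exact: ltW.
Qed.

End polish.

Lemma sigma_algebra_measurable_preimage d (Y : measurableType d) (T : Type)
    (Q : set Y) (k : Y -> T) (C : set (set T)) : measurable Q ->
  (forall A, C A -> measurable (Q `&` k @^-1` A)) ->
  forall A, <<s C >> A -> measurable (Q `&` k @^-1` A).
Proof.
move=> mQ mC; apply: smallest_sub => //.
split; first by rewrite /= preimage_set0 setI0.
  move=> A /= mA; rewrite (_ : _ `&` _ = Q `\` (Q `&` k @^-1` A)).
    exact: measurableD.
  apply/seteqP; split => y; first by move=> [Qy [_ nA]]; split => // -[_ /nA].
  by move=> [Qy nA]; split => //; split => // Ay; apply: nA.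
move=> A mA /=; rewrite preimage_bigcup setI_bigcupr.
exact: bigcupT_measurable.
Qed.

(** * Measurable reconstruction of a point from the basic sets that contain it *)

Section inverse_code.
Context (R : realType) (X : completePseudoMetricType R).
Hypotheses (hX : hausdorff_space X).
Variable x : nat -> X.
Hypothesis dense_x : forall y e, 0 < e -> exists i, ball (x i) e y.
Context d (Y : measurableType d) (B : nat -> nat -> set Y).
Hypothesis mB : forall i m, measurable (B i m).

Let D i m := B i m `\` \bigcup_(j in [set j | (j < i)%N]) B j m.

Let mD i m : measurable (D i m).
Proof. by apply: measurableD => //; exact: bigcup_measurable. Qed.

Let Y0 := \bigcap_m \bigcup_i B i m.

Let mY0 : measurable Y0.
Proof. by apply: bigcapT_measurable => m; exact: bigcupT_measurable. Qed.

Let D_uniq i j m y : D i m y -> D j m y -> i = j.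
Proof.
move=> [Bi ni] [Bj nj]; case: (ltngtP i j) => // ij; exfalso.
  by apply: nj; exists i.
by apply: ni; exists j.
Qed.

Let D_ex y m : Y0 y -> exists i, D i m y.
Proof.
move=> /(_ m I)[i _ Bi]; have exB : exists i, `[< B i m y >].
  by exists i; exact/asboolP.
case: (ex_minnP exB) => j /asboolP Bj jmin; exists j; split => // -[k /= kj Bk].
by have := jmin _ (asboolT Bk); rewrite leqNgt kj.
Qed.

(** The inverse is read off from the least index at each scale, so that it is
    measurable as soon as the [B i m] are. *)
Lemma inverse_code : exists (Q : set Y) (k : Y -> X),
  [/\ measurable Q, forall A, borel A -> measurable (Q `&` k @^-1` A) &
      forall y p, (forall i m, base_ball x i m p <-> B i m y) -> Q y /\ k y = p].
Proof.
have [phi [phiN [clF _ cphi]]] := open_coding hX dense_x.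
have /choice[s sP] : forall y, exists s : nat -> nat, Y0 y -> forall m, D (s m) m y.
  move=> y; have [Yy|nY] := pselect (Y0 y); last by exists (fun=> 0%N).
  by have /choice[s sP] := fun m => D_ex m Yy; exists s.
have sE y i m : Y0 y -> s y m = i <-> D i m y.
  move=> Yy; split => [<-|]; first exact: sP.
  by move=> Diy; exact: D_uniq (sP _ Yy m) Diy.
have mS i m : measurable (Y0 `&` [set y | s y m = i]).
  rewrite (_ : _ `&` _ = Y0 `&` D i m); first exact: measurableI.
  by apply/seteqP; split => y [Yy h]; split => //; apply/(sE _ _ _ Yy).
have mW n (P : set (nat -> nat)) : (forall s t, agree n s t -> P s -> P t) ->
    measurable (Y0 `&` [set y | P (s y)]).
  move=> Pn.
  (* A property read on the first n terms splits along finite words, of which there are countably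
     many; a word is padded with 0 beyond its length. *)
  rewrite (_ : _ `&` _ = \bigcup_(w : seq nat) (if `[< P (nth 0%N w) >] then
      Y0 `&` \bigcap_(i in [set i | (i < n)%N]) (Y0 `&` [set y | s y i = nth 0%N w i])
      else set0)).
    apply: countable_bigcupT_measurable => // w; case: ifP => // _.
    by apply: measurableI => //; exact: bigcap_measurableType.
  apply/seteqP; split => y.
    move=> [Yy Py]; exists (mkseq (s y) n) => //; case: asboolP => [_|].
      by split => // i /= ni; rewrite nth_mkseq.
    by case; apply: Pn Py => i ni; rewrite nth_mkseq.
  move=> [w _]; case: asboolP => // Pw [Yy sw]; split => //=.
  by apply: Pn Pw => i ni; have [_ /= ->] := sw i ni.
pose Q := Y0 `&` [set y | cauchy_code x (s y)].
have mQ : measurable Q.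
  rewrite (_ : Q = \bigcap_n (Y0 `&` [set y | [set t : nat -> nat |
      ball (x (t n)) (rad R n) (x (t n.+1))] (s y)])).
    apply: bigcapT_measurable => n; apply: (mW n.+2) => t u tu /=.
    by rewrite !tu.
  apply/seteqP; split => y; first by move=> [Yy cy] n _; split => //; exact: cy.
  by move=> h; split => [|n]; [exact: (h 0%N I).1|exact: (h n I).2].
exists Q, (phi \o s); split => //.
- have kmO A : open A -> measurable (Q `&` (phi \o s) @^-1` A).
    (* By continuity of [phi], the value is in an open set iff some prefix of the code already
       forces it there. *)
    move=> oA; rewrite (_ : _ `&` _ = \bigcup_n (Q `&` (Y0 `&` [set y |
        [set t | forall u, cauchy_code x u -> agree n t u -> A (phi u)] (s y)]))).
      apply: bigcupT_measurable => n; apply: measurableI => //.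
      apply: (mW n) => t u tu /= tP v cv uv.
      by apply: tP => //; exact: agree_trans tu uv.
    apply/seteqP; split => y.
      move=> [Qy Ay]; have [n nP] := cphi _ oA _ Qy.2 Ay.
      by exists n => //; split => //; split => //; exact: Qy.1.
    by move=> [n _ [Qy [_ /(_ _ Qy.2 (fun _ _ => erefl))]]].
  exact: sigma_algebra_measurable_preimage.
- move=> y p pB; have Yy : Y0 y.
    move=> m _; have [i ip] := base_ball_cover dense_x p m.
    by exists i => //; apply/pB.
  have sp m : ball (x (s y m)) (rad R m.+1) p.
    by have [/pB/interior_subset] := sP _ Yy m.
  have cs : cauchy_code x (s y).
    move=> m; have := ball_triangle (sp m) (ball_sym (sp m.+1)).
    apply: le_ball; have := radS R m; have := radS R m.+1.
    by have := rad_gt0 R m.+2; lra.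
  split => //; apply: (names_uniq hX (phiN _ cs)) => m.
  apply: le_ball (sp m); have := radS R m; have := rad_gt0 R m.+1; lra.
Qed.

End inverse_code.

(** * Standard Borel spaces *)

Definition separating (T : Type) (W : nat -> set T) :=
  forall p q, (forall j, W j p <-> W j q) -> p = q.

Section standard_borel_structure.
Context (R : realType) d (T : measurableType d).

(** What is used of a standard Borel space: a generating sequence [W] that
    separates points, codings of Borel sets by closed sets of sequences that
    turn countably many Borel sets into clopen sets, and the fact that the
    image of [T] under the characteristic map of [W] is Borel. *)
Definition standard_sequence (W : nat -> set T) :=
  [/\ forall j, measurable (W j), separating W, measurable `<=` <<s range W>>,
      forall (A : set T) (E : nat -> set T), measurable A ->
        (forall n, measurable (E n)) -> exists F psi,
        [/\ closed_code F, psi @` F = A & forall n, clopen_pre F psi (E n)] &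
      forall d' (Y : measurableType d') (B : nat -> set Y),
        (forall j, measurable (B j)) ->
        measurable [set y | exists t, forall j, W j t <-> B j y]].

(** The [W j] are the traces on [T] of the basic balls of the Polish space. For the last clause,
    [inverse_code] builds the point that the truth values [B j y] would describe, and it remains to
    test that they do describe it. *)
Lemma standard_borel_sequence :
  standard_borel R T -> exists W, standard_sequence W.
Proof.
move=> [X [f [hX cX f_inj fE]]].
have [x dx] := dense_sequence cX.
pose dec j : nat * nat := odflt (0, 0)%N (unpickle j).
have decK i m : dec (pickle (i, m)) = (i, m) by rewrite /dec pickleK.
pose V j : set X := base_ball x (dec j).1 (dec j).2.
have oV j : open (V j) by exact: base_ball_open.
pose W j : set T := f @^-1` V j.
have bE (E : set X) : borel E -> measurable (f @^-1` E).
  move=> bE; apply/fE; rewrite (_ : _ @` _ = E `&` range f).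
    have bT : borel (range f) := (fE setT).1 measurableT.
    exact: (@measurableI _ (g_sigma_algebraType (@open X)) _ _ bE bT).
  apply/seteqP; split => [_ [t Et <-]|_ [/[swap] -[t _ <-] Et]]; first by split => //; exists t.
  by exists t.
have fK (A : set T) : f @^-1` (f @` A) = A.
  by apply/seteqP; split => [t [u Au /f_inj <-]|t At]//; exists t.
exists W; split.
- by move=> j; apply: bE; exact: sub_sigma_algebra.
- move=> p q pq; apply: f_inj; apply: contrapT => /(hausdorff_separated hX).
  move=> [A [B [oA oB Ap Bq AB]]].
  have [i [m [ip iA]]] := base_ball_nbhs dx oA Ap.
  have := pq (pickle (i, m)); rewrite /W /= /V decK /= => -[/(_ ip)/iA Aq _].
  by have : (A `&` B) (f q) by []; rewrite AB.
- move=> A /fE bA; rewrite -(fK A); move: (f @` A) bA => {A}.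
  apply: smallest_sub.
    split; first exact: sigma_algebra0.
      move=> A sA; rewrite setTD preimage_setC; exact: sigma_algebraC.
    by move=> A sA; rewrite preimage_bigcup; exact: sigma_algebra_bigcup.
  move=> A oA; rewrite (_ : _ @^-1` _ =
      \bigcup_j (if `[< V j `<=` A >] then W j else set0)).
    apply: sigma_algebra_bigcup => j; case: ifP => _; last exact: sigma_algebra0.
    by apply: sub_sigma_algebra; exists j.
  apply/seteqP; split => t.
    move=> At; have [i [m [ip iA]]] := base_ball_nbhs dx oA At.
    exists (pickle (i, m)) => //; case: asboolP; last by rewrite /V decK.
    by rewrite /W /= /V decK.
  by move=> [j _]; case: asboolP => // VA /VA.
- move=> A E mA mE.
  (* The image of [A] is made clopen as well, at index 0, so that the code stays closed when
     restricted to it. *)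
  pose E' n := if n is m.+1 then f @` E m else f @` A.
  have [n|F [phi [[cF sF _] cE]]] := codable_family (hausdorff_separated hX) (E := E').
    by apply: (codable_borel hX dx); case: n => [|n]; apply/fE.
  have /choice[psi psiP] : forall s, exists t, range f (phi s) -> f t = phi s.
    move=> s; have [[t _ <-]|nf] := pselect (range f (phi s)); first by exists t.
    by exists point.
  have psiA s : (f @` A) (phi s) -> f (psi s) = phi s.
    by move=> [t _ ft]; apply: psiP; exists t.
  exists (F `&` phi @^-1` (f @` A)), psi; split.
  + move=> s sP; have Fs : F s.
      by apply: cF => n; have [t [Ft _] st] := sP n; exists t.
    by split => //; apply: (open_pre_rel_closed (cE 0%N).2).
  + apply/seteqP; split.
      move=> _ [s [Fs /= As] <-].
      by have := psiA _ As; case: As => t At <- /f_inj ->.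
    move=> t At; have [s Fs ps] : (phi @` F) (f t) by rewrite sF.
    have As : (f @` A) (phi s) by rewrite ps; exists t.
    by exists s; [split|apply: f_inj; rewrite psiA].
  + have EP n s : (f @` A) (phi s) -> (E n (psi s) <-> E' n.+1 (phi s)).
      move=> As; rewrite -(psiA _ As); split => [Es|[t Et /f_inj <-]]//.
      by exists (psi s).
    move=> n; have [e1 e2] := cE n.+1; split => s [Fs As] Es.
      have /(e1 _ Fs)[m mP] : E' n.+1 (phi s) by exact/EP.
      by exists m => t [Ft At] st; apply/EP => //; exact: mP.
    have /(e2 _ Fs)[m mP] : ~ E' n.+1 (phi s) by move/EP => /(_ As).
    by exists m => t [Ft At] st /EP => /(_ At); exact: mP.
- move=> d' Y B mB.
  have [Q [k [mQ mk kP]]] := @inverse_code R X hX x dx d' Y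
    (fun i m => B (pickle (i, m))) (fun i m => mB _).
  (* The point [k y] is only a candidate: it must come from [T], and lie in exactly those basic sets
     that the [B j] prescribe. *)
  rewrite (_ : [set y | _] = (Q `&` k @^-1` (range f)) `&`
      \bigcap_j ((Q `&` k @^-1` V j) `&` B j `|` (Q `&` k @^-1` (~` V j)) `&` ~` B j)).
    apply: measurableI; first by apply: mk; exact/fE.
    apply: bigcapT_measurable => j; apply: measurableU; apply: measurableI => //.
    + by apply: mk; exact: sub_sigma_algebra.
    + by apply: mk; apply: sigma_algebraC; exact: sub_sigma_algebra.
    + exact: measurableC.
  apply/seteqP; split => y.
    move=> [t tP]; have [|Qy ky] := kP y (f t).
      by move=> i m; have := tP (pickle (i, m)); rewrite /W /= /V decK.
    split; first by split => //=; exists t.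
    move=> j _; have := tP j; rewrite /W /=.
    by have [Bj|nBj] := pselect (B j y) => ?; [left|right]; split => //; split => //=;
      rewrite ky; tauto.
  move=> [[Qy [t _ ft]] h]; exists t => j.
  rewrite /W /= ft; have [] := h j I; move=> [[_ /=]]; tauto.
Qed.

End standard_borel_structure.

(** * Analytic sets *)

Section analytic.
Context d (T : measurableType d) (W : nat -> set T).
Hypothesis stdW : standard_sequence W.

Let mW j : measurable (W j). Proof. by have [] := stdW. Qed.
Let sepW : separating W. Proof. by have [] := stdW. Qed.

(** A continuous image of a closed set of integer sequences, for the topology in which the [W j] are
    clopen. *)
Definition analytic (A : set T) := exists F phi,
  [/\ closed_code F, phi @` F = A & forall j, clopen_pre F phi (W j)].

Lemma measurable_analytic A : measurable A -> analytic A.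
Proof. by move=> mA; have [_ _ _ code _] := stdW; exact: code. Qed.

Lemma separated_points (p q : T) : p <> q ->
  exists j, W j p /\ ~ W j q \/ ~ W j p /\ W j q.
Proof.
move=> pq; apply: contrapT => nj; apply: pq; apply: sepW => j.
by apply: contrapT => h; apply: nj; exists j;
  have [|] := pselect (W j p); have [|] := pselect (W j q); tauto.
Qed.

(** Pairs of codes with equal values form a closed set because the clopen [W j] separate points. The
    last clause concerns any set, not only the [W j], so that preimages under a map can be followed
    too. *)
Lemma fiber_product F1 F2 (phi1 phi2 : (nat -> nat) -> T) :
  closed_code F1 -> (forall j, clopen_pre F1 phi1 (W j)) ->
  closed_code F2 -> (forall j, clopen_pre F2 phi2 (W j)) ->
  exists F phi, [/\ closed_code F, phi @` F = phi1 @` F1 `&` phi2 @` F2 &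
    forall A, clopen_pre F2 phi2 A -> clopen_pre F phi A].
Proof.
move=> cF1 c1 cF2 c2.
pose c (k : nat) (s : nat -> nat) := column k s.
pose F : set (nat -> nat) := [set s | [/\ F1 (c 0%N s), F2 (c 1%N s) &
  phi1 (c 0%N s) = phi2 (c 1%N s)]].
have pre1 A : open_pre F1 phi1 A -> forall s, F s -> A (phi2 (c 1%N s)) ->
    exists n, forall t, F1 (c 0%N t) -> agree n s t -> A (phi1 (c 0%N t)).
  move=> oA s [Fs1 _ e] As; have [|n nP] := oA _ Fs1; first by rewrite e.
  have [k kP] := agree_column 0%N n.
  by exists k => t F1t /kP; exact: nP.
have pre2 A : open_pre F2 phi2 A -> open_pre F (phi2 \o c 1%N) A.
  move=> oA s [_ Fs2 _] As; have [n nP] := oA _ Fs2 As.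
  have [k kP] := agree_column 1%N n.
  by exists k => t [_ F2t _] /kP; exact: nP.
exists F, (phi2 \o c 1%N); split; last first.
- by move=> A [e1 e2]; split; exact: pre2.
- apply/seteqP; split => [_ [s [Fs1 Fs2 e] <-]|_ [[s Fs <-] [t Ft e]]].
    by split; [exists (c 0%N s)|exists (c 1%N s)].
  exists (merge_columns (fun k => if k == 0%N then s else t)).
    by rewrite /F /= /c !column_merge /=; split.
  by rewrite /= /c column_merge.
- move=> s sP.
  have Fs1 : F1 (c 0%N s).
    apply: cF1 => n; have [k kP] := agree_column 0%N n.
    by have [t [F1t _ _] /kP st] := sP k; exists (c 0%N t).
  have Fs2 : F2 (c 1%N s).
    apply: cF2 => n; have [k kP] := agree_column 1%N n.
    by have [t [_ F2t _] /kP st] := sP k; exists (c 1%N t).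
  split => //; apply: contrapT => /separated_points[j sj].
  have [V [V1 V2 [h1 h2]]] : exists V : set T, [/\ V (phi1 (c 0%N s)),
      ~ V (phi2 (c 1%N s)) & open_pre F1 phi1 V /\ open_pre F2 phi2 (~` V)].
    case: sj => -[w1 w2]; [exists (W j)|exists (~` W j)]; split => //.
    + by have [? _] := c1 j; have [_ ?] := c2 j.
    + by rewrite setCK; have [_ ?] := c1 j; have [? _] := c2 j.
  have [n nP] := h1 _ Fs1 V1; have [m mP] := h2 _ Fs2 V2.
  have [k kP] := agree_column 0%N n; have [l lP] := agree_column 1%N m.
  have [t [F1t F2t e] st] := sP (maxn k l).
  apply: (mP (c 1%N t)) => //; first by apply/lP/(agree_le (leq_maxr _ _) st).
  by rewrite -e; apply: nP => //; apply/kP/(agree_le (leq_maxl _ _) st).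
Qed.

Lemma analyticI A B : analytic A -> analytic B -> analytic (A `&` B).
Proof.
move=> [F1 [phi1 [cF1 <- c1]]] [F2 [phi2 [cF2 <- c2]]].
have [F [phi [cF e c]]] := fiber_product cF1 c1 cF2 c2.
by exists F, phi; split => // j; exact: c.
Qed.

Lemma analytic_bigcup (A : nat -> set T) :
  (forall n, analytic (A n)) -> analytic (\bigcup_n A n).
Proof.
move=> /choice[F_ /choice[phi_ cA]].
exists [set s | F_ (s 0%N) (shift s)], (fun s => phi_ (s 0%N) (shift s)); split.
- move=> s sP /=; have [+ _ _] := cA (s 0%N); apply => n.
  have [t /= Ft st] := sP n.+1; exists (shift t); last exact: agree_shift.
  by rewrite (agree0 st).
- apply/seteqP; split => [_ [s Fs <-]|p [n _]].
    by exists (s 0%N) => //; have [_ <- _] := cA (s 0%N); exists (shift s).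
  by have [_ <- _] := cA n => -[s Fs <-]; exists (scons n s).
- move=> j; have h V : (forall n, open_pre (F_ n) (phi_ n) V) -> open_pre
      [set s | F_ (s 0%N) (shift s)] (fun s => phi_ (s 0%N) (shift s)) V.
    move=> oV s /= Fs Vs; have [n nP] := oV _ _ Fs Vs.
    exists n.+1 => t /= Ft st; move: (Ft); rewrite -(agree0 st) => Ft'.
    by apply: nP => //; exact: agree_shift.
  by split; apply: h => n; have [_ _ /(_ j)[]] := cA n.
Qed.

(** A code of the whole space is chosen for which the [W j], at odd indices, and their preimages
    under [f], at even ones, are clopen. Over it [f] becomes continuous, and the fiber product
    restricts it to [A]. *)
Lemma analytic_image (f : T -> T) A : measurable_fun setT f ->
  analytic A -> analytic (f @` A).
Proof.
move=> mf [F1 [phi1 [cF1 <- c1]]].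
pose E n := if odd n then W n./2 else f @^-1` W n./2.
have mE n : measurable (E n).
  by rewrite /E; case: ifP => // _; rewrite -[X in measurable X]setTI; exact: mf.
have [_ _ _ code _] := stdW.
have [F2 [phi2 [cF2 s2 c2]]] := code setT E measurableT mE.
have c2W j : clopen_pre F2 phi2 (W j).
  by have := c2 j.*2.+1; rewrite /E /= odd_double /= uphalf_double.
have [F [phi [cF e c]]] := fiber_product cF1 c1 cF2 c2W.
exists F, (f \o phi); split => //; first by rewrite -image_comp e s2 setIT.
by move=> j; have := c _ (c2 j.*2); rewrite /E odd_double doubleK.
Qed.

Definition separable (A B : set T) :=
  exists C, [/\ measurable C, A `<=` C & B `&` C = set0].

(** Used backwards: if two unions cannot be separated, then neither can some pair of their
    members. *)
Lemma separable_bigcup (A B : nat -> set T) :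
  (forall i j, separable (A i) (B j)) ->
  separable (\bigcup_i A i) (\bigcup_j B j).
Proof.
move=> h.
have /choice[C CP] : forall i, exists C : nat -> set T, forall j,
    [/\ measurable (C j), A i `<=` C j & B j `&` C j = set0].
  move=> i; have := h i; rewrite /separable => /choice[C CP]; by exists C.
exists (\bigcup_i \bigcap_j C i j); split.
- by apply: bigcupT_measurable => i; apply: bigcapT_measurable => j;
    have [] := CP i j.
- by move=> p [i _ Ap]; exists i => // j _; have [_ + _] := CP i j; exact.
- rewrite -subset0 => p [[j _ Bp] [i _ /(_ j I) Cp]].
  by have [_ _ <-] := CP i j.
Qed.

Definition cylinder F n (s : nat -> nat) := F `&` [set t | agree n s t].

Definition upd n (s : nat -> nat) k : nat -> nat :=
  fun i => if (i < n)%N then s i else k.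

Lemma agree_upd n s k : agree n s (upd n s k).
Proof. by move=> i ni; rewrite /upd ni. Qed.

Lemma cylinder0 F s : cylinder F 0 s = F.
Proof. by apply/seteqP; split => [t []|t]. Qed.

Lemma cylinder_split F n s :
  cylinder F n s = \bigcup_k cylinder F n.+1 (upd n s k).
Proof.
apply/seteqP; split => [t [Ft st]|t [k _ [Ft st]]].
  exists (t n) => //; split => // i; rewrite ltnS leq_eqVlt => /orP[/eqP->|ni].
    by rewrite /upd ltnn.
  by rewrite -agree_upd// st.
split => //; apply: agree_trans (agree_upd s k) _.
exact: agree_le (leqnSn n) st.
Qed.

(** As [P] fails for the empty set, no cylinder along [s] is empty, and [F] is closed. *)
Lemma cylinder_nonempty F (phi : (nat -> nat) -> T) s (P : set T -> Prop) :
  closed_code F -> ~ P set0 -> (forall n, P (phi @` cylinder F n s)) -> F s.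
Proof.
move=> cF nP0 Ps; apply: cF => n; apply: contrapT => ne.
apply: nP0; rewrite (_ : set0 = phi @` cylinder F n s)//.
by rewrite (_ : cylinder _ _ _ = set0) ?image_set0// -subset0 => t [Ft st];
  apply: ne; exists t.
Qed.

(** If no Borel set separates them, splitting again and again gives two branches along which the
    cylinders have inseparable images. The limits name distinct points, which some [W j] tells
    apart; by continuity it also separates the images of long enough cylinders. *)
Lemma lusin_separation A B :
  analytic A -> analytic B -> A `&` B = set0 -> separable A B.
Proof.
move=> [F1 [phi1 [cF1 <- c1]]] [F2 [phi2 [cF2 <- c2]]] AB.
apply: contrapT => nsep.
pose P n (st : (nat -> nat) * (nat -> nat)) := ~ separable
  (phi1 @` cylinder F1 n st.1) (phi2 @` cylinder F2 n st.2).
have [||f fP] := @dependent_choice_nat _ P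
    (fun n st st' => agree n st.1 st'.1 /\ agree n st.2 st'.2)
    (fun=> 0%N, fun=> 0%N).
- by rewrite /P /= !cylinder0.
- move=> n [s t] /= nst; apply: contrapT => ne; apply: nst => /=.
  rewrite !cylinder_split !image_bigcup; apply: separable_bigcup => i j.
  apply: contrapT => nij; apply: ne; exists (upd n s i, upd n t j) => //.
  by split; exact: agree_upd.
have a1 := agree_limit leqnn leqnSn (fun n => (fP n).2.1).
have a2 := agree_limit leqnn leqnSn (fun n => (fP n).2.2).
move: a1 a2; set s := fun i => _; set t := fun i => (f i.+1).2 i => a1 a2.
have nsep_st n : ~ separable (phi1 @` cylinder F1 n s) (phi2 @` cylinder F2 n t).
  suff cE F u v : agree n u v -> cylinder F n u = cylinder F n v.
    by rewrite -(cE _ _ _ (a1 n)) -(cE _ _ _ (a2 n)); exact: (fP n).1.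
  move=> uv; apply/seteqP; split => w [Fw aw]; split => //.
    exact: agree_trans (agree_sym uv) aw.
  exact: agree_trans uv aw.
have Fs : F1 s.
  apply: (@cylinder_nonempty _ phi1 _ (fun A => exists B, ~ separable A B)) => //.
    by move=> [C]; apply; exists set0; split => //; rewrite setI0.
  by move=> n; exists (phi2 @` cylinder F2 n t).
have Ft : F2 t.
  apply: (@cylinder_nonempty _ phi2 _ (fun B => exists A, ~ separable A B)) => //.
    by move=> [C]; apply; exists setT; split => //; rewrite set0I.
  by move=> n; exists (phi1 @` cylinder F1 n s).
have /separated_points[j sj] : phi1 s <> phi2 t.
  move=> e; have : (phi1 @` F1 `&` phi2 @` F2) (phi1 s).
    by split; [exists s|rewrite e; exists t].
  by rewrite AB.
have [V [mV V1 V2 [h1 h2]]] : exists V : set T, [/\ measurable V, V (phi1 s),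
    ~ V (phi2 t) & open_pre F1 phi1 V /\ open_pre F2 phi2 (~` V)].
  case: sj => -[w1 w2]; [exists (W j)|exists (~` W j)]; split => //.
  + by have [? _] := c1 j; have [_ ?] := c2 j.
  + exact: measurableC.
  + by rewrite setCK; have [_ ?] := c1 j; have [? _] := c2 j.
have [n nP] := h1 _ Fs V1; have [m mP] := h2 _ Ft V2.
apply: (nsep_st (maxn n m)); exists V; split => //.
  move=> _ [u [Fu su] <-]; apply: nP => //; exact: agree_le (leq_maxl _ _) su.
rewrite -subset0 => _ [[u [Fu tu] <-]]; apply: mP => //.
exact: agree_le (leq_maxr _ _) tu.
Qed.

Lemma measurable_fun_generated d' (Y : measurableType d') (Q : set Y) (k : Y -> T) :
  measurable Q -> (forall j, measurable (Q `&` k @^-1` W j)) ->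
  measurable_fun Q k.
Proof.
move=> mQ mk _ A mA; have [_ _ /(_ A mA) gA _ _] := stdW.
by apply: sigma_algebra_measurable_preimage gA => // _ [j _ <-].
Qed.

(** Injectivity makes the images of the parts of [A] inside and outside [W j] disjoint analytic
    sets. A Borel separator [B j] then reads on [f p] whether [p] is in [W j]. *)
Lemma injective_separators (f : T -> T) A : measurable_fun setT f -> analytic A ->
  set_inj A f -> exists B : nat -> set T, (forall j, measurable (B j)) /\
    forall p j, A p -> (W j p <-> B j (f p)).
Proof.
move=> mf aA f_inj.
have aAV V : measurable V -> analytic (f @` (A `&` V)).
  by move=> mV; apply: analytic_image => //; apply: analyticI => //;
    exact: measurable_analytic.
have /choice[B BP] : forall j, separable (f @` (A `&` W j)) (f @` (A `&` ~` W j)).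
  move=> j; apply: lusin_separation.
  - exact: aAV.
  - by apply: aAV; exact: measurableC.
  - rewrite -subset0 => _ [[p [Ap Wp] <-] [q [Aq nWq] qp]].
    by apply: nWq; rewrite (f_inj _ _ _ _ qp)// inE.
exists B; split => [j|p j Ap]; first by have [] := BP j.
have [_ fW fN] := BP j; split => [Wp|Bp]; first by apply: fW; exists p.
apply: contrapT => nW; have : (f @` (A `&` ~` W j) `&` B j) (f p).
  by split => //; exists p.
by rewrite fN.
Qed.

Lemma lusin_souslin (f : T -> T) A : measurable_fun setT f -> measurable A ->
  set_inj A f -> measurable (f @` A).
Proof.
move=> mf mA f_inj.
have [B [mB fB]] := injective_separators mf (measurable_analytic mA) f_inj.
pose Q := [set y | exists t, forall j, W j t <-> B j y].
have mQ : measurable Q by have [_ _ _ _] := stdW; apply.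
have /choice[k kP] : forall y, exists t, Q y -> forall j, W j t <-> B j y.
  by move=> y; have [[t tP]|nQ] := pselect (Q y); [exists t|exists point].
have mk : measurable_fun Q k.
  apply: measurable_fun_generated => // j.
  rewrite (_ : _ `&` _ = Q `&` B j); first exact: measurableI.
  by apply/seteqP; split => y [Qy] /=; have := kP y Qy j; tauto.
have mfk : measurable_fun Q (f \o k).
  exact: (@measurableT_comp _ _ _ _ _ _ f).
(* On [Q], [k] rebuilds the only point compatible with the [B j]. The image consists of the points
   that [k] sends into [A] and [f] then sends back, which is tested on the separating sequence. *)
rewrite (_ : f @` A = (Q `&` k @^-1` A) `&`
    \bigcap_j ((Q `&` (f \o k) @^-1` W j) `&` W j `|`
               (Q `&` (f \o k) @^-1` (~` W j)) `&` ~` W j)).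
  apply: measurableI; first exact: mk.
  apply: bigcapT_measurable => j; apply: measurableU; apply: measurableI => //.
  - exact: mfk.
  - by apply: mfk => //; exact: measurableC.
  - exact: measurableC.
apply/seteqP; split => [_ [p Ap <-]|y].
  have Qf : Q (f p) by exists p => j; exact: fB.
  have kf : k (f p) = p by apply: sepW => j; rewrite (kP _ Qf j) (fB p j Ap).
  split; first by split => //=; rewrite kf.
  move=> j _; have [Wj|nW] := pselect (W j (f p)); [left|right]; split => //;
    split => //=; by rewrite kf.
move=> [[Qy Ay] h]; exists (k y) => //; apply: sepW => j.
by have [[[_ /=]]|[[_ /=]]] := h j I; tauto.
Qed.

End analytic.

(** * The Lusin-Novikov theorem modulo null sets *)

Section mod_null.
Context d (T : measurableType d) (R : realType) (mu : {measure set T -> \bar R}).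
Hypothesis finmu : (mu setT < +oo)%E.

Lemma finite_measure_fin_num A : measurable A -> mu A \is a fin_num.
Proof.
move=> mA; rewrite ge0_fin_numE//; apply: le_lt_trans finmu.
by apply: le_measure; rewrite ?inE//; exact: measurableT.
Qed.

Lemma null_bigcup (A : nat -> set T) : (forall n, measurable (A n)) ->
  (forall n, mu (A n) = 0%E) -> mu (\bigcup_n A n) = 0%E.
Proof.
move=> mA A0; apply: measure_negligible; first exact: bigcupT_measurable.
by apply: negligible_bigcup => n; exists (A n); split.
Qed.

Lemma nullU A B : measurable A -> measurable B -> mu A = 0%E -> mu B = 0%E ->
  mu (A `|` B) = 0%E.
Proof.
move=> mA mB A0 B0; rewrite -bigcup2E; apply: null_bigcup.
  by move=> [|[|n]] /=.
by move=> [|[|n]] //=; rewrite measure0.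
Qed.

Lemma null_bigcup_count (I : countType) (A : I -> set T) :
  (forall n, measurable (A n)) -> (forall n, mu (A n) = 0%E) ->
  mu (\bigcup_n A n) = 0%E.
Proof.
move=> mA A0; rewrite (_ : \bigcup_n A n =
  \bigcup_n (if @unpickle I n is Some i then A i else set0)).
  by apply: null_bigcup => n; case: unpickle.
apply/seteqP; split => [t [i _ Ai]|t [n _]]; first by exists (pickle i); rewrite ?pickleK.
by case: unpickle => // i Ai; exists i.
Qed.

(** Exhaustion: a countable union of members whose measures tend to the supremum attains it, so that
    no positive measure can be added. *)
Lemma maximal_mod_null (E : set (set T)) : E `<=` measurable -> E set0 ->
  (forall D : nat -> set T, (forall n, E (D n)) -> E (\bigcup_n D n)) ->
  exists2 D, E D & forall A, E A -> mu (A `\` D) = 0%E.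
Proof.
move=> mE E0 Ecup.
pose V := [set fine (mu A) | A in E].
have supV : has_sup V.
  split; first by exists (fine (mu set0)); exists set0.
  exists (fine (mu setT)) => _ [A EA <-]; have mA := mE _ EA.
  by apply: fine_le; rewrite ?finite_measure_fin_num// le_measure// inE//;
    exact: measurableT.
have /choice[D DP] : forall n, exists A, E A /\ sup V - rad R n < fine (mu A).
  move=> n; have [_ [A EA <-] sA] := sup_adherent (rad_gt0 R n) supV.
  by exists A.
have ED : E (\bigcup_n D n) by apply: Ecup => n; have [] := DP n.
exists (\bigcup_n D n) => // A EA; set D' := \bigcup_n D n in ED *.
have [mA mD] := (mE _ EA, mE _ ED).
have mAD : measurable (A `\` D') by exact: measurableD.
have EAD : E ((A `\` D') `|` D').
  rewrite (_ : _ `|` _ = \bigcup_n (if n is n'.+1 then D n' else A)).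
    by apply: Ecup => -[|n] //; have [] := DP n.
  apply/seteqP; split => t.
    by move=> [[At _]|[n _ Dt]]; [exists 0%N|exists n.+1].
  have [Dt|nD] := pselect (D' t); first by right.
  by move=> [[|n] _ h]; [left|case: nD; exists n].
have leV A' : E A' -> fine (mu A') <= sup V.
  by move=> EA'; apply: (sup_upper_bound supV); exists A'.
have := leV _ EAD; rewrite measureU//; last by rewrite setDE -setIA setICl setI0.
rewrite fineD ?finite_measure_fin_num// => le_sup.
have D'sup n : sup V - rad R n <= fine (mu D').
  have [EDn /ltW/le_trans] := DP n; apply.
  apply: fine_le; rewrite ?finite_measure_fin_num//; first exact: mE.
  rewrite le_measure// ?inE//; first exact: mE.
  by move=> t Dt; exists n.
have AD0 n : fine (mu (A `\` D')) <= rad R n.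
  by have := D'sup n; lra.
apply/eqP; rewrite eq_le measure_ge0 andbT.
rewrite -(fineK (finite_measure_fin_num mAD)) lee_fin leNgt; apply/negP.
by move=> /(@rad_lt R)[n]; rewrite ltNge AD0.
Qed.

(** The complement of a largest measurable set, modulo null sets, among those disjoint from [E]. *)
Lemma measurable_hull (E : set T) : exists H, [/\ measurable H, E `<=` H &
  forall B, measurable B -> E `<=` B -> mu (H `\` B) = 0%E].
Proof.
have [|||D [mD DE] Dmax] := @maximal_mod_null
    [set D | measurable D /\ D `&` E = set0].
- by move=> D [].
- by split => //; rewrite set0I.
- move=> D DP; split; first by apply: bigcupT_measurable => n; have [] := DP n.
  by rewrite setI_bigcupl bigcup0// => n _; have [] := DP n.
exists (~` D); split; first exact: measurableC.
  by move=> t Et Dt; have : (D `&` E) t by []; rewrite DE.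
move=> B mB EB; rewrite setDE setIC -setDE; apply: Dmax; split.
  exact: measurableC.
by rewrite -subset0 => t [nB /EB].
Qed.

End mod_null.

Section analytic_measure.
Context d (T : measurableType d) (W : nat -> set T).
Hypothesis stdW : standard_sequence W.
Context (R : realType) (mu : {measure set T -> \bar R}).
Hypothesis finmu : (mu setT < +oo)%E.

Let mW j : measurable (W j). Proof. by have [] := stdW. Qed.

Definition piece F (phi : (nat -> nat) -> T) (w : seq nat) : set T :=
  phi @` cylinder F (size w) (nth 0%N w).

Lemma piece_rcons F phi w : piece F phi w = \bigcup_k piece F phi (rcons w k).
Proof.
rewrite /piece cylinder_split image_bigcup; apply: eq_bigcupr => k _.
rewrite size_rcons; congr (_ @` _); apply/seteqP; split => t [Ft wt]; split => //;
  by move=> i iw; rewrite -wt// /upd nth_rcons; move: iw; rewrite ltnS leq_eqVlt;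
    case: ltngtP.
Qed.

(** A point of the hull of [A] that avoids the null sets lost at each splitting
    of a piece selects a branch, whose value it is. *)
Lemma analytic_measurable A : analytic W A -> exists B Z,
  [/\ measurable B, measurable Z, mu Z = 0%E, B `<=` A & A `<=` B `|` Z].
Proof.
move=> [F [phi [cF <- cW]]].
pose C := piece F phi.
have /choice[H0 H0P] := fun w => measurable_hull finmu (C w).
pose cl w := \bigcap_j ((if `[< C w `<=` W j >] then W j else setT) `&`
  (if `[< C w `<=` ~` W j >] then ~` W j else setT)).
pose H w := H0 w `&` cl w.
have mcl w : measurable (cl w).
  apply: bigcapT_measurable => j; apply: measurableI.
    by case: ifP => // _; exact: measurableT.
  by case: ifP => // _; exact: measurableC.
have mH w : measurable (H w) by apply: measurableI => //; have [] := H0P w.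
have CH w : C w `<=` H w.
  move=> t Ct; split; first by have [_ + _] := H0P w; apply.
  by move=> j _; split; case: asboolP => // CW; exact: CW.
(* The sets [H] of the subpieces cover the piece, so by minimality of its hull they miss only a null
   part of [H w]. *)
pose Z := \bigcup_w (H w `\` \bigcup_k H (rcons w k)).
have mZw w : measurable (H w `\` \bigcup_k H (rcons w k)).
  by apply: measurableD => //; exact: bigcupT_measurable.
have mZ : measurable Z by exact: countable_bigcupT_measurable.
have Z0 : mu Z = 0%E.
  apply: null_bigcup_count => // w; have [mH0 _ H0m] := H0P w.
  have mU : measurable (\bigcup_k H (rcons w k)) by exact: bigcupT_measurable.
  apply: subset_measure0 (H0m _ mU _) => //; first exact: measurableD.
    by apply: setSD => t [].
  by rewrite /C piece_rcons; apply: subset_bigcup => k _; exact: CH.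
have C0 : C [::] = phi @` F by rewrite /C /piece cylinder0.
exists (H [::] `\` Z), Z; split => //; first exact: measurableD.
  move=> y [Hy nZ].
  pose P n (w : seq nat) := size w = n /\ H w y.
  have [||w wP] := @dependent_choice_nat _ P
    (fun n w w' => exists k, w' = rcons w k) [::].
  - by split.
  - move=> n w [sw Hw].
    have [[k _ Hk]|nk] := pselect ((\bigcup_k H (rcons w k)) y).
      by exists (rcons w k); [rewrite /P size_rcons sw|exists k].
    by exfalso; apply: nZ; exists w.
  pose s := fun i => nth 0%N (w i.+1) i.
  have sw k : agree k (nth 0%N (w k)) s.
    apply: (@agree_limit (fun k => nth 0%N (w k)) id) => // {}k.
    have [[sk _] [a ->]] := wP k.
    by move=> i ik; rewrite nth_rcons sk ik.
  have CwE k : C (w k) = phi @` cylinder F k s.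
    rewrite /C /piece; have [[-> _] _] := wP k; congr (_ @` _).
    apply/seteqP; split => t [Ft wt]; split => //.
      exact: agree_trans (agree_sym (sw k)) wt.
    exact: agree_trans (sw k) wt.
  have ycl k j : (C (w k) `<=` W j -> W j y) /\ (C (w k) `<=` ~` W j -> ~ W j y).
    have [[_ [_ /(_ j I)[h1 h2]]] _] := wP k.
    by split => h; [move: h1|move: h2]; case: asboolP.
  have Fs : F s.
    (* An empty piece would lie both inside and outside [W 0], and so would [y]. *)
    apply: (@cylinder_nonempty _ _ F phi s (fun A => A !=set0)) => //.
      by move=> [].
    move=> k; rewrite -CwE; apply/set0P/negP => /eqP C0k.
    have [h1 h2] := ycl k 0%N; rewrite C0k in h1 h2.
    by apply: h2; [move=> ? []|apply: h1 => ? []].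
  exists s => //; apply: contrapT => /(separated_points stdW)[j].
  have [e1 e2] := cW j.
  move=> [[w1 w2]|[w1 w2]].
    have [n nP] := e1 _ Fs w1; have [h1 _] := ycl n j.
    by apply: w2; apply: h1; rewrite CwE => _ [t [Ft st] <-]; exact: nP.
  have [n nP] := e2 _ Fs w1; have [_ h1] := ycl n j.
  by apply: (h1 _ w2); rewrite CwE => _ [t [Ft st] <-]; exact: nP.
move=> t; rewrite -C0 => /CH Ht.
by have [Zt|nZ] := pselect (Z t); [right|left].
Qed.

End analytic_measure.

Section lusin_novikov.
Context d (T : measurableType d) (W : nat -> set T).
Hypothesis stdW : standard_sequence W.
Variable f : T -> T.
Hypothesis mf : measurable_fun setT f.

Let mW j : measurable (W j). Proof. by have [] := stdW. Qed.

Let mfW j : measurable (f @^-1` W j).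
Proof. by rewrite -[X in measurable X]setTI; exact: mf. Qed.

Definition section_cover (E : set T) := exists A : nat -> set T,
  (forall n, measurable (A n) /\ set_inj (A n) f) /\ E `<=` \bigcup_n A n.

Lemma section_cover_sub E E' :
  E `<=` E' -> section_cover E' -> section_cover E.
Proof.
by move=> EE' [A [mA AE']]; exists A; split => //; exact: subset_trans AE'.
Qed.

Lemma section_cover_bigcup (I : countType) (E : I -> set T) :
  (forall n, section_cover (E n)) -> section_cover (\bigcup_n E n).
Proof.
move=> /choice[A AP].
exists (fun n => if @unpickle (I * nat)%type n is Some ij then A ij.1 ij.2 else set0).
split=> [n|t [i _ Ei]].
  case: unpickle => [[i j]|]; first by have [] := AP i.
  by split => // x y; rewrite inE.
have [_ /(_ _ Ei)[j _ Aj]] := AP i.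
by exists (pickle (i, j)) => //; rewrite pickleK.
Qed.

Lemma section_cover1 A : measurable A -> set_inj A f -> section_cover A.
Proof. by move=> mA iA; exists (fun=> A); split => // t At; exists 0%N. Qed.

Lemma section_coverU A B :
  section_cover A -> section_cover B -> section_cover (A `|` B).
Proof.
move=> cA cB; apply: (@section_cover_sub _ (\bigcup_b if b then A else B)).
  by move=> t [At|Bt]; [exists true|exists false].
by apply: section_cover_bigcup => -[].
Qed.

(** The points whose membership in every [W j] is correctly read by [B j] on their image form a
    Borel set that contains [E], and [f] is injective on it because [W] separates points. *)
Lemma analytic_section E : analytic W E -> set_inj E f -> section_cover E.
Proof.
move=> aE f_inj; have [B [mB fB]] := injective_separators stdW mf aE f_inj.
pose C := [set q | forall j, W j q <-> B j (f q)].
have mC : measurable C.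
  rewrite (_ : C = \bigcap_j (W j `&` f @^-1` B j `|` ~` W j `&` f @^-1` (~` B j))).
    apply: bigcapT_measurable => j; apply: measurableU; apply: measurableI => //.
    - by rewrite -[X in measurable X]setTI; exact: mf.
    - exact: measurableC.
    - by rewrite -[X in measurable X]setTI; apply: mf => //; exact: measurableC.
  apply/seteqP; split => q Cq j.
    by have [Wj|nWj] := pselect (W j q); have [Bj|nBj] := pselect (B j (f q));
      have := Cq j; rewrite /setU /=; tauto.
  by have := Cq j I; rewrite /setU /=; tauto.
apply: (@section_cover_sub _ C); last apply: section_cover1 => //.
  by move=> q Eq j; exact: fB.
move=> p q; rewrite !inE => Cp Cq pq; have [_ + _ _ _] := stdW; apply => j.
by rewrite (Cp j) (Cq j) pq.
Qed.

Lemma analytic_piece F phi (w : seq nat) : closed_code F ->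
  (forall j, clopen_pre F phi (W j)) -> analytic W (piece F phi w).
Proof.
move=> cF cW; exists (cylinder F (size w) (nth 0%N w)), phi; split => //.
  move=> s sP; split.
    by apply: cF => n; have [t [Ft _] st] := sP n; exists t.
  have [t [_ wt] st] := sP (size w).
  exact: agree_trans wt (agree_sym st).
move=> j; have [e1 e2] := cW j.
by split => s [Fs _] Ws; [have [n nP] := e1 _ Fs Ws|have [n nP] := e2 _ Fs Ws];
  exists n => t [Ft _]; exact: nP.
Qed.

Section branch.
Variables (F : set (nat -> nat)) (phi : (nat -> nat) -> T) (Rem : set T) (x : T).
Hypotheses (cF : closed_code F) (cphi : forall j, clopen_pre F phi (W j)).
Hypothesis cfphi : forall j, clopen_pre F phi (f @^-1` W j).
Hypothesis countable_fiber : countable [set q | f q = x].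
Hypothesis no_isolated : forall w q, Rem q -> f q = x -> piece F phi w q ->
  exists j p p', [/\ Rem p /\ Rem p', f p = x /\ f p' = x,
    piece F phi w p /\ piece F phi w p' & W j p /\ ~ W j p'].

(** The fiber over [x] is closed, so that if its part in [Rem] had no isolated
    point, a branch could be led away from each of its countably many points. *)
Lemma no_isolated_empty q : phi @` F = setT -> Rem q -> f q = x -> False.
Proof.
move=> sF Rq fq.
have [|g [gx gsurj]] := countable_enum countable_fiber; first by exists q.
pose P k (st : (nat -> nat) * nat) :=
  [/\ F st.1, Rem (phi st.1), f (phi st.1) = x & (k <= st.2)%N].
pose Q k (st st' : (nat -> nat) * nat) := [/\ agree st.2 st.1 st'.1,
  (st.2 <= st'.2)%N &
  forall u, F u -> agree st'.2 st'.1 u -> phi u <> g k].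
have [s0 Fs0 ps0] : (phi @` F) q by rewrite sF.
have [||h hP] := @dependent_choice_nat _ P Q (s0, 0%N).
- by split; rewrite /= ?ps0.
- move=> k [s n] [/= Fs Rs fs kn].
  pose w := mkseq s n.
  have wE t : agree (size w) (nth 0%N w) t <-> agree n s t.
    rewrite /w size_mkseq; split => h i ni; first by rewrite -h// nth_mkseq.
    by rewrite nth_mkseq// h.
  have ws : piece F phi w (phi s) by exists s => //; split => //; exact/wE.
  have [j [p [p' [[Rp Rp'] [fp fp'] [wp wp'] [Wp Wp']]]]] := no_isolated Rs fs ws.
  have [e1 e2] := cphi j.
  (* There are remaining points of the fiber on both sides of [W j]; the branch follows the one on
     the side away from [g k]. *)
  have [V [t [Vg Rt ft [Ft st] [m mP]]]] : exists (V : set T) t,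
      [/\ ~ V (g k), Rem (phi t), f (phi t) = x, F t /\ agree n s t &
          exists m, forall u, F u -> agree m t u -> V (phi u)].
    have [Wg|nWg] := pselect (W j (g k)).
      case: wp' Wp' Rp' fp' => t [Ft /wE st] <- Wt Rt ft.
      by exists (~` W j), t; split => //; exact: e2.
    case: wp Wp Rp fp => t [Ft /wE st] <- Wt Rt ft.
    by exists (W j), t; split => //; exact: e1.
  (* [m] keeps the branch away from [g k], [n] preserves what was fixed before, and [k.+1] makes the
     branches converge. *)
  exists (t, maxn m (maxn n k.+1)); split => //=.
  - by rewrite !leq_max leqnn !orbT.
  - by rewrite !leq_max leqnn !orbT.
  - move=> u Fu tu; have Vu : V (phi u).
      by apply: mP => //; exact: agree_le (leq_maxl _ _) tu.
    by move=> e; rewrite e in Vu.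
pose u k := (h k).1; pose l k := (h k).2.
have ul k : agree (l k) (u k) (fun i => u i.+1 i).
  apply: (@agree_limit u l) => {}k; first by have [[]] := hP k.
    by have [_ []] := hP k.
  by have [_ []] := hP k.
move: ul; set s := fun i => _ => ul.
have us k : agree k (u k) s.
  by apply: agree_le (ul k); have [[]] := hP k.
have Fs : F s.
  apply: cF => k; exists (u k); last exact/agree_sym/us.
  by have [[]] := hP k.
have fs : f (phi s) = x.
  apply: contrapT => /(separated_points stdW)[j].
  have [e1 e2] := cfphi j => -[[w1 w2]|[w1 w2]].
    have [n nP] := e1 _ Fs w1; have [[Fu _ fu _] _] := hP n.
    by apply: w2; rewrite -fu; apply: (nP (u n)) => //; exact/agree_sym/us.
  have [n nP] := e2 _ Fs w1; have [[Fu _ fu _] _] := hP n.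
  by apply: (nP (u n)) => //=; [exact/agree_sym/us|rewrite fu].
have [k gk] := gsurj _ fs.
have [_ [_ _ /(_ s Fs (ul _))]] := hP k.
by rewrite gk.
Qed.
End branch.

Hypothesis countable_fibers : forall x, countable [set q | f q = x].

(** For each word w, [D w] is a largest set of base points, modulo null sets, above which the piece
    is covered by countably many sections; [Rem] is what these sections leave. Above a base point
    outside [M w] the piece contains at most one remaining point, so such base points could be added
    to [D w]. By maximality, off a null set of base points, every piece that contains a remaining
    point of a fiber contains two of them that some [W j] separates, which [no_isolated_empty]
    excludes. *)
Theorem lusin_novikov_mod_null (R : realType) (mu : {measure set T -> \bar R}) :
  (mu setT < +oo)%E -> exists (A : nat -> set T) Z,
  [/\ forall n, measurable (A n) /\ set_inj (A n) f, measurable Z, mu Z = 0%E &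
      forall q, ~ Z (f q) -> exists n, A n q].
Proof.
move=> finmu; have [_ _ _ code _] := stdW.
pose E n := if odd n then W n./2 else f @^-1` W n./2.
have mE n : measurable (E n) by rewrite /E; case: ifP.
have [F [phi [cF sF cE]]] := code setT E measurableT mE.
have cW j : clopen_pre F phi (W j).
  by have := cE j.*2.+1; rewrite /E /= odd_double /= uphalf_double.
have cfW j : clopen_pre F phi (f @^-1` W j).
  by have := cE j.*2; rewrite /E /= odd_double doubleK.
pose C := piece F phi.
have aC w : analytic W (C w) by exact: analytic_piece.
have /choice[D DP] : forall w, exists D, [/\ measurable D,
    section_cover (f @^-1` D `&` C w) & forall D', measurable D' ->
    section_cover (f @^-1` D' `&` C w) -> mu (D' `\` D) = 0%E].
  move=> w; have [|||D [mD cD] Dmax] := @maximal_mod_null _ _ _ mu finmu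
    [set D | measurable D /\ section_cover (f @^-1` D `&` C w)].
  - by move=> D [].
  - split => //; apply: (@section_cover_sub _ set0); first by move=> t [].
    by apply: section_cover1 => // x y; rewrite inE.
  - move=> D DP; split; first by apply: bigcupT_measurable => n; have [] := DP n.
    rewrite preimage_bigcup setI_bigcupl.
    by apply: section_cover_bigcup => n; have [] := DP n.
  by exists D; split => // D' mD' cD'; exact: Dmax.
have [A [AP cA]] : section_cover (\bigcup_w (f @^-1` D w `&` C w)).
  by apply: section_cover_bigcup => w; have [] := DP w.
pose Rem := ~` \bigcup_n A n.
have mRem : measurable Rem.
  by apply: measurableC; apply: bigcupT_measurable => n; have [] := AP n.
(* Base points with two remaining points in the piece; this set is analytic, hence measurable up to
   a null set [Z w]. *)
pose M w := \bigcup_j (f @` (C w `&` (Rem `&` W j)) `&` f @` (C w `&` (Rem `&` ~` W j))).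
have aCR w V : measurable V -> analytic W (C w `&` (Rem `&` V)).
  by move=> mV; apply: analyticI => //; apply: measurable_analytic => //; exact: measurableI.
have aM w : analytic W (M w).
  apply: analytic_bigcup => j; apply: analyticI => //; apply: analytic_image => //.
    exact: aCR.
  by apply: aCR; exact: measurableC.
have /choice[B /choice[Z BZ]] := fun w => analytic_measurable stdW finmu (aM w).
pose D' w := ~` (B w `|` Z w).
have mD' w : measurable (D' w).
  by have [mB mZ _ _ _] := BZ w; apply: measurableC; exact: measurableU.
have cD' w : section_cover (f @^-1` D' w `&` C w).
  apply: (@section_cover_sub _ ((f @^-1` D' w `&` (C w `&` (Rem `&` setT))) `|`
      \bigcup_n A n)).
    move=> t [D't Ct]; have [At|nAt] := pselect ((\bigcup_n A n) t); first by right.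
    by left; split => //; split => //; split.
  apply: section_coverU; last by exists A; split.
  apply: analytic_section.
    apply: analyticI => //; last exact: aCR.
    apply: measurable_analytic => //.
    by rewrite -[X in measurable X]setTI; exact: mf.
  have MD' (p q : T) : (f @^-1` D' w `&` (C w `&` (Rem `&` setT))) p ->
      (f @^-1` D' w `&` (C w `&` (Rem `&` setT))) q -> f p = f q ->
      forall j, W j p -> W j q.
    move=> [D'p [Cp [Rp _]]] [D'q [Cq [Rq _]]] pq j Wp.
    apply: contrapT => nWq; have [_ _ _ _ MBZ] := BZ w.
    apply: D'p; apply: MBZ; exists j => //; split; first by exists p.
    by exists q.
  move=> p q; rewrite !inE => Dp Dq pq; have [_ + _ _ _] := stdW; apply => j.
  by split; apply: MD'.
pose N := \bigcup_w ((D' w `\` D w) `|` Z w).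
have mN w : measurable ((D' w `\` D w) `|` Z w).
  have [mB mZ _ _ _] := BZ w; apply: measurableU => //.
  by apply: measurableD => //; have [] := DP w.
exists A, N; split => //; first exact: countable_bigcupT_measurable.
  apply: null_bigcup_count => // w; have [mB mZ Z0 _ _] := BZ w.
  have [mD _ Dmax] := DP w.
  by apply: nullU => //; [exact: measurableD|exact: Dmax].
move=> q nN; apply: contrapT => nA.
have Rq : Rem q by move=> [n _ An]; apply: nA; exists n.
apply: (@no_isolated_empty F phi Rem (f q) cF cW cfW _ _ q) => //.
move=> w p Rp fp Cp.
have nDp : ~ D w (f p).
  by move=> Dp; apply: Rp; apply: cA; exists w.
have [_ _ _ BM _] := BZ w.
have [|j _ [[p1 [C1 [R1 W1]] fp1] [p2 [C2 [R2 W2]] fp2]]] := BM (f q).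
  apply: contrapT => nB; apply: nN; exists w => //.
  have [Zq|nZq] := pselect (Z w (f q)); first by right.
  by left; split; [case|rewrite -fp].
by exists j, p1, p2.
Qed.

End lusin_novikov.

(** * Bisections and invariant contents *)

Section groupoid_algebra.
Context (G : groupoidType).
Implicit Types (g h : G) (a b : set G).

Lemma unit_val_inj : injective (@unit_val G).
Proof. exact: val_inj. Qed.

Lemma src_rngP g h : src g = rng h <-> gsrc g = grng h.
Proof. by split => [[]//|e]; exact: unit_val_inj. Qed.

Lemma src_srcP g h : src g = src h <-> gsrc g = gsrc h.
Proof. by split => [[]//|e]; exact: unit_val_inj. Qed.

Lemma src_mul g h : src g = rng h -> src (gmul g h) = src h.
Proof. by move=> /src_rngP gh; apply: unit_val_inj; exact: src_gmul. Qed.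

Lemma rng_mul g h : src g = rng h -> rng (gmul g h) = rng g.
Proof. by move=> /src_rngP gh; apply: unit_val_inj; exact: rng_gmul. Qed.

Lemma src_inv g : src (ginv g) = rng g.
Proof. by apply: unit_val_inj; exact: src_ginv. Qed.

Lemma rng_inv g : rng (ginv g) = src g.
Proof. by apply: unit_val_inj; exact: rng_ginv. Qed.

Lemma mulgK g h : src g = rng h -> gmul (gmul g h) (ginv h) = g.
Proof.
move=> gh; rewrite -[LHS]gmulA; [|exact/src_rngP|].
  by rewrite [X in gmul g X](_ : _ = gsrc g) ?gmul_src//; exact/esym/src_rngP.
exact/esym/rng_ginv.
Qed.

Lemma mulgI g h h' : src g = rng h -> src g = rng h' ->
  gmul g h = gmul g h' -> h = h'.
Proof.
move=> gh gh' e.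
have K k : src g = rng k -> gmul (ginv g) (gmul g k) = k.
  move=> gk; rewrite gmulA; [|exact: src_ginv|exact/src_rngP].
  by rewrite [X in gmul X k](_ : _ = grng k) ?rng_gmull//; exact/src_rngP.
by rewrite -(K h)// e K.
Qed.

Lemma gsrc_unit (x : units G) : gsrc (unit_val x) = unit_val x.
Proof. exact: set_mem (valP x). Qed.

Lemma src_unit (x : units G) : src (unit_val x) = x.
Proof. by apply: unit_val_inj; exact: gsrc_unit. Qed.

Lemma rng_unit (x : units G) : rng (unit_val x) = x.
Proof.
apply: unit_val_inj; transitivity (grng (gsrc (unit_val x))).
  by rewrite gsrc_unit.
by rewrite grng_src gsrc_unit.
Qed.

Lemma mul_unit_src g : gmul g (unit_val (src g)) = g.
Proof. exact: gmul_src. Qed.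

Lemma mul_unit_rng g : gmul (unit_val (rng g)) g = g.
Proof. exact: rng_gmull. Qed.

Lemma idem_unit g : src g = rng g -> gmul g g = g -> g = unit_val (src g).
Proof.
move=> sr gg; apply: (@mulgI g) => //; first by rewrite rng_unit.
by rewrite mul_unit_src.
Qed.

Definition bisection a := set_inj a src /\ set_inj a rng.

Lemma bisection_srcI a g h : bisection a -> a g -> a h -> src g = src h -> g = h.
Proof. by move=> [sa _] ag ah; apply: sa; rewrite inE. Qed.

Lemma bisection_rngI a g h : bisection a -> a g -> a h -> rng g = rng h -> g = h.
Proof. by move=> [_ ra] ag ah; apply: ra; rewrite inE. Qed.

Lemma bisection_sub a b : a `<=` b -> bisection b -> bisection a.
Proof. by move=> ab [sb rb]; split; [apply: sub_in2 sb|apply: sub_in2 rb] => x;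
  rewrite !inE; exact: ab. Qed.

Lemma bisection0 : bisection (set0 : set G).
Proof. by split => x y; rewrite inE. Qed.

Lemma bisection_units (S : set (units G)) : bisection (unit_val @` S).
Proof.
by split => _ _ /set_mem[x _ <-] /set_mem[y _ <-]; rewrite ?src_unit ?rng_unit => ->.
Qed.

Lemma bisection_mul a b : bisection a -> bisection b -> bisection (set_gmul a b).
Proof.
move=> ba bb; split => g g' /set_mem[x [y [ax bx xy ->]]]
    /set_mem[x' [y' [ax' bx' xy' ->]]].
  rewrite !src_mul// => /(bisection_srcI bb bx bx') yy'; subst y'.
  by rewrite (bisection_srcI ba ax ax')// xy xy'.
rewrite !rng_mul// => /(bisection_rngI ba ax ax') xx'; subst x'.
by rewrite (bisection_rngI bb bx bx')// -xy -xy'.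
Qed.

Lemma set_gmul0 a : set_gmul a set0 = set0.
Proof. by rewrite -subset0 => g [x [y []]]. Qed.

Lemma set_0gmul a : set_gmul set0 a = set0.
Proof. by rewrite -subset0 => g [x [y []]]. Qed.

End groupoid_algebra.

Section pmp_content.
Context (R : realType) (G : groupoidType).
Implicit Types (a b c e : set G) (A B : set (units G)).

(** A finitely additive version of a pmp groupoid, relative to classes [M] and
    [S] of sets of arrows and of units; it covers both the Borel sets of a pmp
    groupoid and all subsets of a finite groupoid. *)
Record pmp_content (M : set (set G)) (S : set (set (units G)))
    (m : set (units G) -> R) : Prop := PmpContent {
  pmpc_M0 : M set0 ;
  pmpc_MU : forall a b, M a -> M b -> M (a `|` b) ;
  pmpc_MD : forall a b, M a -> M b -> M (a `\` b) ;
  pmpc_Mmul : forall a b, M a -> M b -> bisection a -> bisection b ->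
    M (set_gmul a b) ;
  pmpc_Mpre : forall A, S A -> M (src @^-1` A) /\ M (rng @^-1` A) ;
  pmpc_SU : forall A B, S A -> S B -> S (A `|` B) ;
  pmpc_SD : forall A B, S A -> S B -> S (A `\` B) ;
  pmpc_Simg : forall a, M a -> bisection a -> S (src @` a) /\ S (rng @` a) ;
  pmpc_ge0 : forall A, 0 <= m A ;
  pmpc_add : forall A B, S A -> S B -> A `&` B = set0 ->
    m (A `|` B) = m A + m B ;
  pmpc_inv : forall a, M a -> bisection a -> m (src @` a) = m (rng @` a) }.

Variables (M : set (set G)) (S : set (set (units G))) (m : set (units G) -> R).
Hypothesis pm : pmp_content M S m.

Lemma pmpc_S0 : S set0.
Proof.
by have := (pmpc_Simg pm (pmpc_M0 pm) (bisection0 G)).1; rewrite image_set0.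
Qed.

Lemma pmpc_MI a b : M a -> M b -> M (a `&` b).
Proof.
move=> Ma Mb; rewrite -setDD; apply: (pmpc_MD pm) => //.
exact: (pmpc_MD pm).
Qed.

Lemma pmpc_0 : m set0 = 0.
Proof.
have := pmpc_add pm pmpc_S0 pmpc_S0; rewrite setI0 setU0 => /(_ erefl).
by move=> /eqP; rewrite -subr_eq0 opprD addrA subrr sub0r oppr_eq0 => /eqP.
Qed.

Lemma pmpc_split A B : S A -> S B -> m A = m (A `\` B) + m (A `&` B).
Proof.
move=> SA SB; have SD : S (A `\` B) by exact: (pmpc_SD pm).
have SI : S (A `&` B) by rewrite -setDD; exact: (pmpc_SD pm).
rewrite -(pmpc_add pm SD SI); first by rewrite setUC setUIDK.
by rewrite setDE setIACA setICl setI0.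
Qed.

Lemma pmpc_mono A B : S A -> S B -> A `<=` B -> m A <= m B.
Proof.
move=> SA SB AB; rewrite (pmpc_split SB SA) (setIidr AB) lerDr.
exact: (pmpc_ge0 pm).
Qed.

Lemma pmpc_subU A B : S A -> S B -> m (A `|` B) <= m A + m B.
Proof.
move=> SA SB; have SBA : S (B `\` A) by exact: (pmpc_SD pm).
have -> : A `|` B = A `|` B `\` A.
  by apply/seteqP; split => x; rewrite /setU /setD /=; have [|] := pselect (A x); tauto.
rewrite (pmpc_add pm)//; last by rewrite setDE setICA setICr setI0.
by rewrite lerD2l; apply: pmpc_mono => //; exact: subDsetl.
Qed.

Definition good a := M a /\ bisection a.

Definition cdist a b := m (src @` (a `+` b)).

Lemma good_subset a b : good b -> M a -> a `<=` b -> good a.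
Proof. by move=> [_ bb] Ma ab; split => //; exact: bisection_sub ab bb. Qed.

Lemma good_setI a b : good a -> M b -> good (a `&` b).
Proof.
move=> ga Mb; apply: (good_subset ga); [apply: pmpc_MI => //; exact: ga.1|].
exact: subIsetl.
Qed.

Lemma good_setD a b : good a -> M b -> good (a `\` b).
Proof.
move=> ga Mb; apply: (good_subset ga); last exact: subDsetl.
by apply: (pmpc_MD pm) => //; exact: ga.1.
Qed.

Lemma good_mul a b : good a -> good b -> good (set_gmul a b).
Proof.
by move=> [Ma ba] [Mb bb]; split; [exact: (pmpc_Mmul pm)|exact: bisection_mul].
Qed.

Lemma good_S a : good a -> S (src @` a) /\ S (rng @` a).
Proof. by move=> [Ma ba]; exact: (pmpc_Simg pm). Qed.

Lemma setY_S a b : good a -> good b -> S (src @` (a `+` b)) /\ S (rng @` (a `+` b)).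
Proof.
move=> ga gb; rewrite setY_def !image_setU.
have [? ?] := good_S (good_setD ga gb.1); have [? ?] := good_S (good_setD gb ga.1).
by split; exact: (pmpc_SU pm).
Qed.

Lemma cdist_ge0 a b : 0 <= cdist a b. Proof. exact: (pmpc_ge0 pm). Qed.

Lemma cdistxx a : cdist a a = 0.
Proof. by rewrite /cdist setYK image_set0 pmpc_0. Qed.

Lemma cdistC a b : cdist a b = cdist b a.
Proof. by rewrite /cdist setYC. Qed.

Lemma cdist_triangle b a c : good a -> good b -> good c ->
  cdist a c <= cdist a b + cdist b c.
Proof.
move=> ga gb gc; have Sab := (setY_S ga gb).1; have Sbc := (setY_S gb gc).1.
apply: le_trans (pmpc_subU Sab Sbc); apply: pmpc_mono.
- exact: (setY_S ga gc).1.
- exact: (pmpc_SU pm).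
- rewrite -image_setU; apply: image_subset; rewrite !setY_def => g.
  by have [bg|nbg] := pselect (b g); rewrite /setU /setD /=; tauto.
Qed.

Lemma cdist0 a : cdist a set0 = m (src @` a).
Proof. by rewrite /cdist setY0. Qed.

Lemma src_setY_le a b : good a -> good b -> m (src @` (a `\` b)) <= cdist a b.
Proof.
move=> ga gb; have gab := good_setD ga gb.1; apply: pmpc_mono.
- exact: (good_S gab).1.
- exact: (setY_S ga gb).1.
- by apply: image_subset; rewrite setY_def; exact: subsetUl.
Qed.

(** Invariance moves the measure of these arrows from their sources to their ranges, which lie in
    [A]. *)
Lemma inv_corestrict a A : good a -> S A -> m (src @` (a `&` rng @^-1` A)) <= m A.
Proof.
move=> ga SA; have g' := good_setI ga (pmpc_Mpre pm SA).2.
rewrite (pmpc_inv pm g'.1 g'.2); apply: pmpc_mono => //.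
  exact: (good_S g').2.
by move=> _ [g [_ Ag] <-].
Qed.

(** A product is lost only if its right factor is, or if its left factor is; the source of the left
    factor is the range of the right one, and invariance carries this second set over to sources. *)
Lemma cdist_mul a b a' b' : good a -> good b -> good a' -> good b' ->
  cdist (set_gmul a b) (set_gmul a' b') <= cdist a a' + cdist b b'.
Proof.
move=> ga gb ga' gb'; pose A := src @` (a `+` a').
have SA : S A by exact: (setY_S ga ga').1.
have g2 : good (b `&` b') by apply: good_setI => //; exact: gb'.1.
have S1 : S (src @` ((b `&` b') `&` rng @^-1` A)).
  by apply: (good_S (good_setI g2 _)).1; exact: (pmpc_Mpre pm SA).2.
have S2 := (setY_S gb gb').1.
apply: (@le_trans _ _ (m (src @` ((b `&` b') `&` rng @^-1` A) `|` src @` (b `+` b')))).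
  apply: pmpc_mono.
  - exact: (setY_S (good_mul ga gb) (good_mul ga' gb')).1.
  - exact: (pmpc_SU pm).
  rewrite !setY_def => _ [_ [[[x [y [ax by' xy ->]]] n]|[[x [y [ax by' xy ->]]] n]] <-];
      rewrite src_mul//.
    have [b'y|nb'y] := pselect (b' y); last by right; exists y => //; left.
    left; exists y => //; split => //=; exists x => //; rewrite setY_def; left.
    by split => // a'x; apply: n; exists x, y.
  have [b'y|nb'y] := pselect (b y); last by right; exists y => //; right.
  left; exists y => //; split => //=; exists x => //; rewrite setY_def; right.
  by split => // a'x; apply: n; exists x, y.
apply: le_trans (pmpc_subU S1 S2) _; rewrite lerD2r.
exact: inv_corestrict.
Qed.

End pmp_content.

(** Off [D] both functions are replaced by constants, so that they can be paired on the whole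
    space. *)
Lemma measurable_fun_pairD d d1 d2 (Y : measurableType d) (T1 : measurableType d1)
    (T2 : measurableType d2) (D : set Y) (h : Y -> T1) (k : Y -> T2) :
  measurable D -> measurable_fun D h -> measurable_fun D k ->
  measurable_fun D (fun y => (h y, k y)).
Proof.
move=> mD mh mk.
have ext d' (T' : measurableType d') (f : Y -> T') : measurable_fun D f ->
    measurable_fun setT (fun y => if y \in D then f y else point).
  move=> mf _ B mB; rewrite setTI (_ : _ @^-1` _ = (D `&` f @^-1` B) `|`
      (~` D `&` (if `[< B point >] then setT else set0))).
    apply: measurableU; first exact: mf.
    apply: measurableI; first exact: measurableC.
    by case: ifP => // _; exact: measurableT.
  apply/seteqP; split => y; rewrite /preimage /= /setU /setI /setC /=.
    case: ifPn; rewrite ?inE ?notin_setE => Dy By; [by left|right].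
    by split => //; case: asboolP.
  move=> [[Dy By]|[nDy]]; first by rewrite ifT// inE.
  by case: asboolP => // Bp _; rewrite ifF//; apply/negP; rewrite inE.
have := measurable_fun_pair (ext _ _ _ mh) (ext _ _ _ mk).
move=> /(measurable_funS measurableT (@subsetT _ D)); apply: eq_measurable_fun.
by move=> y yD; rewrite !yD.
Qed.

Lemma good0_measurable d (G : measurableGroupoidType d) :
  good measurable (set0 : set G).
Proof. by split; [exact: measurable0|exact: bisection0]. Qed.

Section borel_groupoid.
Context (R : realType) d (G : measurableGroupoidType d).
Hypothesis hG : discrete_measurable_groupoid R G.
Local Notation BG := (set_type (borel_full_semigroup G)).
Implicit Types (a b : set G) (A : set (units G)).

Lemma measurable_ginv : measurable_fun setT (@ginv G).
Proof. by have [] := hG. Qed.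

Lemma measurable_gmul_fun d' (Y : measurableType d') (D : set Y) (h k : Y -> G) :
  measurable D -> measurable_fun D h -> measurable_fun D k ->
  (forall y, D y -> src (h y) = rng (k y)) ->
  measurable_fun D (fun y => gmul (h y) (k y)).
Proof.
move=> mD mh mk hk; have [_ mC mM _ _] := hG.
have hkC : (fun y => (h y, k y)) @` D `<=` composable G.
  by move=> _ [y Dy <-]; exact: hk.
exact: (measurable_comp mC hkC mM (measurable_fun_pairD mD mh mk)).
Qed.

Lemma measurable_gsrc : measurable_fun setT (@gsrc G).
Proof.
apply: measurable_gmul_fun => //; first exact: measurable_ginv.
by move=> g _; exact: src_inv.
Qed.

Lemma measurable_grng : measurable_fun setT (@grng G).
Proof.
apply: measurable_gmul_fun => //; first exact: measurable_ginv.
by move=> g _; rewrite rng_inv.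
Qed.

Lemma measurable_src_preimage A : measurable A -> measurable (src @^-1` A).
Proof.
move=> [B mB <-]; rewrite setTI -[X in measurable X]setTI.
exact: measurable_gsrc.
Qed.

Lemma measurable_rng_preimage A : measurable A -> measurable (rng @^-1` A).
Proof.
move=> [B mB <-]; rewrite setTI -[X in measurable X]setTI.
exact: measurable_grng.
Qed.

Lemma measurable_src_image a : measurable a -> set_inj a src -> measurable (src @` a).
Proof.
move=> ma sa; have [/standard_borel_sequence[W stdW] _ _ _ _] := hG.
exists (@gsrc G @` a); last first.
  rewrite setTI; apply/seteqP; split => [x [g ag gx]|_ [g ag <-]]; last by exists g.
  by exists g => //; exact: unit_val_inj.
apply: (lusin_souslin stdW) => //; first exact: measurable_gsrc.
by move=> x y ax ay /src_srcP; exact: sa.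
Qed.

Lemma measurable_rng_image a : measurable a -> set_inj a rng -> measurable (rng @` a).
Proof.
move=> ma sa; have [/standard_borel_sequence[W stdW] _ _ _ _] := hG.
exists (@grng G @` a); last first.
  rewrite setTI; apply/seteqP; split => [x [g ag gx]|_ [g ag <-]]; last by exists g.
  by exists g => //; exact: unit_val_inj.
apply: (lusin_souslin stdW) => //; first exact: measurable_grng.
by move=> x y ax ay e; apply: sa => //; exact: unit_val_inj.
Qed.

Lemma measurable_unit_arrows : measurable (unit_arrows G).
Proof.
have [/standard_borel_sequence[W stdW] _ _ _ _] := hG.
have [mW sepW _ _ _] := stdW.
have mgW j : measurable (@gsrc G @^-1` W j).
  by rewrite -[X in measurable X]setTI; exact: measurable_gsrc.
rewrite (_ : unit_arrows G =
    \bigcap_j (W j `&` @gsrc G @^-1` W j `|` ~` W j `&` ~` (@gsrc G @^-1` W j))).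
  by apply: bigcapT_measurable => j; apply: measurableU; apply: measurableI => //;
    exact: measurableC.
apply/seteqP; split => [x ux j _|x ux].
  by have [Wx|nWx] := pselect (W j x); [left|right]; split => //;
    rewrite /= /preimage /setC /= ux.
apply: sepW => j; have := ux j I; rewrite /setU /setC /preimage /=; tauto.
Qed.

Lemma measurable_unit_image A : measurable A -> measurable (unit_val @` A).
Proof.
move=> [B mB <-]; rewrite (_ : _ @` _ = unit_arrows G `&` B).
  by apply: measurableI => //; exact: measurable_unit_arrows.
apply/seteqP; split => [_ [x [_ Bx] <-]|g [ug Bg]].
  by split => //; exact: gsrc_unit.
exists (src g); first by split => //=; rewrite /preimage /= (_ : unit_val _ = g).
exact: ug.
Qed.

(** Dividing on the right by the only element of [b] with the same source presents the product as a
    preimage of [a]. That element depends measurably on the arrow because source images of Borel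
    parts of [b] are Borel. *)
Lemma measurable_set_gmul a b : measurable a -> measurable b -> bisection a ->
  bisection b -> measurable (set_gmul a b).
Proof.
move=> ma mb ba bb.
pose D := src @^-1` (src @` b).
have mD : measurable D.
  by apply: measurable_src_preimage; apply: measurable_src_image => //; exact: bb.1.
have /choice[y yP] : forall g, exists h, D g -> b h /\ src h = src g.
  move=> g; have [[h bh hg]|nD] := pselect (D g); first by exists h.
  by exists point.
have my : measurable_fun D y.
  move=> _ C mC; rewrite (_ : _ `&` _ = src @^-1` (src @` (b `&` C))).
    apply: measurable_src_preimage; apply: measurable_src_image.
      exact: measurableI.
    by apply: sub_in2 bb.1 => x; rewrite !inE => -[].
  apply/seteqP; split => [g [Dg Cy]|g [h [bh Ch] hg]].
    by have [by_ sy] := yP _ Dg; exists (y g).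
  have Dg : D g by exists h.
  split => //=; have [by_ sy] := yP _ Dg.
  by rewrite /preimage /= (bisection_srcI bb by_ bh)// hg.
have mp : measurable_fun D (fun g => gmul g (ginv (y g))).
  apply: measurable_gmul_fun => //.
    apply: (@measurableT_comp _ _ _ _ _ _ (@ginv G)) => //.
    exact: measurable_ginv.
  by move=> g /yP[_ yg]; rewrite rng_inv.
rewrite (_ : set_gmul a b = D `&` (fun g => gmul g (ginv (y g))) @^-1` a).
  exact: mp.
apply/seteqP; split => [_ [g [h [ag bh gh ->]]]|g [Dg ag]].
  have Dgh : D (gmul g h) by rewrite /D /preimage /= src_mul//; exists h.
  split => //=; have [by_ sy] := yP _ Dgh.
  rewrite /preimage /= (bisection_srcI bb by_ bh) ?mulgK//.
  by rewrite sy src_mul.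
have [by_ sy] := yP _ Dg; exists (gmul g (ginv (y g))), (y g); split => //.
  by rewrite src_mul ?rng_inv// src_inv.
rewrite -[LHS](mulgK (h := ginv (y g))) ?rng_inv//; congr gmul.
apply: (@mulgI _ (ginv (y g))).
- by rewrite rng_inv.
- by rewrite src_inv.
- exact: rng_ginv.
Qed.

Lemma borel_full_semigroupP a :
  borel_full_semigroup G a <-> measurable a /\ bisection a.
Proof. by split => [[? ? ?]|[? [? ?]]]. Qed.

Lemma borel_good (x : BG) : good measurable (val x).
Proof. by apply/borel_full_semigroupP; exact: set_mem (valP x). Qed.

Definition to_BG a (h : good measurable a) : BG :=
  SigSub (mem_set ((borel_full_semigroupP a).2 h)).

Lemma val_bmul (x y : BG) : val (bmul x y) = set_gmul (val x) (val y).
Proof.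
have [[mx bx] [my by_]] := (borel_good x, borel_good y).
have h : good measurable (set_gmul (val x) (val y)).
  by split; [exact: measurable_set_gmul|exact: bisection_mul].
rewrite /bmul; case: xgetP => [c -> //|/(_ (to_BG h))].
by rewrite /= => /(_ erefl).
Qed.

Lemma pmp_contentP (mu : probability (units G) R) : pmp mu <->
  pmp_content measurable measurable (fun A => fine (mu A)).
Proof.
have fm A : measurable A -> mu A \is a fin_num by move=> mA; exact: fin_num_measure.
split => [[_ mu_inv]|pm].
  split => //.
  - by move=> a b; exact: measurableU.
  - by move=> a b; exact: measurableD.
  - exact: measurable_set_gmul.
  - by move=> A mA; split; [exact: measurable_src_preimage|exact: measurable_rng_preimage].
  - by move=> A B; exact: measurableU.
  - by move=> A B; exact: measurableD.
  - by move=> a ma [sa ra]; split; [exact: measurable_src_image|exact: measurable_rng_image].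
  - by move=> A; exact: fine_ge0.
  - by move=> A B mA mB AB; rewrite measureU// fineD// fm.
  - by move=> a ma ba; congr fine; apply: mu_inv; exact/borel_full_semigroupP.
split => // a /borel_full_semigroupP[ma ba].
have [ms mr] := pmpc_Simg pm ma ba.
by rewrite -[LHS]fineK ?fm// -[RHS]fineK ?fm// (pmpc_inv pm).
Qed.

End borel_groupoid.

(** * Separability of the full semigroup *)

Section mass.
Context d (T : measurableType d) (R : realType) (P : probability T R).
Implicit Types A B : set T.

Lemma mass_fin_num A : measurable A -> P A \is a fin_num.
Proof. by move=> mA; exact: fin_num_measure. Qed.

Lemma mass_ge0 A : 0 <= fine (P A). Proof. exact: fine_ge0. Qed.

Lemma mass_mono A B : measurable A -> measurable B -> A `<=` B ->
  fine (P A) <= fine (P B).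
Proof.
by move=> mA mB AB; apply: fine_le; rewrite ?mass_fin_num// le_measure// inE.
Qed.

Lemma mass_le1 A : measurable A -> fine (P A) <= 1.
Proof.
move=> mA; rewrite -[leRHS]/(fine 1%E) -(@probability_setT _ _ _ P).
by apply: mass_mono.
Qed.

Lemma massU A B : measurable A -> measurable B -> A `&` B = set0 ->
  fine (P (A `|` B)) = fine (P A) + fine (P B).
Proof. by move=> mA mB AB; rewrite measureU// fineD// mass_fin_num. Qed.

Lemma mass_subU A B : measurable A -> measurable B ->
  fine (P (A `|` B)) <= fine (P A) + fine (P B).
Proof.
move=> mA mB; have mBA : measurable (B `\` A) by exact: measurableD.
rewrite (_ : A `|` B = A `|` B `\` A).
  rewrite massU// ?lerD2l; first by apply: mass_mono => //; exact: subDsetl.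
  by rewrite setDE setICA setICr setI0.
by apply/seteqP; split => x; rewrite /setU /setD /=; have [|] := pselect (A x); tauto.
Qed.

Lemma mass_cvg0 (S : nat -> set T) : (forall k, measurable (S k)) ->
  (forall k, S k.+1 `<=` S k) -> P (\bigcap_k S k) = 0%E ->
  forall e, 0 < e -> exists k, fine (P (S k)) < e.
Proof.
move=> mS decS S0 e e0.
have : (P \o S) x @[x --> \oo] --> P (\bigcap_n S n).
  apply: nonincreasing_cvg_mu => //.
  - by rewrite (le_lt_trans (probability_le1 P (mS 0%N)))// ltry.
  - exact: bigcapT_measurable.
  - by apply/nonincreasing_seqP => n; apply/subsetPset; exact: decS.
rewrite S0 => /fine_cvgP[_ /cvgrPdist_lt/(_ _ e0)[k _ /(_ k (leqnn k))]] /=.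
by rewrite sub0r normrN ger0_norm ?mass_ge0// => ?; exists k.
Qed.

End mass.

Section unit_pushforward.
Context (R : realType) d (G : measurableGroupoidType d).
Variable mu : probability (units G) R.

(** [lusin_novikov_mod_null] concerns a self-map and a measure on one and the same space; [mu] is
    therefore moved to the arrows, next to the arrow-valued source [gsrc]. *)
Definition unit_pushforward (A : set G) : \bar R := mu (unit_val @^-1` A).

Let unit_pushforward0 : unit_pushforward set0 = 0%E.
Proof. by rewrite /unit_pushforward preimage_set0 measure0. Qed.

Let unit_pushforward_ge0 A : (0 <= unit_pushforward A)%E.
Proof. exact: measure_ge0. Qed.

Let unit_pushforward_sigma_additive : semi_sigma_additive unit_pushforward.
Proof.
have mpre (B : set G) : measurable B -> measurable (@unit_val G @^-1` B).
  by move=> mB; exists B; rewrite ?setTI.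
move=> F mF tF mUF; rewrite /unit_pushforward preimage_bigcup.
apply: measure_semi_sigma_additive.
- by move=> i; exact: mpre.
- by apply/trivIsetP => i j _ _ ij; rewrite -preimage_setI; move/trivIsetP : tF
    => /(_ _ _ _ _ ij) ->//; rewrite preimage_set0.
- by rewrite -preimage_bigcup; exact: mpre.
Qed.

HB.instance Definition _ := isMeasure.Build _ _ _ unit_pushforward
  unit_pushforward0 unit_pushforward_ge0 unit_pushforward_sigma_additive.

End unit_pushforward.

Section separability.
Context (R : realType) d (G : measurableGroupoidType d).
Hypothesis hG : discrete_measurable_groupoid R G.
Variable mu : probability (units G) R.
Local Notation BG := (set_type (borel_full_semigroup G)).
Local Notation m := (fun A => fine (mu A)).
Implicit Types E : set G.

(** The source image of a Borel set is in general only analytic. Subsets of finite unions of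
    sections have this better property, by the Lusin-Souslin theorem. *)
Definition src_regular E := measurable E /\
  forall B, measurable B -> measurable (src @` (E `&` B)).

Lemma src_regular_section E :
  measurable E -> set_inj E src -> src_regular E.
Proof.
move=> mE iE; split => // B mB; apply: (measurable_src_image hG).
  exact: measurableI.
by apply: sub_in2 iE => x; rewrite !inE => -[].
Qed.

Lemma src_regular_sub E E' : measurable E -> E `<=` E' -> src_regular E' ->
  src_regular E.
Proof.
move=> mE EE' [mE' sE']; split => // B mB.
by rewrite -(setIidr EE') -setIA; apply: sE'; exact: measurableI.
Qed.

Lemma src_regularU E E' : src_regular E -> src_regular E' -> src_regular (E `|` E').
Proof.
move=> [mE sE] [mE' sE']; split; first exact: measurableU.
by move=> B mB; rewrite setIUl image_setU; apply: measurableU; [exact: sE|exact: sE'].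
Qed.

Lemma src_regular_measurable E : src_regular E -> measurable (src @` E).
Proof. by move=> [mE /(_ setT measurableT)]; rewrite setIT. Qed.

Variables (A : nat -> set G) (W : nat -> set G).
Hypothesis secA : forall n, measurable (A n) /\ set_inj (A n) src.
Hypothesis mW : forall j, measurable (W j).
Hypothesis genW : measurable `<=` <<s range W>>.

(** The countable algebra of sets generated by the [W j], indexed by trees in order to be
    enumerated. *)
Fixpoint boolean_term (t : GenTree.tree nat) : set G :=
  match t with
  | GenTree.Leaf j => W j
  | GenTree.Node _ [:: a] => ~` boolean_term a
  | GenTree.Node _ [:: a; b] => boolean_term a `|` boolean_term b
  | _ => set0
  end.

Lemma boolean_term_measurable : forall t, measurable (boolean_term t).
Proof.
fix IH 1 => -[j|k [|a [|b [|]]]] //=; first exact: measurableC.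
exact: measurableU.
Qed.

Let local_mass i E := m (src @` (E `&` A i)).

Let mSA i E : measurable E -> measurable (src @` (E `&` A i)).
Proof.
move=> mE; rewrite setIC; have [mA iA] := secA i.
by have [_] := src_regular_section mA iA; apply.
Qed.

Let section_mass n E := \sum_(i < n) local_mass i E.

Let section_mass_mono n E E' : measurable E -> measurable E' -> E `<=` E' ->
  section_mass n E <= section_mass n E'.
Proof.
move=> mE mE' EE'; apply: ler_sum => i _; apply: mass_mono; try exact: mSA.
by apply: image_subset; exact: setSI.
Qed.

Let section_massU n E E' : measurable E -> measurable E' ->
  section_mass n (E `|` E') <= section_mass n E + section_mass n E'.
Proof.
move=> mE mE'; rewrite /section_mass -big_split; apply: ler_sum => i _.
by rewrite /local_mass setIUl image_setU; apply: mass_subU; exact: mSA.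
Qed.

Let section_mass_cvg0 n (S : nat -> set G) e : (forall k, measurable (S k)) ->
  (forall k, S k.+1 `<=` S k) -> \bigcap_k S k = set0 -> 0 < e ->
  exists k, section_mass n (S k) < e.
Proof.
move=> mS decS S0; elim: n e => [|n IH] e e0.
  by exists 0%N; rewrite /section_mass big_ord0.
have SE k l : (k <= l)%N -> S l `<=` S k.
  by move=> /subnKC <-; elim: (l - k)%N => [|j IHj];
    rewrite ?addn0// addnS; apply: subset_trans IHj.
have e20 : 0 < e / 2 by rewrite divr_gt0.
have [k kP] := IH _ e20.
have [||||l lP] := @mass_cvg0 _ _ _ mu (fun k => src @` (S k `&` A n)) _ _ _ (e / 2).
- by move=> j; exact: mSA.
- by move=> j; apply: image_subset; exact: setSI.
(* As the source is injective on [A n], the intersection of the images is the image of the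
   intersection. *)
- rewrite (_ : \bigcap_k _ = set0) ?measure0// -subset0 => x xS.
  have [g [Sg Ag] gx] := xS 0%N I.
  suff : (\bigcap_k S k) g by rewrite S0.
  move=> j _; have [h [Sh Ah] hx] := xS j I.
  by rewrite (_ : g = h)//; apply: (secA n).2; rewrite ?inE// gx hx.
- by [].
exists (maxn k l); rewrite /section_mass big_ord_recr/=.
have h1 : section_mass n (S (maxn k l)) <= section_mass n (S k).
  by apply: section_mass_mono => //; apply: SE; exact: leq_maxl.
have h2 : local_mass n (S (maxn k l)) <= local_mass n (S l).
  apply: mass_mono; try exact: mSA.
  by apply: image_subset; apply: setSI; apply: SE; exact: leq_maxr.
by move: h1 h2 kP lP; rewrite /section_mass /local_mass; lra.
Qed.

Let mterm := boolean_term_measurable.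

Let mY E E' : measurable E -> measurable E' -> measurable (E `+` E').
Proof.
by move=> mE mE'; rewrite setY_def; apply: measurableU; exact: measurableD.
Qed.

(** The sets approximated by terms form a sigma-algebra that contains the generators; for countable
    unions, continuity from above of [section_mass] reduces to finite ones. *)
Lemma boolean_term_dense E n e : measurable E -> 0 < e ->
  exists t, section_mass n (E `+` boolean_term t) < e.
Proof.
move=> mE; pose L := [set E | measurable E /\ forall e, 0 < e ->
  exists t, section_mass n (E `+` boolean_term t) < e].
suff : L E by move=> [_]; apply.
have sm0 : section_mass n set0 = 0.
  by apply: big1 => i _; rewrite /local_mass set0I image_set0 measure0.
have L0 : L set0.
  split => // e' e'0; exists (GenTree.Node 0 [::]).
  by rewrite /= setYK sm0.
have LU E1 E2 : L E1 -> L E2 -> L (E1 `|` E2).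
  move=> [m1 h1] [m2 h2]; split; first exact: measurableU.
  move=> e' e'0; have e20 : 0 < e' / 2 by rewrite divr_gt0.
  have [t1 t1P] := h1 _ e20; have [t2 t2P] := h2 _ e20.
  exists (GenTree.Node 0 [:: t1; t2]) => /=.
  apply: le_lt_trans (_ : section_mass n ((E1 `+` boolean_term t1) `|`
      (E2 `+` boolean_term t2)) < _).
    apply: section_mass_mono.
    - by apply: mY; exact: measurableU.
    - by apply: measurableU; exact: mY.
    by rewrite !setY_def => x; rewrite /setU /setD /=; tauto.
  by apply: le_lt_trans (section_massU _ (mY _ _) (mY _ _)) _ => //; lra.
move: E {mE} (genW mE); apply: smallest_sub; last first.
  by move=> _ [j _ <-]; split => // e' e'0; exists (GenTree.Leaf j);
    rewrite /= setYK sm0.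
split => //.
- move=> E [mE hE]; rewrite setTD; split; first exact: measurableC.
  move=> e' /hE[t tP]; exists (GenTree.Node 0 [:: t]) => /=.
  rewrite (_ : _ `+` _ = E `+` boolean_term t)//.
  rewrite !setY_def; apply/seteqP; split => x; rewrite /setU /setD /setC /=;
    have [|] := pselect (E x); have [|] := pselect (boolean_term t x); tauto.
- move=> F LF; have mF k : measurable (F k) by have [] := LF k.
  have mUF : measurable (\bigcup_k F k) by exact: bigcupT_measurable.
  split => // e' e'0; have e20 : 0 < e' / 2 by rewrite divr_gt0.
  pose FK k := \big[setU/set0]_(i < k) F i.
  have LFK k : L (FK k).
    by elim: k => [|k IH]; rewrite /FK ?big_ord0// big_ord_recr; exact: LU.
  have [||| //|k kP] := @section_mass_cvg0 n (fun k => (\bigcup_k F k) `\` FK k) (e' / 2).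
  - by move=> k; apply: measurableD => //; have [] := LFK k.
  - by move=> k x [Fx nFx]; split => // h; apply: nFx; rewrite /FK big_ord_recr; left.
  - rewrite -subset0 => x h; have [[k _ Fx] _] := h 0%N I.
    have [_] := h k.+1 I; apply; rewrite /FK big_ord_recr; right => //.
  have [mFK /(_ _ e20)[t tP]] := LFK k.
  exists t; apply: le_lt_trans (_ : section_mass n (((\bigcup_k F k) `\` FK k) `|`
      (FK k `+` boolean_term t)) < _).
    apply: section_mass_mono.
    - exact: mY.
    - by apply: measurableU; [exact: measurableD|exact: mY].
    have FKF : FK k `<=` \bigcup_k F k.
      by rewrite /FK -bigcup_mkord => x [i _ Fi]; exists i.
    move=> x; rewrite !setY_def => -[[Fx nt]|[tx nF]].
      by have [FKx|nFKx] := pselect (FK k x); [right; left|left].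
    by right; right; split => // /FKF.
  apply: le_lt_trans (section_massU _ _ (mY _ _)) _ => //; first exact: measurableD.
  by move: kP tP; lra.
Qed.

End separability.

Section dense.
Context (R : realType) d (G : measurableGroupoidType d).
Hypothesis hG : discrete_measurable_groupoid R G.
Variable mu : probability (units G) R.
Local Notation BG := (set_type (borel_full_semigroup G)).
Local Notation m := (fun A => fine (mu A)).

(** Terms intersected with finitely many sections approximate every bisection but need not be
    bisections. At each scale, each of them is replaced by some bisection that close to it, if there
    is one. *)
Lemma full_semigroup_dense : exists a : nat -> BG,
  forall (x : BG) e, 0 < e -> exists n, cdist m (val x) (val (a n)) < e.
Proof.
have [/standard_borel_sequence[W stdW] _ _ _ cG] := hG.
have [mW _ genW _ _] := stdW.
have cfib x : countable [set q : G | gsrc q = x].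
  have [[q0 <-]|nx] := pselect (exists q, gsrc q = x).
    by apply: sub_countable (cG (src q0)); apply: subset_card_le => q /src_srcP.
  by rewrite (_ : [set q | _] = set0)// -subset0 => q qx; apply: nx; exists q.
have [|A [Z [AP mZ Z0 AZ]]] := lusin_novikov_mod_null stdW (measurable_gsrc hG)
    cfib (mu := unit_pushforward mu).
  by rewrite /= /unit_pushforward preimage_setT probability_setT ltry.
have secA n : measurable (A n) /\ set_inj (A n) src.
  by have [mA iA] := AP n; split => // x y xA yA /src_srcP; exact: iA.
have mterm := boolean_term_measurable mW.
pose AA n := \big[setU/set0]_(i < n) A i.
pose C (tn : GenTree.tree nat * nat) := boolean_term W tn.1 `&` AA tn.2.
have sAA n : src_regular (AA n).
  rewrite /AA; elim: n => [|n IH].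
    by rewrite big_ord0; split => // B mB; rewrite set0I image_set0.
  rewrite big_ord_recr; apply: src_regularU => //=.
  by have [mA iA] := secA n; exact: (src_regular_section hG).
have sC tn : src_regular (C tn).
  apply: src_regular_sub (sAA tn.2); last exact: subIsetr.
  by apply: measurableI => //; exact: (sAA _).1.
have sBG (x : BG) : src_regular (val x).
  have [mx [ix _]] := borel_good x; exact: (src_regular_section hG).
have mY (E E' : set G) : src_regular E -> src_regular E' ->
    measurable (src @` (E `+` E')).
  move=> sE sE'; apply: src_regular_measurable.
  apply: src_regular_sub (src_regularU sE sE').
    by rewrite setY_def; apply: measurableU; apply: measurableD; [exact: sE.1|
      exact: sE'.1|exact: sE'.1|exact: sE.1].
  by rewrite setY_def => g [[]|[]]; [left|right].
have approx (x : BG) e : 0 < e -> exists tn, cdist m (val x) (C tn) < e.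
  move=> e0; have [mx bx] := borel_good x.
  pose Sx n := src @` (val x `\` AA n).
  have sx n : src_regular (val x `\` AA n).
    apply: src_regular_sub (sBG x); last exact: subDsetl.
    by apply: measurableD => //; exact: (sAA n).1.
  have e20 : 0 < e / 2 by rewrite divr_gt0.
  have [|||n nP] := @mass_cvg0 _ _ _ mu Sx _ _ _ _ e20.
  - by move=> k; exact: src_regular_measurable.
  - move=> k; apply: image_subset => g [xg nA]; split => // h; apply: nA.
    by rewrite /AA big_ord_recr; left.
  - apply/eqP; rewrite eq_le measure_ge0 andbT -Z0.
    apply: le_measure; rewrite ?inE.
    + by apply: bigcapT_measurable => k; exact: src_regular_measurable.
    + by exists Z => //; rewrite setTI.
    (* A point that stays in all [Sx k] is the source of an arrow that lies in no section, so it
       belongs to the null set [Z]. *)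
    move=> y yS; have [g [xg _] gy] := yS 0%N I.
    rewrite -gy; apply: contrapT => /(AZ g)[k Akg].
    have [h [xh nA] hy] := yS k.+1 I; apply: nA.
    rewrite (_ : h = g); first by rewrite /AA big_ord_recr; right.
    by apply: (bisection_srcI bx) => //; rewrite gy hy.
  have [t tP] := @boolean_term_dense _ _ _ hG mu A W secA mW genW (val x) n _ mx e20.
  exists (t, n).
  have mS i : measurable (src @` ((val x `+` boolean_term W t) `&` A i)).
    rewrite setIC; have [mA iA] := secA i.
    have [_] := src_regular_section hG mA iA; apply.
    by rewrite setY_def; apply: measurableU; apply: measurableD.
  have sub_sum k : fine (mu (src @` ((val x `+` boolean_term W t) `&` AA k))) <=
      \sum_(i < k) fine (mu (src @` ((val x `+` boolean_term W t) `&` A i))) /\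
      measurable (src @` ((val x `+` boolean_term W t) `&` AA k)).
    elim: k => [|k [IH1 IH2]].
      by rewrite /AA !big_ord0 setI0 image_set0 measure0.
    rewrite /AA !big_ord_recr /= setIUr image_setU; split; last exact: measurableU.
    by apply: le_trans (mass_subU mu IH2 (mS k)) _; rewrite lerD2r.
  have [h1 h2] := sub_sum n.
  apply: le_lt_trans (_ : fine (mu (Sx n)) +
      fine (mu (src @` ((val x `+` boolean_term W t) `&` AA n))) < _).
    have mSx : measurable (Sx n) by exact: src_regular_measurable.
    apply: le_trans (mass_subU mu mSx h2).
    apply: mass_mono; first exact: mY.
      exact: measurableU.
    rewrite -image_setU; apply: image_subset => g; rewrite !setY_def /C /=.
    move=> [[xg nC]|[[tg Ag] nx]]; last by right; split => //; right.
    have [Ag|nA] := pselect (AA n g); last by left.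
    by right; split => //; left; split => // tg; apply: nC.
  by move: nP tP h1; rewrite /Sx; lra.
have /choice[b bP] : forall tnk : (GenTree.tree nat * nat) * nat, exists y : BG,
    forall x : BG, cdist m (val x) (C tnk.1) < rad R tnk.2 ->
      cdist m (val y) (C tnk.1) < rad R tnk.2.
  move=> [tn k]; have [[y yP]|ny] := pselect (exists y : BG,
      cdist m (val y) (C tn) < rad R k); first by exists y.
  by exists (to_BG (good0_measurable G)) => x xP; exfalso; apply: ny; exists x.
exists (fun n => if unpickle n is Some tnk then b tnk else b ((GenTree.Leaf 0, 0), 0)%N).
move=> x e e0; have e20 : 0 < e / 2 by rewrite divr_gt0.
have [k ke] := rad_lt e20; have [tn xC] := approx x _ (rad_gt0 R k).
exists (pickle (tn, k)); rewrite pickleK; have yC := bP (tn, k) x xC.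
apply: le_lt_trans (_ : cdist m (val x) (C tn) +
    cdist m (val (b (tn, k))) (C tn) < _); last by move: xC yC; rewrite /=; lra.
have m1 := mY _ _ (sBG x) (sC tn); have m2 := mY _ _ (sBG (b (tn, k))) (sC tn).
apply: le_trans (mass_subU mu m1 m2).
apply: mass_mono; [exact: mY|exact: measurableU|].
rewrite -image_setU; apply: image_subset => g; rewrite !setY_def.
by have [|] := pselect (C tn g); rewrite /setU /setD /=; tauto.
Qed.

End dense.

(** * Finite models *)

Section sum_groupoid.
Context (N1 N2 : groupoidType).

(** Arrows of different summands are never composable, so that the value at a mixed pair is
    arbitrary. *)
Definition sum_gmul (g h : N1 + N2) : N1 + N2 :=
  match g, h with
  | inl x, inl y => inl (gmul x y)
  | inr x, inr y => inr (gmul x y)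
  | _, _ => g
  end.

Definition sum_ginv (g : N1 + N2) : N1 + N2 :=
  match g with inl x => inl (ginv x) | inr x => inr (ginv x) end.

Let s := src_arrow sum_gmul sum_ginv.
Let r := rng_arrow sum_gmul sum_ginv.

Let sV g : s (sum_ginv g) = r g.
Proof.
by case: g => x; [exact: (congr1 (@inl N1 N2) (src_ginv x))|exact: (congr1 (@inr N1 N2) (src_ginv x))].
Qed.

Let rV g : r (sum_ginv g) = s g.
Proof.
by case: g => x; [exact: (congr1 (@inl N1 N2) (rng_ginv x))|exact: (congr1 (@inr N1 N2) (rng_ginv x))].
Qed.

Let sM g h : s g = r h -> s (sum_gmul g h) = s h.
Proof.
by case: g h => x [] y //= [e];
  [exact: (congr1 (@inl N1 N2) (src_gmul _ _ e))|exact: (congr1 (@inr N1 N2) (src_gmul _ _ e))].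
Qed.

Let rM g h : s g = r h -> r (sum_gmul g h) = r g.
Proof.
by case: g h => x [] y //= [e];
  [exact: (congr1 (@inl N1 N2) (rng_gmul _ _ e))|exact: (congr1 (@inr N1 N2) (rng_gmul _ _ e))].
Qed.

Let mA f g h : s f = r g -> s g = r h ->
  sum_gmul f (sum_gmul g h) = sum_gmul (sum_gmul f g) h.
Proof.
by case: f g h => x [] y [] z //= [e] [e'];
  [exact: (congr1 (@inl N1 N2) (gmulA _ _ _ e e'))|exact: (congr1 (@inr N1 N2) (gmulA _ _ _ e e'))].
Qed.

Let mS g : sum_gmul g (s g) = g.
Proof.
by case: g => x; [exact: (congr1 (@inl N1 N2) (gmul_src x))|exact: (congr1 (@inr N1 N2) (gmul_src x))].
Qed.

Let mR g : sum_gmul (r g) g = g.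
Proof.
by case: g => x; [exact: (congr1 (@inl N1 N2) (rng_gmull x))|exact: (congr1 (@inr N1 N2) (rng_gmull x))].
Qed.

HB.instance Definition _ := isGroupoid.Build (N1 + N2)%type
  sV rV sM rM mA mS mR.

Local Notation N := (N1 + N2 : groupoidType)%type.

Definition sum_set (A : set N1) (B : set N2) : set (N1 + N2) :=
  fun g => match g with inl x => A x | inr y => B y end.

Definition inl_unit (x : units N1) : units (N1 + N2)%type := src (inl (unit_val x)).
Definition inr_unit (x : units N2) : units (N1 + N2)%type := src (inr (unit_val x)).

Lemma src_inl (x : N1) : src (inl x : N1 + N2) = inl_unit (src x).
Proof. by apply: unit_val_inj; congr inl; exact/esym/gsrc_src. Qed.

Lemma src_inr (x : N2) : src (inr x : N1 + N2) = inr_unit (src x).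
Proof. by apply: unit_val_inj; congr inr; exact/esym/gsrc_src. Qed.

Lemma rng_inl (x : N1) : rng (inl x : N1 + N2) = inl_unit (rng x).
Proof. by apply: unit_val_inj; congr inl; exact/esym/gsrc_rng. Qed.

Lemma rng_inr (x : N2) : rng (inr x : N1 + N2) = inr_unit (rng x).
Proof. by apply: unit_val_inj; congr inr; exact/esym/gsrc_rng. Qed.

Lemma inl_unit_inj : injective inl_unit.
Proof.
move=> x y /(congr1 (@unit_val _)) [] e.
by apply: unit_val_inj; rewrite -(gsrc_unit x) -(gsrc_unit y).
Qed.

Lemma inr_unit_inj : injective inr_unit.
Proof.
move=> x y /(congr1 (@unit_val _)) [] e.
by apply: unit_val_inj; rewrite -(gsrc_unit x) -(gsrc_unit y).
Qed.

Lemma inl_inr_unit x y : inl_unit x <> inr_unit y.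
Proof. by move=> /(congr1 (@unit_val _)). Qed.

Lemma sum_setY A B A' B' :
  sum_set A B `+` sum_set A' B' = sum_set (A `+` A') (B `+` B').
Proof. by rewrite !setY_def; apply/seteqP; split => -[x|x]. Qed.

Lemma sum_set_gmul A B A' B' : set_gmul (sum_set A B) (sum_set A' B') =
  sum_set (set_gmul A A') (set_gmul B B').
Proof.
apply/seteqP; split.
  move=> g [[x|x] [[y|y] [/= ax ay]]]; rewrite ?(src_inl, src_inr, rng_inl, rng_inr).
  - by move=> /inl_unit_inj xy ->; exists x, y.
  - by move=> /inl_inr_unit.
  - by move=> /esym/inl_inr_unit.
  - by move=> /inr_unit_inj xy ->; exists x, y.
move=> [g|g] [x [y [ax ay xy ->]]].
  by exists (inl x), (inl y); split => //; rewrite src_inl rng_inl xy.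
by exists (inr x), (inr y); split => //; rewrite src_inr rng_inr xy.
Qed.

Lemma bisection_sum A B : bisection A -> bisection B -> bisection (sum_set A B).
Proof.
move=> bA bB; split => -[x|x] [y|y] /set_mem ax /set_mem ay;
    rewrite ?(src_inl, src_inr, rng_inl, rng_inr).
- by move=> /inl_unit_inj /(bisection_srcI bA ax ay) ->.
- by move=> /inl_inr_unit.
- by move=> /esym/inl_inr_unit.
- by move=> /inr_unit_inj /(bisection_srcI bB ax ay) ->.
- by move=> /inl_unit_inj /(bisection_rngI bA ax ay) ->.
- by move=> /inl_inr_unit.
- by move=> /esym/inl_inr_unit.
- by move=> /inr_unit_inj /(bisection_rngI bB ax ay) ->.
Qed.

Lemma inl_unit_src (a : set (N1 + N2)) :
  inl_unit @^-1` (src @` a) = src @` (inl @^-1` a).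
Proof.
apply/seteqP; split => [x [[y|y] ay]|_ [y ay <-]].
- by rewrite src_inl => /inl_unit_inj <-; exists y.
- by rewrite src_inr => /esym/inl_inr_unit.
- by exists (inl y) => //; rewrite src_inl.
Qed.

Lemma inr_unit_src (a : set (N1 + N2)) :
  inr_unit @^-1` (src @` a) = src @` (inr @^-1` a).
Proof.
apply/seteqP; split => [x [[y|y] ay]|_ [y ay <-]].
- by rewrite src_inl => /inl_inr_unit.
- by rewrite src_inr => /inr_unit_inj <-; exists y.
- by exists (inr y) => //; rewrite src_inr.
Qed.

Lemma inl_unit_rng (a : set (N1 + N2)) :
  inl_unit @^-1` (rng @` a) = rng @` (inl @^-1` a).
Proof.
apply/seteqP; split => [x [[y|y] ay]|_ [y ay <-]].
- by rewrite rng_inl => /inl_unit_inj <-; exists y.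
- by rewrite rng_inr => /esym/inl_inr_unit.
- by exists (inl y) => //; rewrite rng_inl.
Qed.

Lemma inr_unit_rng (a : set (N1 + N2)) :
  inr_unit @^-1` (rng @` a) = rng @` (inr @^-1` a).
Proof.
apply/seteqP; split => [x [[y|y] ay]|_ [y ay <-]].
- by rewrite rng_inl => /inl_inr_unit.
- by rewrite rng_inr => /inr_unit_inj <-; exists y.
- by exists (inr y) => //; rewrite rng_inr.
Qed.

Lemma sum_finite : finite_set [set: N1] -> finite_set [set: N2] ->
  finite_set [set: N1 + N2].
Proof.
move=> f1 f2; rewrite (_ : setT = inl @` setT `|` inr @` setT).
  by rewrite finite_setU; split; exact: finite_image.
by apply/seteqP; split => // -[x|x] _; [left|right]; exists x.
Qed.

End sum_groupoid.

Section finite_content.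
Context (R : realType).

Definition finite_content (N : groupoidType) (m : set (units N) -> R) :=
  pmp_content setT setT m.

Lemma finite_contentP (N : groupoidType) (m : set (units N) -> R) :
  (forall A, 0 <= m A) ->
  (forall A B, A `&` B = set0 -> m (A `|` B) = m A + m B) ->
  (forall a, bisection a -> m (src @` a) = m (rng @` a)) -> finite_content m.
Proof. by move=> m0 mU mI; split => // *; [exact: mU|exact: mI]. Qed.

Lemma finite_content_scale (N : groupoidType) (m : set (units N) -> R) k :
  0 <= k -> finite_content m -> finite_content (fun A => k * m A).
Proof.
move=> k0 pm; apply: finite_contentP => [A|A B AB|a ba].
- by rewrite mulr_ge0//; exact: (pmpc_ge0 pm).
- by rewrite (pmpc_add pm)// mulrDr.
- by rewrite (pmpc_inv pm).
Qed.

Definition sum_content (N1 N2 : groupoidType) (m1 : set (units N1) -> R)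
    (m2 : set (units N2) -> R) (A : set (units (N1 + N2)%type)) : R :=
  m1 (@inl_unit N1 N2 @^-1` A) + m2 (@inr_unit N1 N2 @^-1` A).

Lemma finite_content_sum (N1 N2 : groupoidType) (m1 : set (units N1) -> R)
    (m2 : set (units N2) -> R) : finite_content m1 -> finite_content m2 ->
  finite_content (sum_content m1 m2).
Proof.
move=> p1 p2; apply: finite_contentP => [A|A B AB|a [sa ra]].
- by rewrite addr_ge0//; [exact: (pmpc_ge0 p1)|exact: (pmpc_ge0 p2)].
- rewrite /sum_content !preimage_setU (pmpc_add p1)//; last first.
    by rewrite -preimage_setI AB preimage_set0.
  rewrite (pmpc_add p2)//; last by rewrite -preimage_setI AB preimage_set0.
  by rewrite addrACA.
- have ea (x y : N1 + N2) : a x -> a y -> src x = src y -> x = y.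
    by move=> ax ay; apply: sa; rewrite inE.
  have er (x y : N1 + N2) : a x -> a y -> rng x = rng y -> x = y.
    by move=> ax ay; apply: ra; rewrite inE.
  rewrite /sum_content inl_unit_src inr_unit_src inl_unit_rng inr_unit_rng.
  congr (_ + _).
    apply: (pmpc_inv p1) => //; split => x y /set_mem ax /set_mem ay xy.
      by have [] := ea _ _ ax ay ltac:(by rewrite !src_inl xy).
    by have [] := er _ _ ax ay ltac:(by rewrite !rng_inl xy).
  apply: (pmpc_inv p2) => //; split => x y /set_mem ax /set_mem ay xy.
    by have [] := ea _ _ ax ay ltac:(by rewrite !src_inr xy).
  by have [] := er _ _ ax ay ltac:(by rewrite !rng_inr xy).
Qed.

Lemma sum_content_cdist (N1 N2 : groupoidType) (m1 : set (units N1) -> R)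
    (m2 : set (units N2) -> R) A B A' B' :
  cdist (sum_content m1 m2) (sum_set A B) (sum_set A' B') =
  cdist m1 A A' + cdist m2 B B'.
Proof. by rewrite /cdist sum_setY /sum_content inl_unit_src inr_unit_src. Qed.

End finite_content.

Section unit_groupoid.

Let mul (g h : unit) := tt.
Let inv (g : unit) := tt.
Let s := src_arrow mul inv.
Let r := rng_arrow mul inv.

Let sV g : s (inv g) = r g. Proof. by []. Qed.
Let rV g : r (inv g) = s g. Proof. by []. Qed.
Let sM g h : s g = r h -> s (mul g h) = s h. Proof. by []. Qed.
Let rM g h : s g = r h -> r (mul g h) = r g. Proof. by []. Qed.
Let mA f g h : s f = r g -> s g = r h -> mul f (mul g h) = mul (mul f g) h.
Proof. by []. Qed.
Let mS g : mul g (s g) = g. Proof. by case: g. Qed.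
Let mR g : mul (r g) g = g. Proof. by case: g. Qed.

HB.instance Definition _ := isGroupoid.Build unit sV rV sM rM mA mS mR.

Lemma unit_units (x y : units unit) : x = y.
Proof. by apply: unit_val_inj; case: (unit_val x); case: (unit_val y). Qed.

(** A one-point groupoid of mass [c] models the zero distance with any prescribed mass, and stands
    for an empty corner. *)
Lemma unit_content (R : realType) (c : R) : 0 <= c ->
  exists m : set (units unit) -> R, finite_content m /\ m setT = c.
Proof.
move=> c0; exists (fun A => if `[< A !=set0 >] then c else 0); split; last first.
  by case: asboolP => // -[]; exists (src tt).
apply: finite_contentP.
- by move=> A; case: ifP.
- move=> A B AB; case: asboolP => [[x [Ax|Bx]]|nAB].
  + rewrite ifT; last by apply/asboolP; exists x.
    rewrite ifF ?addr0//; apply/negbTE/asboolPn => -[y By].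
    by have : (A `&` B) x; [split => //; rewrite (unit_units x y)|rewrite AB].
  + rewrite [X in _ = _ + X]ifT; last by apply/asboolP; exists x.
    rewrite ifF ?add0r//; apply/negbTE/asboolPn => -[y Ay].
    by have : (A `&` B) x; [split => //; rewrite (unit_units x y)|rewrite AB].
  + rewrite !ifF ?addr0//; apply/negbTE/asboolPn => -[x Ax]; apply: nAB; exists x;
      rewrite /setU /=; tauto.
- move=> a _; congr (if _ then _ else _); apply/asbool_equiv_eq.
  by split => -[_ [x ax _]]; [exists (rng x)|exists (src x)]; exists x.
Qed.

End unit_groupoid.

(** * Approximability of a distance by finite groupoids *)

Section approximation.
Context (R : realType) d (G : measurableGroupoidType d).
Local Notation BG := (set_type (borel_full_semigroup G)).
Implicit Types (K : seq BG) (e c : R) (D : BG -> BG -> R).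

(** [c] and [D] are arbitrary, and not just the mass [1] and the distance of a
    full semigroup, so that approximations can be scaled, added and cut down. *)
Definition approx_at K e c D := exists (N : groupoidType)
  (m : set (units N) -> R) (phi : BG -> set N),
  [/\ finite_set [set: N], finite_content m, forall a, bisection (phi a),
      `|m setT - c| <= e &
      {in K &, forall a b, `|cdist m (phi a) (phi b) - D a b| <= e /\
        cdist m (phi (bmul a b)) (set_gmul (phi a) (phi b)) <= e}].

Definition approximable c D := forall K e, 0 < e -> approx_at K e c D.

Lemma approx_at_close K e e' c c' D D' : approx_at K e c D -> `|c - c'| <= e' ->
  {in K &, forall a b, `|D a b - D' a b| <= e'} -> approx_at K (e + e') c' D'.
Proof.
move=> [N [m [phi [fN pm bphi mc h]]]] cc' DD'.
have e'0 : 0 <= e' by apply: le_trans cc'.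
exists N, m, phi; split => //.
  rewrite -(subrKA c); apply: le_trans (ler_normD _ _) _; exact: lerD.
move=> a b aK bK; have [h1 h2] := h a b aK bK; split.
  rewrite -(subrKA (D a b)); apply: le_trans (ler_normD _ _) _.
  by apply: lerD => //; exact: DD'.
by rewrite (le_trans h2)// lerDl.
Qed.

Lemma approx_at_scale K e c D k : 0 <= k -> approx_at K e c D ->
  approx_at K (k * e) (k * c) (fun a b => k * D a b).
Proof.
move=> k0 [N [m [phi [fN pm bphi mc h]]]].
exists N, (fun A => k * m A), phi; split => //.
- exact: finite_content_scale.
- by rewrite -mulrBr normrM (ger0_norm k0) ler_wpM2l.
- move=> a b aK bK; have [h1 h2] := h a b aK bK.
  by rewrite /cdist -mulrBr normrM (ger0_norm k0) !ler_wpM2l.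
Qed.

Lemma approx_at_add K e1 e2 c1 c2 D1 D2 :
  approx_at K e1 c1 D1 -> approx_at K e2 c2 D2 ->
  approx_at K (e1 + e2) (c1 + c2) (fun a b => D1 a b + D2 a b).
Proof.
move=> [N1 [m1 [phi1 [f1 p1 b1 mc1 h1]]]] [N2 [m2 [phi2 [f2 p2 b2 mc2 h2]]]].
exists (N1 + N2)%type, (sum_content m1 m2), (fun a => sum_set (phi1 a) (phi2 a)).
split.
- exact: sum_finite.
- exact: finite_content_sum.
- by move=> a; exact: bisection_sum.
- rewrite /sum_content !preimage_setT opprD addrACA.
  by apply: le_trans (ler_normD _ _) _; exact: lerD.
- move=> a b aK bK; have [h1d h1m] := h1 a b aK bK.
  have [h2d h2m] := h2 a b aK bK.
  rewrite sum_set_gmul !sum_content_cdist; split; last exact: lerD.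
  by rewrite opprD addrACA; apply: le_trans (ler_normD _ _) _; exact: lerD.
Qed.

Lemma approximable0 c : 0 <= c -> approximable c (fun _ _ => 0).
Proof.
move=> c0 K e e0; have [m [pm mT]] := unit_content c0.
exists unit, m, (fun=> set0); split => //.
- exact: (@finite_finset _ _).
- by move=> _; exact: bisection0.
- by rewrite mT subrr normr0 ltW.
- by move=> a b _ _; rewrite set_gmul0 (cdistxx pm) subr0 normr0 ltW.
Qed.

Lemma approximable_close c D : (forall K e, 0 < e -> exists c' D',
    [/\ approximable c' D', `|c' - c| <= e &
        {in K &, forall a b, `|D' a b - D a b| <= e}]) ->
  approximable c D.
Proof.
move=> h K e e0; have e20 : 0 < e / 2 by rewrite divr_gt0.
have [c' [D' [/(_ K _ e20) ap cc DD]]] := h K _ e20.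
by have := approx_at_close ap cc DD; rewrite -splitr.
Qed.

Lemma approximable_scale c D k : 0 <= k -> approximable c D ->
  approximable (k * c) (fun a b => k * D a b).
Proof.
(* The factor 0 is treated apart because the error is divided by [k]. *)
rewrite le_eqVlt => /orP[/eqP <- _|k0 ap K e e0].
  rewrite mul0r (_ : (fun _ _ => _) = (fun _ _ => 0)); first exact: approximable0.
  by apply/funext => a; apply/funext => b; rewrite mul0r.
have ek : 0 < e / k by rewrite divr_gt0.
by have := approx_at_scale (ltW k0) (ap K _ ek); rewrite mulrCA divff ?mulr1// gt_eqF.
Qed.

Lemma approximable_add c1 c2 D1 D2 : approximable c1 D1 -> approximable c2 D2 ->
  approximable (c1 + c2) (fun a b => D1 a b + D2 a b).
Proof.
move=> ap1 ap2 K e e0; have e20 : 0 < e / 2 by rewrite divr_gt0.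
by have := approx_at_add (ap1 K _ e20) (ap2 K _ e20); rewrite -splitr.
Qed.

Lemma approximable_sum (I : Type) (r : seq I) (c : I -> R)
    (Di : I -> BG -> BG -> R) :
  (forall i, approximable (c i) (Di i)) ->
  approximable (\sum_(i <- r) c i) (fun a b => \sum_(i <- r) Di i a b).
Proof.
move=> ap; elim: r => [|i r IH].
  rewrite big_nil (_ : (fun a b => _) = (fun _ _ => 0)); first exact: approximable0.
  by apply/funext => a; apply/funext => b; rewrite big_nil.
rewrite big_cons (_ : (fun a b => _) = (fun a b => Di i a b + \sum_(j <- r) Di j a b)).
  exact: approximable_add.
by apply/funext => a; apply/funext => b; rewrite big_cons.
Qed.

End approximation.

(** * Finite groupoids as discrete measurable groupoids *)

Definition discrete_space (T : Type) : Type := T.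

Section discrete_complete.
Context (T : pointedType).

HB.instance Definition _ := Pointed.copy (discrete_space T) T.
HB.instance Definition _ := hasNbhs.Build (discrete_space T) principal_filter.
HB.instance Definition _ := Discrete_ofNbhs.Build (discrete_space T) erefl.
HB.instance Definition _ := DiscreteUniform_ofNbhs.Build (discrete_space T).
HB.instance Definition _ {R : numDomainType} :=
  @DiscretePseudoMetric_ofUniform.Build R (discrete_space T).

(** The diagonal is an entourage, so that a Cauchy filter contains a singleton. *)
Lemma discrete_cauchy_cvg (F : set_system (discrete_space T)) :
  ProperFilter F -> cauchy F -> cvg F.
Proof.
move=> FF cF; have [|[A B] /= [FA FB] AB] := cF [set xy | xy.1 = xy.2].
  by rewrite uniform_discrete => _ [x _ <-].
have [a Aa] := filter_ex FA; have [b Bb] := filter_ex FB.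
apply/cvg_ex; exists b; apply/discrete_cvg; apply: filterS FA => x Ax.
exact: (AB (x, b)).
Qed.

HB.instance Definition _ := Uniform_isComplete.Build (discrete_space T)
  discrete_cauchy_cvg.

End discrete_complete.

Section discrete_groupoid.

(** [N] with all its subsets measurable; [x0] is there to make it pointed. *)
Definition discrete_groupoid (N : groupoidType) (x0 : N) : Type := N.

Context (N : groupoidType) (x0 : N).
Local Notation T := (discrete_groupoid x0).

HB.instance Definition _ := Groupoid.copy T N.
HB.instance Definition _ := gen_eqMixin T.
HB.instance Definition _ := gen_choiceMixin T.
HB.instance Definition _ := isPointed.Build T x0.

Let discrete_measurable : set (set T) := [set: set T].
Let discrete_measurable0 : discrete_measurable set0. Proof. by []. Qed.
Let discrete_measurableC A : discrete_measurable A -> discrete_measurable (~` A).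
Proof. by []. Qed.
Let discrete_measurable_bigcup (F : (set T)^nat) :
  (forall i, discrete_measurable (F i)) -> discrete_measurable (\bigcup_i F i).
Proof. by []. Qed.

HB.instance Definition _ := @isMeasurable.Build default_measure_display T
  discrete_measurable discrete_measurable0 discrete_measurableC
  discrete_measurable_bigcup.

Lemma discrete_measurableT (A : set T) : measurable A. Proof. by []. Qed.

Hypothesis finN : finite_set [set: N].

Lemma discrete_prodT (A : set (T * T)) : measurable A.
Proof.
rewrite (_ : A = \bigcup_(g in [set: T]) ([set g] `*` [set h | A (g, h)])).
  apply: (@fin_bigcup_measurable _ _ T) => // g _; exact: measurableX.
by apply/seteqP; split => [[g h] Agh|[g h] [g' _ [/= -> ]]]//; exists g.
Qed.

Lemma discrete_standard (R : realType) : standard_borel R T.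
Proof.
have bT (A : set (discrete_space T)) : borel A.
  by apply: sub_sigma_algebra; exact: discrete_open.
exists (discrete_space T), id; split => //.
- exact: discrete_hausdorff.
- exists (range (fun x : T => [set x])).
    apply: finite_set_countable; exact: finite_image.
  split; first by move=> A _; exact: discrete_open.
  move=> x A xA; exists [set x]; first by split => //; exists x.
  by move=> y ->; exact: nbhs_singleton xA.
Qed.

Lemma discrete_groupoid_dmg (R : realType) : discrete_measurable_groupoid R T.
Proof.
split.
- exact: discrete_standard.
- exact: discrete_prodT.
- by move=> _ B _; exact: discrete_prodT.
- by move=> _ B _.
- move=> x; apply: finite_set_countable; exact: sub_finite_set finN.
Qed.

End discrete_groupoid.

Section content_probability.
Context (R : realType) (N : groupoidType) (x0 : N).
Local Notation T := (discrete_groupoid x0).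
Variable m : set (units T) -> R.
Hypotheses (finN : finite_set [set: N]) (pm : finite_content m) (mT : m setT = 1).

Definition content_measure (A : set (units T)) : \bar R := (m A)%:E.

Let content_measure0 : content_measure set0 = 0%E.
Proof. by rewrite /content_measure (pmpc_0 pm). Qed.

Let content_measure_ge0 A : (0 <= content_measure A)%E.
Proof. by rewrite lee_fin; exact: (pmpc_ge0 pm). Qed.

Let finU : finite_set [set: units T].
Proof.
apply: (@sub_finite_set _ _ (src @` [set: T])); last exact: finite_image.
by move=> x _; exists (unit_val x) => //; exact: src_unit.
Qed.

(** The unit space is finite, so a sequence of sets has exhausted its union after finitely many
    terms, and finite additivity suffices. *)
Let content_measure_sigma_additive : semi_sigma_additive content_measure.
Proof.
move=> F _ tF _.
have sumE n : (\sum_(0 <= i < n) content_measure (F i) =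
    content_measure (\big[setU/set0]_(i < n) F i))%E.
  elim: n => [|n IH]; first by rewrite big_nil big_ord0 content_measure0.
  rewrite big_nat_recr//= IH big_ord_recr/= /content_measure (pmpc_add pm)//.
  rewrite -subset0 -bigcup_mkord => x [[i /= ni Fi] Fn].
  have /trivIsetP/(_ i n I I) := tF; rewrite neq_ltn ni => /(_ isT) e.
  have : (F i `&` F n) x by split.
  by rewrite e.
have /choice[i_ iP] : forall x, exists i, (\bigcup_i F i) x -> F i x.
  move=> x; have [[i _ Fi]|nF] := pselect ((\bigcup_i F i) x); first by exists i.
  by exists 0%N.
have [n nP] : exists n, forall x, (i_ x < n)%N.
  have /finite_seqP[s sE] : finite_set (range i_) by exact: finite_image.
  exists (\max_(i <- s) i).+1 => x; rewrite ltnS.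
  have : [set` s] (i_ x) by rewrite -sE; exists x.
  by move=> /= xs; exact: leq_bigmax_seq.
apply: cvg_near_cst; exists n => // k /= nk; rewrite sumE; congr content_measure.
rewrite -bigcup_mkord; apply/seteqP; split => x; first by move=> [i _ Fi]; exists i.
by move=> Fx; exists (i_ x); [exact: leq_trans nk|exact: iP].
Qed.

HB.instance Definition _ := isMeasure.Build _ _ _ content_measure
  content_measure0 content_measure_ge0 content_measure_sigma_additive.

Let content_measure_setT : content_measure setT = 1%E.
Proof. by rewrite /content_measure mT. Qed.

HB.instance Definition _ := Measure_isProbability.Build _ _ _ content_measure
  content_measure_setT.

Definition content_probability : probability (units T) R := content_measure.

Lemma pmp_content_probability : pmp content_probability.
Proof.
split; first exact: discrete_groupoid_dmg.
move=> a /borel_full_semigroupP[_ ba].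
exact: (congr1 EFin (pmpc_inv pm I ba)).
Qed.

End content_probability.

(** Bundled so that [choice] can pick a model for each integer. *)
Record finite_model (R : realType) (X : Type) := FiniteModel {
  model_display : measure_display ;
  model_groupoid : measurableGroupoidType model_display ;
  model_measure : probability (units model_groupoid) R ;
  model_map : X -> set_type (borel_full_semigroup model_groupoid) ;
  model_finite : finite_set [set: model_groupoid] ;
  model_pmp : pmp model_measure }.

Definition model_dist (R : realType) (X : Type) (F : finite_model R X)
    (a b : set (model_groupoid F)) : R :=
  cdist (fun A => fine (model_measure F A)) a b.

Section models.
Context (R : realType) d (G : measurableGroupoidType d).
Local Notation BG := (set_type (borel_full_semigroup G)).

(** The total mass has to be normalized to 1. It is at least 1/2, so its inverse is at most 2, and
    as distances are at most 1 its defect adds at most [e] to the error before this factor: in all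
    [2 * (e + e)]. *)
Lemma approx_model (K : seq BG) e (D : BG -> BG -> R) :
  0 < e -> e <= 2^-1 -> approx_at K e 1 D ->
  {in K &, forall a b, 0 <= D a b <= 1} ->
  exists F : finite_model R BG, {in K &, forall a b,
    `|model_dist (val (model_map F a)) (val (model_map F b)) - D a b| <= 4 * e /\
    model_dist (val (model_map F (bmul a b)))
      (set_gmul (val (model_map F a)) (val (model_map F b))) <= 4 * e}.
Proof.
move=> e0 e2 [[S [mix]] [m [phi [fN pm bphi mc h]]]] D01.
pose N : groupoidType := Groupoid.Pack (Groupoid.Class mix).
have mT : 2^-1 <= m setT by move: mc; rewrite ler_distl => /andP[]; lra.
have mT0 : 0 < m setT by lra.
(* Positive mass provides a unit, needed as the point of the discrete groupoid. *)
have [y0 _] : [set: units N] !=set0.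
  by apply/set0P/negP => /eqP T0; move: mT0; rewrite T0 (pmpc_0 pm) ltxx.
pose x0 := unit_val y0; pose m' := fun A => (m setT)^-1 * m A.
have i0 : 0 <= (m setT)^-1 by rewrite invr_ge0 ltW.
have i2 : (m setT)^-1 <= 2 by rewrite invf_ple ?posrE// ltr0n.
have pm' : finite_content m' by exact: finite_content_scale.
have m'T : m' setT = 1 by rewrite /m' mulVf// gt_eqF.
pose nu : probability (units (@discrete_groupoid N x0)) R :=
  @content_probability R N x0 m' fN pm' m'T.
have good_phi a : good measurable (phi a : set (@discrete_groupoid N x0)) by split.
have pnu : pmp nu by exact: pmp_content_probability.
exists (@FiniteModel R BG _ (@discrete_groupoid N x0) nu
  (fun a => to_BG (good_phi a)) fN pnu) => a b aK bK.
rewrite /model_dist /=; have [h1 h2] := h a b aK bK.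
have cE A B : cdist (fun A => fine (nu A)) A B = (m setT)^-1 * cdist m A B by [].
rewrite !cE; have /andP[D0 D1] := D01 a b aK bK; split; last first.
  apply: le_trans (_ : 2 * e <= _); last by lra.
  by apply: ler_pM => //; exact: (cdist_ge0 pm).
have -> : (m setT)^-1 * cdist m (phi a) (phi b) - D a b =
    (m setT)^-1 * ((cdist m (phi a) (phi b) - D a b) + (1 - m setT) * D a b).
  by field; rewrite gt_eqF.
rewrite normrM (ger0_norm i0).
apply: le_trans (_ : 2 * (e + e) <= _); last by lra.
apply: ler_pM => //; apply: le_trans (ler_normD _ _) _; apply: lerD => //.
rewrite normrM distrC (ger0_norm D0) -[leRHS]mulr1.
by apply: ler_pM.
Qed.

End models.

(** * Soficity as finite approximability *)

Section pseudo_magma.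
Context (R : realType).

(** These axioms make the operations of the metric quotient independent of the chosen
    representatives; the bound 1 keeps ultralimits in a compact interval. *)
Record pseudo_magma (M : metric_magma R) : Prop := PseudoMagma {
  pseudo_ge0 : forall x y : M, 0 <= mm_dist x y ;
  pseudo_le1 : forall x y : M, mm_dist x y <= 1 ;
  pseudo_xx : forall x : M, mm_dist x x = 0 ;
  pseudo_sym : forall x y : M, mm_dist x y = mm_dist y x ;
  pseudo_triangle : forall y x z : M, mm_dist x z <= mm_dist x y + mm_dist y z ;
  pseudo_mul : forall x y x' y' : M,
    mm_dist (mm_mul x y) (mm_mul x' y') <= mm_dist x x' + mm_dist y y' }.

Variable M : metric_magma R.
Hypothesis pM : pseudo_magma M.
Local Notation pi := (@mquot_pi R M).
Local Notation repr := (@mquot_repr R M).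

Lemma pseudo_eq0 (x y z : M) : mm_dist x y = 0 -> mm_dist x z = mm_dist y z.
Proof.
move=> xy; apply/eqP; rewrite eq_le; apply/andP; split.
  by apply: le_trans (pseudo_triangle pM y _ _) _; rewrite xy add0r.
apply: le_trans (pseudo_triangle pM x _ _) _.
by rewrite (pseudo_sym pM y) xy add0r.
Qed.

Lemma repr_pi (x : M) : mm_dist (repr (pi x)) x = 0.
Proof.
rewrite /mquot_repr; case: cid => y /= yP.
by have : mclass x x; [exact: (pseudo_xx pM)|rewrite yP].
Qed.

Lemma pi_eq (x y : M) : mm_dist x y = 0 -> pi x = pi y.
Proof.
move=> xy; apply: eq_exist; apply/funext => z; rewrite /mclass /=.
by rewrite (pseudo_eq0 z xy).
Qed.

Lemma dist_pi (x y : M) :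
  mm_dist (pi x : metric_quotient M) (pi y) = mm_dist x y.
Proof.
rewrite /= (pseudo_eq0 _ (repr_pi x)) (pseudo_sym pM).
by rewrite (pseudo_eq0 _ (repr_pi y)) (pseudo_sym pM).
Qed.

Lemma mul_pi (x y : M) :
  mm_mul (pi x : metric_quotient M) (pi y) = pi (mm_mul x y).
Proof.
apply: pi_eq; apply/eqP; rewrite eq_le (pseudo_ge0 pM) andbT.
by apply: le_trans (pseudo_mul pM _ _ _ _) _; rewrite !repr_pi addr0.
Qed.

Lemma pseudo_quotient : pseudo_magma (metric_quotient M).
Proof.
split => //=.
- by move=> x y; exact: (pseudo_ge0 pM).
- by move=> x y; exact: (pseudo_le1 pM).
- by move=> x; exact: (pseudo_xx pM).
- by move=> x y; exact: (pseudo_sym pM).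
- by move=> y x z; exact: (pseudo_triangle pM).
- move=> x y x' y'; rewrite -[leLHS]/(mm_dist (pi _ : metric_quotient M) (pi _)).
  by rewrite dist_pi; exact: (pseudo_mul pM).
Qed.

End pseudo_magma.

(** * Ultralimits and ultraproducts *)

Section ultralimit.
Context (R : realType) (U : set_system nat).
Hypothesis freeU : free_ultrafilter U.

Definition ultralimit (u : nat -> R) : R := lim (u @ U).

Lemma ultra_proper_filter : ProperFilter U.
Proof. by have [uU _] := freeU; exact: ultra_proper. Qed.

Lemma ultra_ge n : U [set k | (n <= k)%N].
Proof.
have [uU U0] := freeU; have pU := ultra_proper_filter.
elim: n => [|n IH]; first exact: filterS filterT.
have Un : U [set k | k <> n].
  have [] := in_ultra_setVsetC [set k | k <> n] uU => // Un.
  have nn : ~ (\bigcap_(A in U) A) n by rewrite U0.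
  exfalso; apply: nn => A UA.
  have [k [Ak /= nk]] := filter_ex (filterI UA Un).
  by move: nk => /contrapT <-.
apply: filterS2 IH Un => k /= nk /eqP kn.
by rewrite ltn_neqAle eq_sym kn.
Qed.

(** The image of an ultrafilter is an ultrafilter, and ultrafilters on a compact interval
    converge. *)
Lemma ultralimit_cvg (u : nat -> R) : (forall k, 0 <= u k <= 1) ->
  u @ U --> ultralimit u.
Proof.
move=> u01; have [uU _] := freeU; have pU := ultra_proper_filter.
have uF : UltraFilter (u @ U).
  split; first exact: fmap_proper_filter.
  move=> H pH UH; apply/seteqP; split => A HA; last exact: UH.
  have [//|UC] := in_ultra_setVsetC (u @^-1` A) uU.
  have HC : H (~` A) by apply: UH.
  by have [x [Ax nAx]] := filter_ex (filterI HA HC).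
have := @segment_compact R 0 1; rewrite compact_ultra => /(_ _ uF)[|l [_ ul]].
  have h : U [set k | u k \in `[0, 1]].
    by apply: filterS filterT => k _ /=; rewrite in_itv /=; exact: u01.
  exact: h.
by apply/cvg_ex; exists l.
Qed.

Lemma ultralimit_near (u : nat -> R) : (forall k, 0 <= u k <= 1) ->
  forall e, 0 < e -> U [set k | `|u k - ultralimit u| < e].
Proof.
move=> u01 e e0; have pU := ultra_proper_filter.
have /cvgrPdist_lt/(_ _ e0) := ultralimit_cvg u01.
by apply: filterS => k; rewrite /= distrC.
Qed.

Lemma ultralimit_eq (u : nat -> R) (l : R) : (forall k, 0 <= u k <= 1) ->
  (forall e, 0 < e -> U [set k | `|u k - l| <= e]) -> ultralimit u = l.
Proof.
move=> u01 ul; have pU := ultra_proper_filter.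
apply/eqP; rewrite -subr_eq0 -normr_eq0 eq_le normr_ge0 andbT.
apply/ler_addgt0Pl => e e0; rewrite addr0.
have e20 : 0 < e / 2 by rewrite divr_gt0.
have [k [/= h1 h2]] := filter_ex (filterI (ultralimit_near u01 e20) (ul _ e20)).
rewrite -(subrKA (u k)) distrC in h1 *.
apply: le_trans (ler_normD _ _) _; rewrite (splitr e); apply: lerD => //.
exact: ltW.
Qed.

Lemma ultralimit_bounds (u : nat -> R) : (forall k, 0 <= u k <= 1) ->
  0 <= ultralimit u <= 1.
Proof.
move=> u01; have pU := ultra_proper_filter.
apply/andP; split; apply/ler_addgt0Pl => e e0;
  have [k /=] := filter_ex (ultralimit_near u01 e0);
  have /andP[] := u01 k; rewrite ltr_distl => h0 h1 /andP[]; lra.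
Qed.

Lemma ultralimit_leD (u v w : nat -> R) : (forall k, 0 <= u k <= 1) ->
  (forall k, 0 <= v k <= 1) -> (forall k, 0 <= w k <= 1) ->
  (forall k, u k <= v k + w k) ->
  ultralimit u <= ultralimit v + ultralimit w.
Proof.
move=> u01 v01 w01 uvw; have pU := ultra_proper_filter.
apply/ler_addgt0Pl => e e0; have e30 : 0 < e / 3 by rewrite divr_gt0.
have [k [/= [h1 h2] h3]] := filter_ex (filterI (filterI (ultralimit_near u01 e30)
  (ultralimit_near v01 e30)) (ultralimit_near w01 e30)).
move: h1 h2 h3 (uvw k); rewrite !ltr_distl => /andP[? ?] /andP[? ?] /andP[? ?]; lra.
Qed.

Variable M : nat -> metric_magma R.
Hypothesis pM : forall k, pseudo_magma (M k).

Definition ultra_base : metric_magma R := {|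
  mm_sort := forall k, M k ;
  mm_dist := fun x y => lim ((fun k => mm_dist (x k) (y k)) @ U) ;
  mm_mul := fun x y k => mm_mul (x k) (y k) |}.

Lemma ultra_dist01 (x y : forall k, M k) k : 0 <= mm_dist (x k) (y k) <= 1.
Proof. by rewrite (pseudo_ge0 (pM k)) (pseudo_le1 (pM k)). Qed.

Lemma pseudo_ultra : pseudo_magma ultra_base.
Proof.
split => /=.
- by move=> x y; have /andP[] := ultralimit_bounds (ultra_dist01 x y).
- by move=> x y; have /andP[] := ultralimit_bounds (ultra_dist01 x y).
- move=> x; apply: ultralimit_eq; first exact: ultra_dist01.
  move=> e e0; have pU := ultra_proper_filter.
  apply: filterS filterT => k _ /=.
  by rewrite (pseudo_xx (pM k)) subrr normr0 ltW.
- move=> x y; congr (lim (_ @ U)); apply/funext => k; exact: (pseudo_sym (pM k)).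
- move=> y x z; apply: ultralimit_leD; try exact: ultra_dist01.
  by move=> k; exact: (pseudo_triangle (pM k)).
- move=> x y x' y'; apply: ultralimit_leD; try exact: ultra_dist01.
  by move=> k; exact: (pseudo_mul (pM k)).
Qed.

End ultralimit.

Section full_semigroup_magma.
Context (R : realType) d (G : measurableGroupoidType d).
Variable mu : probability (units G) R.
Local Notation BG := (set_type (borel_full_semigroup G)).

(** The magma of which [full_semigroup] is by definition the quotient, named in order to speak of
    representatives; [ultra_base] does the same for [ultraproduct]. *)
Definition full_semigroup_base : metric_magma R := {|
  mm_sort := BG ;
  mm_dist := fun a b => fine (mu (src @` (val a `+` val b))) ;
  mm_mul := @bmul d G |}.

Definition fs_dist (a b : BG) : R := cdist (fun A => fine (mu A)) (val a) (val b).

Hypothesis pmu : pmp mu.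

Let hG : discrete_measurable_groupoid R G. Proof. by have [] := pmu. Qed.
Let pm := (pmp_contentP hG mu).1 pmu.

Lemma pseudo_full_semigroup_base : pseudo_magma full_semigroup_base.
Proof.
split => /=.
- by move=> x y; rewrite fine_ge0.
- move=> x y; apply: mass_le1.
  exact: (setY_S pm (borel_good x) (borel_good y)).1.
- by move=> x; exact: (cdistxx pm).
- by move=> x y; rewrite setYC.
- by move=> y x z; apply: (cdist_triangle pm); exact: borel_good.
- move=> x y x' y'; rewrite !(val_bmul hG).
  by apply: (cdist_mul pm); exact: borel_good.
Qed.

End full_semigroup_magma.

Lemma fs_dist_refl (R : realType) d (G : measurableGroupoidType d)
    (mu : probability (units G) R) (a b : set_type (borel_full_semigroup G)) :
  val a = val b -> fs_dist mu a b = 0.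
Proof. by rewrite /fs_dist /cdist => ->; rewrite setYK image_set0 measure0. Qed.

Lemma measurable_src_setY (R : realType) d (G : measurableGroupoidType d)
    (mu : probability (units G) R) (a b : set_type (borel_full_semigroup G)) :
  pmp mu -> measurable (src @` (val a `+` val b)).
Proof.
move=> pmu; have pm := (pmp_contentP pmu.1 mu).1 pmu.
exact: (setY_S pm (borel_good a) (borel_good b)).1.
Qed.

Section finite_groupoid.
Context (R : realType).

(** Finite sets are closed in a Hausdorff space. Hence the measures on the finite groupoids in the
    definition of soficity are contents on all subsets. *)
Lemma finite_standard_borel d (T : measurableType d) (A : set T) :
  standard_borel R T -> finite_set [set: T] -> measurable A.
Proof.
move=> [X [f [hX _ _ fE]]] fT; apply/fE; rewrite -[X in borel X]setCK.
apply: sigma_algebraC; apply: sub_sigma_algebra; rewrite /= openC.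
apply: (accessible_finite_set_closed.1 (hausdorff_accessible hX)).
by apply: finite_image; exact: sub_finite_set fT.
Qed.

Lemma finite_pmp_content d (G : measurableGroupoidType d) (mu : probability (units G) R) :
  finite_set [set: G] -> pmp mu -> finite_content (fun A => fine (mu A)).
Proof.
move=> fG pmu; have [hG _] := pmu; have [sG _ _ _ _] := hG.
have pm := (pmp_contentP hG mu).1 pmu.
have mU (A : set (units G)) : measurable A.
  exists (unit_val @` A); first exact: finite_standard_borel sG fG.
  rewrite setTI; apply/seteqP; split => [x [y Ay /unit_val_inj <-]|x Ax]//.
  by exists x.
apply: finite_contentP => [A|A B AB|a ba].
- exact: (pmpc_ge0 pm).
- by rewrite (pmpc_add pm).
- by rewrite (pmpc_inv pm)//; exact: finite_standard_borel sG fG.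
Qed.

End finite_groupoid.

Lemma filter_all (T : Type) (F : set_system T) (X : eqType) (K : seq X)
    (P : X -> set T) : Filter F -> (forall a, F (P a)) ->
  F [set k | {in K, forall a, P a k}].
Proof.
move=> FF FP; elim: K => [|a K IH].
  by apply: filterS filterT => k _ a; rewrite in_nil.
apply: filterS2 IH (FP a) => k hK ha b; rewrite in_cons => /orP[/eqP->//|].
exact: hK.
Qed.

Section sofic_approximation.
Context (R : realType) (U : set_system nat).
Hypothesis freeU : free_ultrafilter U.
Context d (G : measurableGroupoidType d).
Variable mu : probability (units G) R.
Local Notation BG := (set_type (borel_full_semigroup G)).

(** An ultralimit is nearly attained on a set of the ultrafilter; finitely many such sets, one for
    each estimate on [K], have a common coordinate k. *)
Lemma sofic_approximable : sofic U mu -> approximable 1 (fs_dist mu).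
Proof.
move=> [pmu [d_ [G_ [mu_ [finG [f [f_iso f_mul]]]]]]].
have pU := ultra_proper_filter freeU.
have pB := pseudo_full_semigroup_base pmu.
have pBk k := pseudo_full_semigroup_base (finG k).2.
have pQk k := pseudo_quotient (pBk k).
have pV := pseudo_ultra freeU pQk.
pose P := metric_quotient (full_semigroup_base mu).
(* Representatives are taken twice: in the ultraproduct, to get a sequence, and then in the k-th
   coordinate, to get a bisection. *)
pose phi k (a : BG) : set_type (borel_full_semigroup (G_ k)) :=
  @mquot_repr _ (full_semigroup_base (mu_ k))
    (@mquot_repr _ (ultra_base U (fun k => full_semigroup (mu_ k)))
      (f (@mquot_pi _ (full_semigroup_base mu) a)) k).
have phi_dist a b :
    ultralimit U (fun k => fs_dist (mu_ k) (phi k a) (phi k b)) = fs_dist mu a b.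
  have := f_iso (@mquot_pi _ (full_semigroup_base mu) a)
    (@mquot_pi _ (full_semigroup_base mu) b).
  by rewrite (dist_pi pB).
have phi_mul a b : ultralimit U (fun k => fs_dist (mu_ k) (phi k (bmul a b))
    (bmul (phi k a) (phi k b))) = 0.
  have := f_mul (@mquot_pi _ (full_semigroup_base mu) a)
    (@mquot_pi _ (full_semigroup_base mu) b).
  rewrite (mul_pi pB) => e.
  have := repr_pi pV (fun k => mm_mul
    (mquot_repr (f (@mquot_pi _ (full_semigroup_base mu) a)) k)
    (mquot_repr (f (@mquot_pi _ (full_semigroup_base mu) b)) k)).
  rewrite -[X in mquot_repr X]/(mm_mul (f (@mquot_pi _ (full_semigroup_base mu) a))
    (f (@mquot_pi _ (full_semigroup_base mu) b))) -e /= => <-.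
  congr (lim (_ @ U)); apply/funext => k.
  have e1 := repr_pi (pBk k) (bmul (phi k a) (phi k b)).
  have e2 := pseudo_eq0 (pBk k) (phi k (bmul a b)) e1.
  by rewrite [LHS](pseudo_sym (pBk k)) -[LHS]e2; exact: (pseudo_sym (pBk k)).
move=> K e e0.
have fs01 k (a b : set_type (borel_full_semigroup (G_ k))) :
    0 <= fs_dist (mu_ k) a b <= 1.
  exact/andP/(conj (pseudo_ge0 (pBk k) a b) (pseudo_le1 (pBk k) a b)).
have Udist a b := ultralimit_near freeU (fun k => fs01 k (phi k a) (phi k b)) e0.
have Umul a b := ultralimit_near freeU
  (fun k => fs01 k (phi k (bmul a b)) (bmul (phi k a) (phi k b))) e0.
have [k kP] := filter_ex (filter_all K _ (fun a => filter_all K _ (fun b =>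
  filterI (Udist a b) (Umul a b)))).
have [fk pk] := finG k; have [hk _] := pk.
exists (G_ k), (fun A => fine (mu_ k A)), (fun a => val (phi k a)); split => //.
- exact: finite_pmp_content.
- by move=> a; have [] := borel_good (phi k a).
- by rewrite probability_setT subrr normr0 ltW.
- move=> a b aK bK; have [/= h1 h2] := kP a aK b bK; split.
    by rewrite -phi_dist ltW.
  move: h2; rewrite phi_mul subr0 ger0_norm; last by have /andP[] := fs01 _ (phi k (bmul a b)) (bmul (phi k a) (phi k b)).
  by rewrite /fs_dist (val_bmul hk) => /ltW.
Qed.

End sofic_approximation.

Section approximation_sofic.
Context (R : realType) (U : set_system nat).
Hypothesis freeU : free_ultrafilter U.
Context d (G : measurableGroupoidType d).
Variable mu : probability (units G) R.
Local Notation BG := (set_type (borel_full_semigroup G)).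

(** [a n] enumerates a dense set.  The [k]-th coordinate of the image of [x] is
    the image, in the [k]-th finite model, of the best approximation of [x] among
    [a 0, ..., a k]; no extension by continuity is needed. *)
Lemma approximable_sofic :
  pmp mu -> approximable 1 (fs_dist mu) -> sofic U mu.
Proof.
move=> pmu ap; have pU := ultra_proper_filter freeU.
have [hG _] := pmu; have pm := (pmp_contentP hG mu).1 pmu.
have pB := pseudo_full_semigroup_base pmu.
have [a aD] := full_semigroup_dense hG mu.
(* Products are included because the image of the product of two approximants is compared with that
   of the approximant of the product. *)
pose K k := [seq a i | i <- iota 0 k.+1] ++
  [seq bmul (a i) (a j) | i <- iota 0 k.+1, j <- iota 0 k.+1].
have aK k i : (i <= k)%N -> a i \in K k.
  move=> ik; rewrite mem_cat; apply/orP; left.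
  by apply: map_f; rewrite mem_iota.
have aaK k i j : (i <= k)%N -> (j <= k)%N -> bmul (a i) (a j) \in K k.
  move=> ik jk; rewrite mem_cat; apply/orP; right.
  by apply: (allpairs_f (fun i j => bmul (a i) (a j))); rewrite mem_iota.
have /choice[F FP] : forall k, exists F : finite_model R BG, {in K k &, forall x y,
    `|model_dist (val (model_map F x)) (val (model_map F y)) - fs_dist mu x y| <= rad R k /\
    model_dist (val (model_map F (bmul x y)))
      (set_gmul (val (model_map F x)) (val (model_map F y))) <= rad R k}.
  (* Two scales make up for the factor 4 lost in [approx_model]. *)
  move=> k; have rE : rad R k = 4 * rad R k.+2.
    by have := radS R k; have := radS R k.+1; lra.
  rewrite rE; apply: approx_model (ap (K k) _ (rad_gt0 R _)) _.
  - exact: rad_gt0.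
  - rewrite /rad -[leRHS]expr1; apply: ler_wiXn2l => //; lra.
  - move=> x y _ _; apply/andP; split; first exact: (pseudo_ge0 pB).
    exact: (pseudo_le1 pB).
have dN x y z : fs_dist mu x z <= fs_dist mu x y + fs_dist mu y z.
  exact: (pseudo_triangle pB).
have dC x y : fs_dist mu x y = fs_dist mu y x by exact: (pseudo_sym pB).
have d0 x y : 0 <= fs_dist mu x y by exact: (pseudo_ge0 pB).
have dM x y x' y' : fs_dist mu (bmul x y) (bmul x' y') <=
    fs_dist mu x x' + fs_dist mu y y' by exact: (pseudo_mul pB).
have /choice[n nP] : forall xk : BG * nat, exists i, (i <= xk.2)%N /\
    forall j, (j <= xk.2)%N -> fs_dist mu xk.1 (a i) <= fs_dist mu xk.1 (a j).
  move=> [x k] /=.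
  have [i _ iP] := arg_minP (fun i : 'I_k.+1 => fs_dist mu x (a i)) (erefl : xpredT (ord0 : 'I_k.+1)).
  exists i; split; first by rewrite -ltnS.
  by move=> j; rewrite -ltnS => jk; exact: (iP (Ordinal jk)).
pose b x k := a (n (x, k)).
have nk x k : (n (x, k) <= k)%N by have [] := nP (x, k).
have bx x e : 0 < e -> U [set k | fs_dist mu x (b x k) < e].
  move=> e0; have [j xj] := aD x _ e0.
  apply: filterS (ultra_ge freeU j) => k /= jk.
  by apply: le_lt_trans xj; have [_ ] := nP (x, k); apply.
have radU e : 0 < e -> U [set k | rad R k < e].
  move=> /(@rad_lt R)[j je]; apply: filterS (ultra_ge freeU j) => k /= jk.
  apply: le_lt_trans je; rewrite /rad; apply: ler_wiXn2l => //; lra.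
pose phi x k := model_map (F k) (b x k).
pose muk k := model_measure (F k).
have pBk k := pseudo_full_semigroup_base (model_pmp (F k)).
have pQk k := pseudo_quotient (pBk k).
have pV := pseudo_ultra freeU pQk.
have hGk k : discrete_measurable_groupoid R (model_groupoid (F k)).
  by have [] := model_pmp (F k).
pose f (c : full_semigroup mu) : ultraproduct U (fun k => full_semigroup (muk k)) :=
  @mquot_pi _ (ultra_base U (fun k => full_semigroup (muk k)))
    (fun k => @mquot_pi _ (full_semigroup_base (muk k)) (phi (mquot_repr c) k)).
have phi_dist x y :
    ultralimit U (fun k => fs_dist (muk k) (phi x k) (phi y k)) = fs_dist mu x y.
  apply: (ultralimit_eq freeU).
    move=> k; apply/andP/(conj (pseudo_ge0 (pBk k) _ _)).
    exact: (pseudo_le1 (pBk k)).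
  (* Three errors: the approximations of [x] and [y], and the model. *)
  move=> e e0; have e30 : 0 < e / 3 by rewrite divr_gt0.
  apply: filterS2 (filterI (bx x _ e30) (bx y _ e30)) (radU _ e30) => k /= [xk yk] rk.
  have [h _] := FP k _ _ (aK _ _ (nk x k)) (aK _ _ (nk y k)).
  have {}h : `|fs_dist (muk k) (phi x k) (phi y k) - fs_dist mu (b x k) (b y k)|
    <= rad R k := h.
  have h1 := dN x (b x k) y; have h2 := dN (b x k) (b y k) y.
  have h3 := dN (b x k) x (b y k); have h4 := dN x y (b y k).
  rewrite (dC (b x k) x) in h3; rewrite (dC (b y k) y) in h2.
  change (`|fs_dist (muk k) (phi x k) (phi y k) - fs_dist mu x y| <= e).
  move: h; rewrite !ler_distl => /andP[h5 h6]; apply/andP; split; lra.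
have phi_mul x y z : fs_dist mu z (bmul x y) = 0 ->
    ultralimit U (fun k => fs_dist (muk k) (phi z k) (bmul (phi x k) (phi y k))) = 0.
  move=> zxy; apply: (ultralimit_eq freeU).
    move=> k; apply/andP/(conj (pseudo_ge0 (pBk k) _ _)).
    exact: (pseudo_le1 (pBk k)).
  (* Five errors: the approximations of [x], [y] and [z], and the model, once for a distance and
     once for a product. *)
  move=> e e0; have e50 : 0 < e / 5%:R by rewrite divr_gt0.
  apply: filterS2 (filterI (filterI (bx x _ e50) (bx y _ e50)) (bx z _ e50))
    (radU _ e50) => k /= [[xk yk] zk] rk.
  have [h1 _] := FP k _ _ (aK _ _ (nk z k)) (aaK _ _ _ (nk x k) (nk y k)).
  have [_ h2] := FP k _ _ (aK _ _ (nk x k)) (aK _ _ (nk y k)).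
  have h3 := dN (b z k) z (bmul (b x k) (b y k)).
  have h4 := dN z (bmul x y) (bmul (b x k) (b y k)).
  have h5 := dM x y (b x k) (b y k).
  have h6 : fs_dist (muk k) (phi z k) (bmul (phi x k) (phi y k)) <=
      fs_dist (muk k) (phi z k) (model_map (F k) (bmul (b x k) (b y k))) +
      fs_dist (muk k) (model_map (F k) (bmul (b x k) (b y k)))
        (bmul (phi x k) (phi y k)) by exact: (pseudo_triangle (pBk k)).
  rewrite -(val_bmul (hGk k)) in h2.
  have {}h2 : fs_dist (muk k) (model_map (F k) (bmul (b x k) (b y k)))
    (bmul (phi x k) (phi y k)) <= rad R k := h2.
  have {}h1 : `|fs_dist (muk k) (phi z k) (model_map (F k) (bmul (b x k) (b y k))) -
    fs_dist mu (b z k) (bmul (b x k) (b y k))| <= rad R k := h1.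
  rewrite subr0 ger0_norm; last exact: (pseudo_ge0 (pBk k)).
  rewrite (dC (b z k) z) in h3.
  change (fs_dist (muk k) (phi z k) (bmul (phi x k) (phi y k)) <= e).
  move: h1; rewrite ler_distl => /andP[_ h1]; lra.
split => //.
exists (fun k => model_display (F k)), (fun k => model_groupoid (F k)), muk; split.
  by move=> k; split; [exact: model_finite|exact: model_pmp].
exists f; split.
- move=> x y; rewrite [LHS](dist_pi pV) /=.
  rewrite -[RHS](phi_dist (mquot_repr x) (mquot_repr y)).
  by congr (lim (_ @ U)); apply/funext => k; exact: (dist_pi (pBk k)).
- move=> x y; rewrite [RHS](mul_pi pV); apply: (pi_eq pV) => /=.
  have zxy : fs_dist mu (mquot_repr (mm_mul x y)) (bmul (mquot_repr x) (mquot_repr y)) = 0.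
    exact: (repr_pi pB).
  rewrite -[RHS](phi_mul _ _ _ zxy); congr (lim (_ @ U)); apply/funext => k.
  rewrite -[LHS]/(mm_dist (@mquot_pi _ (full_semigroup_base (muk k)) _ : metric_quotient _)
    (mm_mul (@mquot_pi _ (full_semigroup_base (muk k)) _ : metric_quotient _)
            (@mquot_pi _ (full_semigroup_base (muk k)) _ : metric_quotient _))).
  by rewrite (mul_pi (pBk k)) (dist_pi (pBk k)).
Qed.

End approximation_sofic.

(** * Subgroupoids and corners *)

Section subgroupoid.
Context d (G : measurableGroupoidType d) (H : subgroupoid G).
Local Notation HT := (subgpd_type H).
Local Notation v := (@subgpd_val d G H).
Local Notation incl := (@subgpd_unit_incl d G H).
Implicit Types (x y : HT) (A B : set HT).

Lemma subgpd_val_inj : injective v. Proof. exact: val_inj. Qed.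

Lemma subgpd_valP x : subgpd_set H (v x). Proof. exact: set_mem (valP x). Qed.

Lemma subgpd_val_surj g : subgpd_set H g -> exists x, v x = g.
Proof. by move=> Hg; exists (SigSub (mem_set (Hg : subgpd_set H g))). Qed.

Lemma subgpd_unit_incl_inj : injective incl.
Proof.
move=> x y /(congr1 (@unit_val _)) e; apply: unit_val_inj.
exact: subgpd_val_inj.
Qed.

Lemma incl_src x : incl (src x) = src (v x).
Proof. by apply: unit_val_inj; exact: subgpd_val_src. Qed.

Lemma incl_rng x : incl (rng x) = rng (v x).
Proof. by rewrite -src_inv incl_src; exact: src_inv. Qed.

Lemma subgpd_src_rng x y : src x = rng y <-> src (v x) = rng (v y).
Proof. by rewrite -incl_src -incl_rng; split => [->//|/subgpd_unit_incl_inj]. Qed.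

Lemma subgpd_src_src x y : src x = src y <-> src (v x) = src (v y).
Proof. by rewrite -!incl_src; split => [->//|/subgpd_unit_incl_inj]. Qed.

Lemma subgpd_rng_rng x y : rng x = rng y <-> rng (v x) = rng (v y).
Proof. by rewrite -!incl_rng; split => [->//|/subgpd_unit_incl_inj]. Qed.

Lemma subgpd_val_mul x y : src x = rng y -> v (gmul x y) = gmul (v x) (v y).
Proof.
move=> /subgpd_src_rng e; rewrite [gmul in LHS]/gmul /= /subgpd_gmul.
by case: pselect.
Qed.

Lemma subgpd_val_set_gmul A B :
  v @` set_gmul A B = set_gmul (v @` A) (v @` B).
Proof.
apply/seteqP; split => [_ [_ [x [y [Ax By xy ->]]] <-]|_ [_ [_ [[x Ax <-] [y By <-] xy ->]]]].
  exists (v x), (v y); split; [by exists x|by exists y|exact/subgpd_src_rng|].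
  exact: subgpd_val_mul.
have xy' : src x = rng y by exact/subgpd_src_rng.
exists (gmul x y); last exact: subgpd_val_mul.
by exists x, y.
Qed.

Lemma subgpd_val_bisection A : bisection (v @` A) <-> bisection A.
Proof.
split=> -[sA rA].
  split=> x y /set_mem Ax /set_mem Ay xy; apply: subgpd_val_inj.
    by apply: sA; rewrite ?inE; [exists x|exists y|exact/subgpd_src_src].
  by apply: rA; rewrite ?inE; [exists x|exists y|exact/subgpd_rng_rng].
split=> _ _ /set_mem[x Ax <-] /set_mem[y Ay <-].
  by move=> /subgpd_src_src xy; congr v; apply: sA; rewrite ?inE.
by move=> /subgpd_rng_rng xy; congr v; apply: rA; rewrite ?inE.
Qed.

Lemma image_setY (T1 T2 : Type) (f : T1 -> T2) (A B : set T1) : injective f ->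
  f @` (A `+` B) = f @` A `+` f @` B.
Proof.
move=> f_inj; rewrite !setY_def; apply/seteqP; split.
  move=> _ [x [[Ax nB]|[Bx nA]] <-]; [left|right]; split; try by exists x.
    by move=> [y By /f_inj xy]; apply: nB; rewrite -xy.
  by move=> [y Ay /f_inj xy]; apply: nA; rewrite -xy.
move=> _ [[[x Ax <-] nB]|[[x Bx <-] nA]]; exists x => //.
  by left; split.
by right; split.
Qed.

Lemma incl_src_image A : incl @` (src @` A) = src @` (v @` A).
Proof. by rewrite !image_comp; apply: eq_imagel => x _ /=; exact: incl_src. Qed.

Lemma incl_rng_image A : incl @` (rng @` A) = rng @` (v @` A).
Proof. by rewrite !image_comp; apply: eq_imagel => x _ /=; exact: incl_rng. Qed.

Lemma subgpd_val_preimage (B : set G) : v @` (v @^-1` B) = subgpd_set H `&` B.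
Proof.
apply/seteqP; split => [_ [x Bx <-]|g [Hg Bg]].
  by split => //; exact: subgpd_valP.
by have [x xg] := subgpd_val_surj Hg; exists x => //; rewrite /preimage /= xg.
Qed.

Lemma measurable_subgpd_val_image A : measurable A -> measurable (v @` A).
Proof.
move=> [B mB <-]; rewrite setTI subgpd_val_preimage.
by apply: measurableI => //; exact: subgpd_measurable.
Qed.

Lemma measurable_subgpd_val : measurable_fun setT v.
Proof. by move=> _ B mB; rewrite setTI; exists B => //; rewrite setTI. Qed.

Context (R : realType).
Hypothesis hG : discrete_measurable_groupoid R G.

Lemma subgpd_discrete_measurable : discrete_measurable_groupoid R HT.
Proof.
have [[X [f [hX cX f_inj fE]]] mC mM mV cG] := hG.
pose vv := fun xy : HT * HT => (v xy.1, v xy.2).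
have mvv : measurable_fun setT vv.
  by apply: measurable_fun_pair; apply: measurableT_comp => //;
    exact: measurable_subgpd_val.
split.
- exists X, (f \o v); split => //; first exact: inj_comp subgpd_val_inj.
  move=> A; rewrite -image_comp -fE; split; first exact: measurable_subgpd_val_image.
  move=> mA; exists (v @` A) => //; rewrite setTI.
  by apply/seteqP; split => [x [y Ay /subgpd_val_inj <-]|x Ax]//; exists x.
- rewrite (_ : composable HT = setT `&` vv @^-1` composable G); first exact: mvv.
  by rewrite setTI; apply/seteqP; split => -[x y] /subgpd_src_rng.
- move=> _ A [B mB <-]; rewrite setTI.
  rewrite (_ : _ `&` _ = setT `&`
      vv @^-1` (composable G `&` (fun gh => gmul gh.1 gh.2) @^-1` B)).
    by apply: mvv => //; exact: mM.
  rewrite setTI; apply/seteqP; split => -[x y].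
    move=> [xy]; rewrite /preimage /= subgpd_val_mul// => Bxy.
    by split => //; exact/subgpd_src_rng.
  move=> [/subgpd_src_rng xy]; rewrite /preimage /= => Bxy.
  by split => //=; rewrite subgpd_val_mul.
- move=> _ A [B mB <-]; rewrite !setTI.
  exists (@ginv G @^-1` B); last by rewrite setTI.
  by rewrite -[X in measurable X]setTI; exact: mV.
- move=> x; apply: (@sub_countable _ _ _ (src @^-1` [set incl x])); last exact: cG.
  rewrite -(card_le_eql (inj_card_eq (in2W subgpd_val_inj))).
  apply: subset_card_le => _ [y yx <-].
  by rewrite /preimage /= -incl_src yx.
Qed.

Lemma subgpd_pmp (mu : probability (units G) R) (h : non_null H mu) :
  pmp mu -> pmp (subgpd_measure h).
Proof.
move=> [_ mu_inv]; split; first exact: subgpd_discrete_measurable.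
move=> a /borel_full_semigroupP[ma ba]; rewrite /= /subgpd_measure.
rewrite incl_src_image incl_rng_image mu_inv//.
apply/borel_full_semigroupP; split; first exact: measurable_subgpd_val_image.
exact/subgpd_val_bisection.
Qed.

End subgroupoid.

Section finite_corner.
Context (R : realType).

Definition corner (N : groupoidType) (Y : set (units N)) : set N :=
  [set g | Y (src g) /\ Y (rng g)].

(** [rho] cuts a set of arrows down to the corner over [Y]. The corner is described through [rho]
    alone, so as to cover an empty [Y], for which there is no [subgroupoid]. *)
Definition corner_of (N N' : groupoidType) (m : set (units N) -> R)
    (Y : set (units N)) (m' : set (units N') -> R) (rho : set N -> set N') :=
  [/\ finite_set [set: N'], finite_content m', m' setT = m Y,
      (forall A, bisection A -> bisection (rho A)) &
      (forall A B, cdist m' (rho A) (rho B) =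
        cdist m (A `&` corner Y) (B `&` corner Y)) /\
      (forall A B, set_gmul (rho A) (rho B) =
        rho (set_gmul (A `&` corner Y) (B `&` corner Y)))].

(** With all subsets measurable, the corner is a [subgroupoid], whose groupoid structure is
    reused. *)
Lemma corner_discrete (N : groupoidType) (x0 : N)
    (m : set (units (discrete_groupoid x0)) -> R)
    (Y : set (units (discrete_groupoid x0))) :
  Y !=set0 -> finite_set [set: N] -> finite_content m ->
  exists (N' : groupoidType) (m' : set (units N') -> R) rho, corner_of m Y m' rho.
Proof.
set T := discrete_groupoid x0 in m Y *; move=> [y0 Yy0] finN pm.
have Cmul (g h : T) : corner Y g -> corner Y h -> src g = rng h -> corner Y (gmul g h).
  by move=> [_ Yg] [Yh _] gh; split; rewrite ?src_mul ?rng_mul.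
have Cinv (g : T) : corner Y g -> corner Y (ginv g).
  by move=> [Yg Yg']; split; rewrite ?src_inv ?rng_inv.
have C0 : corner Y !=set0.
  by exists (unit_val y0); split; rewrite ?src_unit ?rng_unit.
pose H : subgroupoid T := Subgroupoid C0 (discrete_measurableT _) Cmul Cinv.
pose v := @subgpd_val _ _ H; pose incl := @subgpd_unit_incl _ _ H.
have v_inj : injective v by exact: subgpd_val_inj.
have vK (A : set (subgpd_type H)) : v @^-1` (v @` A) = A.
  by apply/seteqP; split => [x [y Ay /v_inj <-]|x Ax]//; exists x.
pose rho (A : set T) := v @^-1` A.
have vrho A : v @` rho A = A `&` corner Y.
  by rewrite setIC; exact: (subgpd_val_preimage H).
exists (subgpd_type H), (fun S => m (incl @` S)), rho; split.
- have -> : [set: subgpd_type H] = v @^-1` setT by rewrite preimage_setT.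
  by apply: finite_preimage; [exact: in2W v_inj|exact: finN].
- apply: finite_contentP => [A|A B AB|a ba].
  + exact: (pmpc_ge0 pm).
  + rewrite image_setU (pmpc_add pm)// -subset0 => x [[y Ay yx] [z Bz zx]].
    have yz : y = z by apply: (@subgpd_unit_incl_inj _ _ H); rewrite [LHS]yx -zx.
    by have : (A `&` B) y; [split; rewrite // yz|rewrite AB].
  + rewrite /incl incl_src_image incl_rng_image (pmpc_inv pm)//.
    exact/subgpd_val_bisection.
- congr m; apply/seteqP; split => [_ [x _ <-]|y Yy].
    have [+ _] := subgpd_valP (unit_val x).
    by rewrite -[X in src X]/(unit_val (incl x)) src_unit.
  have [|x xy] := @subgpd_val_surj _ _ H (unit_val y).
    by split; rewrite ?src_unit ?rng_unit.
  by exists (src x) => //; rewrite /incl incl_src xy src_unit.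
- move=> A bA; have bv : bisection (v @` rho A).
    by rewrite vrho; apply: bisection_sub bA; exact: subIsetl.
  exact: (@subgpd_val_bisection _ _ H _).1 bv.
- split=> A B.
    rewrite /cdist /incl incl_src_image; congr (m (src @` _)).
    by rewrite -!vrho; exact: image_setY.
  rewrite -[LHS]vK; congr (v @^-1` _).
  by rewrite -!vrho; exact: subgpd_val_set_gmul.
Qed.

Lemma corner_exists (N : groupoidType) (m : set (units N) -> R) (Y : set (units N)) :
  finite_set [set: N] -> finite_content m ->
  exists (N' : groupoidType) (m' : set (units N') -> R) rho, corner_of m Y m' rho.
Proof.
move=> finN pm; have [[y0 Yy0]|Y0] := pselect (Y !=set0).
  case: N m Y finN pm y0 Yy0 => S [mix] m Y finN pm y0 Yy0.
  pose N : groupoidType := Groupoid.Pack (Groupoid.Class mix).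
  by apply: (@corner_discrete N (unit_val y0) m Y _ finN pm); exists y0.
have {}Y0 : Y = set0 by rewrite -subset0 => y Yy; apply: Y0; exists y.
have [m' [pm' m'T]] := unit_content (lexx (0 : R)).
have C0 : corner Y = set0 by rewrite Y0 -subset0 => g [].
exists unit, m', (fun=> set0); split => //.
- exact: (@finite_finset _ _).
- by rewrite m'T Y0 (pmpc_0 pm).
- by move=> A _; exact: bisection0.
- split=> A B; last by rewrite set_gmul0.
  by rewrite C0 !setI0 (cdistxx pm) (cdistxx pm').
Qed.

End finite_corner.

Section corner_approximation.
Context (R : realType) (N : groupoidType) (m : set (units N) -> R).
Hypothesis pm : finite_content m.
Implicit Types A B E : set N.

Let mono (A B : set (units N)) : A `<=` B -> m A <= m B.
Proof. exact: (pmpc_mono pm). Qed.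

Let subU (A B : set (units N)) : m (A `|` B) <= m A + m B.
Proof. exact: (pmpc_subU pm). Qed.

Let src_setD A B : bisection A -> bisection B -> m (src @` (A `\` B)) <= cdist m A B.
Proof. by move=> bA bB; apply: (src_setY_le pm). Qed.

(** If an arrow of [E] is a product of two arrows of [E], it shares its range with the first and its
    source with the second, so it equals both; being idempotent, it is a unit. *)
Lemma approx_idempotent_unit E : bisection E ->
  m (src @` (E `\` unit_arrows N)) <= cdist m E (set_gmul E E).
Proof.
move=> bE; apply: le_trans (src_setD bE (bisection_mul bE bE)).
apply: mono; apply: image_subset => g [Eg nug]; split => //.
move=> [x [y [Ex Ey xy gE]]]; apply: nug.
have gy : g = y by apply: (bisection_srcI bE) => //; rewrite gE src_mul.
have gx : g = x by apply: (bisection_rngI bE) => //; rewrite gE rng_mul.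
have gg : gmul g g = g by rewrite {1}gx gy -gE -gy.
have sr : src g = rng g by rewrite {1}gx xy gy.
by rewrite (idem_unit sr gg); exact: gsrc_unit.
Qed.

Definition units_of E : set (units N) := [set x | E (unit_val x)].

Lemma units_of_split E : src @` E `<=` units_of E `|` src @` (E `\` unit_arrows N).
Proof.
move=> _ [g Eg <-]; have [ug|nug] := pselect (unit_arrows N g).
  by left; rewrite /units_of /= (_ : unit_val _ = g)//; exact: ug.
by right; exists g.
Qed.

(** An arrow of [A] that is a product with an arrow of [E] on either side has its source and range
    in [units_of E], unless one of these arrows of [E] is not a unit. Non-units of [E] are few, and
    those met at ranges are carried to sources by invariance. *)
Lemma corner_src A E : bisection A -> bisection E ->
  m (src @` (A `\` corner (units_of E))) <=
  cdist m A (set_gmul A E) + cdist m A (set_gmul E A) + 2 * cdist m E (set_gmul E E).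
Proof.
move=> bA bE; pose u := E `\` unit_arrows N.
have bu : bisection u by apply: bisection_sub bE; exact: subDsetl.
have mu : m (src @` u) <= cdist m E (set_gmul E E) by exact: approx_idempotent_unit.
have Sp := src_setD bA (bisection_mul bA bE).
have Rp := src_setD bA (bisection_mul bE bA).
have ru : m (src @` (A `&` rng @^-1` (rng @` u))) <= m (src @` u).
  rewrite (pmpc_inv pm _ bu)//; exact: (inv_corestrict pm).
apply: le_trans (_ : m ((src @` (A `\` set_gmul A E) `|` src @` u) `|`
  (src @` (A `\` set_gmul E A) `|` src @` (A `&` rng @^-1` (rng @` u)))) <= _).
  apply: mono => _ [g [Ag nC] <-].
  have [Yg|nYg] := pselect (units_of E (src g)).
    right; have [[x [y [Ex Ay xy gE]]]|nEA] := pselect (set_gmul E A g); last first.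
      by left; exists g.
    right; exists g => //; split => //; exists x; last by rewrite gE rng_mul.
    split => // ux; apply: nC; split => //.
    rewrite gE rng_mul// /units_of /=; suff -> : unit_val (rng x) = x by [].
    have -> : rng x = src x by rewrite -[in LHS](_ : unit_val (src x) = x) ?rng_unit//; exact: ux.
    exact: ux.
  left; have [[x [y [Ax Ey xy gE]]]|nAE] := pselect (set_gmul A E g); last first.
    by left; exists g.
  right; exists y; last by rewrite gE src_mul.
  split => // uy; apply: nYg; rewrite gE src_mul// /units_of /=.
  by suff -> : unit_val (src y) = y by []; exact: uy.
have h1 := subU (src @` (A `\` set_gmul A E) `|` src @` u)
  (src @` (A `\` set_gmul E A) `|` src @` (A `&` rng @^-1` (rng @` u))).
have h2 := subU (src @` (A `\` set_gmul A E)) (src @` u).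
have h3 := subU (src @` (A `\` set_gmul E A)) (src @` (A `&` rng @^-1` (rng @` u))).
by move: h1 h2 h3 Sp Rp ru mu; lra.
Qed.

(** The image [Z] of the empty set is nearly contained in that [P] of the unit,
    and both nearly consist of units; their distance is nearly maximal. *)
Lemma zero_small P Z (e : R) : bisection P -> bisection Z ->
  cdist m P (set_gmul P P) <= e -> cdist m Z (set_gmul Z Z) <= e ->
  cdist m Z (set_gmul Z P) <= e -> 1 - e <= cdist m P Z -> m setT <= 1 + e ->
  m (src @` Z) <= 7%:R * e.
Proof.
move=> bP bZ PP ZZ ZP PZ mT.
pose uP := src @` (P `\` unit_arrows N); pose uZ := src @` (Z `\` unit_arrows N).
have h1 : m uP <= e by apply: le_trans (approx_idempotent_unit bP) PP.
have h2 : m uZ <= e by apply: le_trans (approx_idempotent_unit bZ) ZZ.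
have h3 : m (src @` (Z `\` set_gmul Z P)) <= e.
  exact: le_trans (src_setD bZ (bisection_mul bZ bP)) ZP.
pose I := units_of P `&` units_of Z.
have h4 : m (src @` Z) <= m (src @` (Z `\` set_gmul Z P)) + (m I + m uP + m uZ).
  apply: le_trans (_ : m (src @` (Z `\` set_gmul Z P) `|` ((I `|` uP) `|` uZ)) <= _).
    apply: mono => _ [g Zg <-].
    have [[x [y [Zx Py xy gE]]]|nZP] := pselect (set_gmul Z P g); last by left; exists g.
    right; have [Zu|Zu] := units_of_split (imageP src Zg); last by right.
    left; have [Pu|Pu] := units_of_split (imageP src Py); last first.
      by right; rewrite gE src_mul.
    by left; split => //; rewrite gE src_mul.
  apply: le_trans (subU _ _) _; rewrite lerD2l; apply: le_trans (subU _ _) _.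
  by rewrite lerD2r; exact: subU.
have h5 : cdist m P Z <= m (~` I) + m uP + m uZ.
  apply: le_trans (_ : m ((~` I `|` uP) `|` uZ) <= _); last first.
    by apply: le_trans (subU _ _) _; rewrite lerD2r; exact: subU.
  apply: mono; rewrite setY_def => _ [g gPZ <-].
  have [ug|nug] := pselect (unit_arrows N g); last first.
    case: gPZ => -[gP gZ]; [left; right|right]; exists g => //.
  left; left => -[].
  rewrite /units_of /= (_ : unit_val _ = g); last exact: ug.
  by case: gPZ => -[].
have h6 : m I + m (~` I) <= 1 + e.
  by rewrite -(pmpc_add pm)// ?setICr// setUCr.
(* The common units [I] have mass at most [4 * e], by [h5] and [h6]; the three other terms of [h4]
   make it 7. *)
by move: h1 h2 h3 h4 h5 h6 PZ; lra.
Qed.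

End corner_approximation.

Section corner.
Context (R : realType) d (G : measurableGroupoidType d).
Hypothesis hG : discrete_measurable_groupoid R G.
Local Notation BG := (set_type (borel_full_semigroup G)).

Definition BG_zero : BG := to_BG (good0_measurable G).

Lemma unit_arrowsE (N : groupoidType) : unit_arrows N = unit_val @` setT.
Proof.
apply/seteqP; split => [x ux|_ [x _ <-]]; last exact: gsrc_unit.
by exists (src x) => //; exact: ux.
Qed.

Lemma good_unit_arrows : good measurable (unit_arrows G).
Proof.
split; first exact: (measurable_unit_arrows hG).
by rewrite unit_arrowsE; exact: bisection_units.
Qed.

Definition BG_one : BG := to_BG good_unit_arrows.

Lemma unit_arrows_gmul (N : groupoidType) (a : set N) : set_gmul (unit_arrows N) a = a.
Proof.
apply/seteqP; split => [_ [x [y [ux ay xy ->]]]|g ag].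
  suff -> : x = unit_val (rng y) by rewrite mul_unit_rng.
  by rewrite -xy; exact/esym.
exists (unit_val (rng g)), g; split => //.
- exact: gsrc_unit.
- by rewrite src_unit.
- by rewrite mul_unit_rng.
Qed.

Lemma bmul_one (x : BG) : bmul BG_one x = x.
Proof. by apply: val_inj; rewrite (val_bmul hG) unit_arrows_gmul. Qed.

Lemma bmul_zero (x : BG) : bmul BG_zero x = BG_zero.
Proof. by apply: val_inj; rewrite (val_bmul hG) set_0gmul. Qed.

Variable mu : probability (units G) R.
Hypotheses (pmu : pmp mu) (ap : approximable 1 (fs_dist mu)).

Lemma fs_dist_one_zero : fs_dist mu BG_one BG_zero = 1.
Proof.
rewrite /fs_dist cdist0 (_ : src @` _ = setT) ?probability_setT//.
apply/seteqP; split => // x _; exists (unit_val x); last exact: src_unit.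
exact: gsrc_unit.
Qed.

(** [theta] is a morphism, up to null sets, into the corner of [e]. Its domain is the semigroup of
    any groupoid [G']: arrows are pushed into [G] from a subgroupoid, or pulled back to a piece of a
    partition, or cut down within the same groupoid. *)
Lemma approximable_corner d' (G' : measurableGroupoidType d')
    (theta : set_type (borel_full_semigroup G') -> BG) (e : BG) :
  (forall a, fs_dist mu (bmul (theta a) e) (theta a) = 0) ->
  (forall a, fs_dist mu (bmul e (theta a)) (theta a) = 0) ->
  fs_dist mu (bmul e e) e = 0 ->
  (forall a b, fs_dist mu (theta (bmul a b)) (bmul (theta a) (theta b)) = 0) ->
  approximable (fs_dist mu e BG_zero) (fun a b => fs_dist mu (theta a) (theta b)).
Proof.
(* The estimate for products is the worst, with 26 times [del]: three cuts to the corner at 8 each,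
   the multiplicativity of [theta] and that of [phi]. *)
move=> re le_ ee hom K eps eps0; pose del := eps / 32%:R.
have del0 : 0 < del by rewrite divr_gt0.
(* The images of products are also cut to the corner. *)
pose L := K ++ [seq bmul a b | a <- K, b <- K].
have KL a : a \in K -> a \in L by move=> aK; rewrite mem_cat aK.
have KKL a b : a \in K -> b \in K -> bmul a b \in L.
  by move=> aK bK; rewrite mem_cat (allpairs_f (@bmul _ G') aK bK) orbT.
pose K' : seq BG := [:: e; BG_zero; BG_one; bmul e e] ++ [seq theta a | a <- L] ++
  [seq bmul (theta a) e | a <- L] ++ [seq bmul e (theta a) | a <- L] ++
  [seq bmul (theta a) (theta b) | a <- K, b <- K].
have Ke : e \in K' by rewrite mem_cat inE eqxx.
have K0 : BG_zero \in K' by rewrite mem_cat !inE eqxx !orbT.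
have K1 : BG_one \in K' by rewrite mem_cat !inE eqxx !orbT.
have Kee : bmul e e \in K' by rewrite mem_cat !inE eqxx !orbT.
have Kt a : a \in L -> theta a \in K'.
  by move=> aK; rewrite !mem_cat (map_f theta aK) !orbT.
have Kte a : a \in L -> bmul (theta a) e \in K'.
  by move=> aK; rewrite !mem_cat (map_f (fun a => bmul (theta a) e) aK) !orbT.
have Ket a : a \in L -> bmul e (theta a) \in K'.
  by move=> aK; rewrite !mem_cat (map_f (fun a => bmul e (theta a)) aK) !orbT.
have Ktatb a b : a \in K -> b \in K -> bmul (theta a) (theta b) \in K'.
  move=> aK bK; rewrite !mem_cat.
  by rewrite (allpairs_f (fun a b => bmul (theta a) (theta b)) aK bK) !orbT.
have [N [m [phi [fN pm bphi mT h]]]] := ap K' del0.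
have g A : bisection A -> good setT A by [].
have tri B A C : bisection A -> bisection B -> bisection C ->
    cdist m A C <= cdist m A B + cdist m B C.
  by move=> bA bB bC; exact: (cdist_triangle pm).
have mulP x y : x \in K' -> y \in K' ->
    cdist m (phi (bmul x y)) (set_gmul (phi x) (phi y)) <= del.
  by move=> xK yK; have [] := h x y xK yK.
have eqP x y : x \in K' -> y \in K' -> fs_dist mu x y = 0 ->
    cdist m (phi x) (phi y) <= del.
  move=> xK yK xy; have [+ _] := h x y xK yK.
  by rewrite xy subr0 ger0_norm// (cdist_ge0 pm).
have bM := bisection_mul.
(* The mass of the corner is controlled through the distance of [e] to the empty bisection, whose
   image must therefore be small. *)
have Z7 : m (src @` phi BG_zero) <= 7%:R * del.
  apply: (zero_small pm (bphi BG_one)) => //.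
  - by have := mulP _ _ K1 K1; rewrite bmul_one.
  - by have := mulP _ _ K0 K0; rewrite bmul_zero.
  - by have := mulP _ _ K0 K1; rewrite bmul_zero.
  - have [+ _] := h _ _ K1 K0; rewrite fs_dist_one_zero ler_distl => /andP[].
    by lra.
  - by move: mT; rewrite ler_distl => /andP[].
pose E := phi e; have bE : bisection E by exact: bphi.
have EE : cdist m E (set_gmul E E) <= 2 * del.
  have h1 := tri (phi (bmul e e)) _ _ bE (bphi _) (bM _ _ _ bE bE).
  have h2 := mulP _ _ Ke Ke; have := eqP _ _ Kee Ke ee; rewrite cdistC => h3.
  by move: h1 h2 h3; rewrite /E; lra.
pose C := corner (units_of E).
(* Each product with [E] costs 2, and the bound [EE] counts twice. *)
have AC a : a \in L -> cdist m (phi (theta a)) (phi (theta a) `&` C) <= 8%:R * del.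
  move=> aK; have bA := bphi (theta a).
  have h1 := tri (phi (bmul (theta a) e)) _ _ bA (bphi _) (bM _ _ _ bA bE).
  have h2 := mulP _ _ (Kt a aK) Ke.
  have := eqP _ _ (Kte a aK) (Kt a aK) (re a); rewrite cdistC => h3.
  have h4 := tri (phi (bmul e (theta a))) _ _ bA (bphi _) (bM _ _ _ bE bA).
  have h5 := mulP _ _ Ke (Kt a aK).
  have := eqP _ _ (Ket a aK) (Kt a aK) (le_ a); rewrite cdistC => h6.
  rewrite [leLHS]/cdist setYD; have := corner_src pm bA bE.
  by move: h1 h2 h3 h4 h5 h6 EE; rewrite /E; lra.
have bI A : bisection A -> bisection (A `&` C).
  by move=> bA; apply: bisection_sub bA; exact: subIsetl.
have [N' [m' [rho [fN' pm' m'T brho [dist_rho mul_rho]]]]] :=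
  corner_exists (units_of E) fN pm.
exists N', m', (fun a => rho (phi (theta a))); split => //.
- by move=> a; apply: brho; exact: bphi.
- rewrite m'T; have [+ _] := h _ _ Ke K0; rewrite -/E => h1.
  have h2 : m (units_of E) <= m (src @` E).
    apply: (pmpc_mono pm) => // x Ex; exists (unit_val x) => //; exact: src_unit.
  have h3 : m (src @` E) <= m (units_of E) + 2 * del.
    apply: le_trans (pmpc_mono pm I I (@units_of_split _ E)) _.
    apply: le_trans (pmpc_subU pm I I) _; rewrite lerD2l.
    exact: le_trans (approx_idempotent_unit pm bE) EE.
  have h4 := tri (phi BG_zero) _ _ bE (bphi _) (bisection0 _).
  have h5 := tri set0 _ _ bE (bisection0 _) (bphi BG_zero).
  rewrite (cdistC m set0) in h5; rewrite !cdist0 in h4 h5.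
  move: h1; rewrite !ler_distl => /andP[h1 h1'].
  have eE : eps = 32%:R * del by rewrite /del; field.
  by apply/andP; split; move: h1 h1' h2 h3 h4 h5 Z7; rewrite eE; lra.
- move=> a b aK bK; have eE : eps = 32%:R * del by rewrite /del; field.
  have [bA bB] := (bphi (theta a), bphi (theta b)).
  have [aL bL] := (KL a aK, KL b bK).
  have [ACa ACb] := (AC a aL, AC b bL).
  split.
    rewrite dist_rho -/C; have [+ _] := h _ _ (Kt a aL) (Kt b bL).
    have h1 := tri (phi (theta a)) _ _ (bI _ bA) bA (bI _ bB).
    have h2 := tri (phi (theta b)) _ _ bA bB (bI _ bB).
    have h3 := tri (phi (theta a) `&` C) _ _ bA (bI _ bA) bB.
    have h4 := tri (phi (theta b) `&` C) _ _ (bI _ bA) (bI _ bB) bB.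
    rewrite (cdistC m (phi (theta a) `&` C) (phi (theta a))) in h1.
    rewrite (cdistC m (phi (theta b) `&` C) (phi (theta b))) in h4.
    rewrite !ler_distl => /andP[h5 h6]; rewrite eE.
    by apply/andP; split; move: h1 h2 h3 h4 h5 h6 ACa ACb; lra.
  rewrite mul_rho dist_rho -/C.
  set X := phi (theta (bmul a b)); have bX : bisection X by exact: bphi.
  set A' := phi (theta a) `&` C; set B' := phi (theta b) `&` C.
  have bA' : bisection A' by exact: bI.
  have bB' : bisection B' by exact: bI.
  have -> : set_gmul A' B' `&` C = set_gmul A' B'.
    apply/setIidl => _ [x [y [[_ [_ Cx]] [_ [Cy _]] xy ->]]].
    by split; rewrite ?src_mul ?rng_mul.
  set A := phi (theta a) in bA A' bA' ACa *.
  set B := phi (theta b) in bB B' bB' ACb *.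
  have := AC _ (KKL a b aK bK); rewrite -/X cdistC => ACX.
  have h1 := tri X _ _ (bI _ bX) bX (bM _ _ _ bA' bB').
  have h2 := tri (phi (bmul (theta a) (theta b))) _ _ bX (bphi _) (bM _ _ _ bA' bB').
  have h3 := eqP _ _ (Kt _ (KKL a b aK bK)) (Ktatb a b aK bK) (hom a b).
  have h4 := tri (set_gmul A B) _ _ (bphi (bmul (theta a) (theta b)))
    (bM _ _ _ bA bB) (bM _ _ _ bA' bB').
  have h5 := mulP _ _ (Kt a aL) (Kt b bL).
  have h6 : cdist m (set_gmul A B) (set_gmul A' B') <= cdist m A A' + cdist m B B'.
    by apply: (cdist_mul pm).
  by rewrite eE; move: h1 h2 h3 h4 h5 h6 ACX ACa ACb; lra.
Qed.

End corner.

(** * Permanence properties *)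

Section strong_limits.
Context (R : realType) (U : set_system nat).
Hypothesis freeU : free_ultrafilter U.
Context d (G : measurableGroupoidType d).
Hypothesis hG : discrete_measurable_groupoid R G.
Local Notation BG := (set_type (borel_full_semigroup G)).

Lemma net_proper_filter (I : Type) (leI : I -> I -> Prop) :
  directed leI -> ProperFilter (net_filter leI).
Proof.
move=> [[i0] refl_le trans_le dir]; split.
  by move=> [i /(_ i (refl_le i))].
split.
- by exists i0.
- move=> P Q [i iP] [j jQ]; have [k ik jk] := dir i j.
  by exists k => l kl; split; [exact/iP/(trans_le _ k)|exact/jQ/(trans_le _ k)].
- by move=> P Q PQ [i iP]; exists i => j ij; exact/PQ/iP.
Qed.

(** Invariance passes to the limit one bisection at a time. The distances of finitely many pairs are
    masses of finitely many Borel sets, so a single index of the net approximates them all. *)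
Lemma sofic_strong_limit (I : Type) (leI : I -> I -> Prop)
    (mu_ : I -> probability (units G) R) (mu : probability (units G) R) :
  directed leI -> strong_limit leI mu_ mu ->
  (forall i, sofic U (mu_ i)) -> sofic U mu.
Proof.
move=> dirI lim_mu sof; have FF := net_proper_filter dirI.
have pmu : pmp mu.
  split => // a /borel_full_semigroupP[ma [sa ra]].
  have ms := measurable_src_image hG ma sa; have mr := measurable_rng_image hG ma ra.
  have h1 := lim_mu _ ms; have h2 := lim_mu _ mr.
  apply: (cvg_unique (@ereal_hausdorff R) h1).
  rewrite (_ : (fun i => mu_ i (src @` a)) = (fun i => mu_ i (rng @` a)))//.
  apply/funext => i; have [[_ inv] _] := sof i; apply: inv.
  exact/borel_full_semigroupP.
apply: approximable_sofic => //.
apply: approximable_close => K e e0.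
have near_dist a b : net_filter leI
    [set i | `|fs_dist (mu_ i) a b - fs_dist mu a b| <= e].
  have mS := measurable_src_setY a b pmu.
  have := lim_mu _ mS; rewrite -(fineK (mass_fin_num mu mS)) => /fine_cvgP[_].
  move=> /cvgrPdist_le/(_ _ e0); apply: filterS => i /=.
  by rewrite distrC.
have [i iP] := filter_ex (filter_all K _ (fun a => filter_all K _ (near_dist a))).
exists 1, (fs_dist (mu_ i)); split.
- exact: sofic_approximable freeU _ _ _ (sof i).
- by rewrite subrr normr0 ltW.
- by move=> a b aK bK; exact: iP.
Qed.

(** A finite set of indices carries weight at least [1 - e]; as distances are at most 1, the other
    indices contribute at most [e]. *)
Lemma approximable_esum (I : countType) (t : I -> R) (Di : I -> BG -> BG -> R)
    (D : BG -> BG -> R) :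
  (forall i, 0 <= t i) -> \esum_(i in [set: I]) (t i)%:E = 1%E ->
  (forall i a b, 0 <= Di i a b <= 1) ->
  (forall a b, (D a b)%:E = \esum_(i in [set: I]) (t i * Di i a b)%:E) ->
  (forall i, approximable 1 (Di i)) -> approximable 1 D.
Proof.
move=> t0 t1 D01 DE ap; apply: approximable_close => K e e0.
have [A [finA _] At] : exists2 A, fsets [set: I] A &
    ((1 - e)%:E < \sum_(i \in A) (t i)%:E)%E.
  have : ((1 - e)%:E < \esum_(i in [set: I]) (t i)%:E)%E by rewrite t1 lte_fin; lra.
  by rewrite /esum => /ereal_sup_gt[_ [A hA <-] ?]; exists A.
pose J := finmap.enum_fset (fset_set A).
have split_esum (f : I -> R) : (forall i, 0 <= f i) ->
    (\esum_(i in [set: I]) (f i)%:E = (\sum_(i <- J) f i)%:E +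
      \esum_(i in ~` A) (f i)%:E)%E.
  move=> f0; rewrite (esumID A); last by move=> i _; rewrite lee_fin.
  rewrite !setTI esum_fset//; last by move=> i _; rewrite lee_fin.
  by rewrite fsbig_finite//= sumEFin.
have rest0 (f : I -> R) : (forall i, 0 <= f i) -> (0 <= \esum_(i in ~` A) (f i)%:E)%E.
  by move=> f0; apply: esum_ge0 => i _; rewrite lee_fin.
have tJ := split_esum t t0; rewrite t1 in tJ.
have restt : (\esum_(i in ~` A) (t i)%:E <= e%:E)%E.
  move: At tJ (rest0 t t0); rewrite fsbig_finite//= -/J sumEFin.
  case: (\esum_(i in ~` A) (t i)%:E)%E => [r| |]//=.
  by rewrite lte_fin => h1 [h2] h3; rewrite lee_fin; lra.
have sumt : 1 - e <= \sum_(i <- J) t i <= 1.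
  move: At tJ (rest0 t t0); rewrite fsbig_finite//= -/J sumEFin.
  case: (\esum_(i in ~` A) (t i)%:E)%E => [r| |]//=.
  by rewrite lte_fin lee_fin => h1 [h2] h3; apply/andP; split; lra.
exists (\sum_(i <- J) t i), (fun a b => \sum_(i <- J) t i * Di i a b); split.
- rewrite (_ : \sum_(i <- J) t i = \sum_(i <- J) t i * 1); last first.
    by apply: eq_bigr => i _; rewrite mulr1.
  by apply: approximable_sum => i; exact: approximable_scale.
- by move: sumt => /andP[? ?]; rewrite ler_distl; apply/andP; split; lra.
- move=> a b _ _; have f0 i : 0 <= t i * Di i a b.
    by have /andP[? ?] := D01 i a b; exact: mulr_ge0.
  have := split_esum _ f0; rewrite -DE.
  have : (\esum_(i in ~` A) (t i * Di i a b)%:E <= e%:E)%E.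
    apply: le_trans restt; apply: le_esum => i _; rewrite lee_fin.
    by have /andP[? ?] := D01 i a b; rewrite ler_piMr.
  move: (rest0 _ f0); case: (\esum_(i in ~` A) (t i * Di i a b)%:E)%E => [r| |]//=.
  by rewrite !lee_fin => h1 h2 [->]; rewrite ler_distl; apply/andP; split; lra.
Qed.

Lemma sofic_convex (I : countType) (t : I -> R)
    (mu_ : I -> probability (units G) R) (mu : probability (units G) R) :
  convex_combination t mu_ mu -> (forall i, sofic U (mu_ i)) -> sofic U mu.
Proof.
move=> [t0 t1 muE] sof.
have pmu : pmp mu.
  split => // a ha; have [ma [sa ra]] := (borel_full_semigroupP a).1 ha.
  have ms := measurable_src_image hG ma sa; have mr := measurable_rng_image hG ma ra.
  rewrite !muE//; apply: eq_esum => i _; congr (_ * _)%E.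
  by have [[_ inv] _] := sof i; exact: inv.
apply: approximable_sofic => //.
have mS (a b : BG) := measurable_src_setY a b pmu.
apply: (@approximable_esum I t (fun i => fs_dist (mu_ i))) => //.
- move=> i a b; apply/andP; split; first exact: mass_ge0.
  exact: mass_le1.
- move=> a b; rewrite /fs_dist /cdist fineK ?mass_fin_num// muE//.
  by apply: eq_esum => i _; rewrite EFinM fineK// mass_fin_num.
- by move=> i; exact: sofic_approximable freeU _ _ _ (sof i).
Qed.

End strong_limits.

(** * Disintegrations *)

Section barycenters.
Context (R : realType) d (G : measurableGroupoidType d).
Local Notation BG := (set_type (borel_full_semigroup G)).
Context d' (Z : measurableType d') (nu : probability Z R).
Variables (Z0 : set Z) (g : BG -> BG -> Z -> \bar R).
Hypothesis mg : forall a b, measurable_fun setT (g a b).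
Hypothesis gD : forall z, Z0 z -> exists D : BG -> BG -> R,
  [/\ approximable 1 D, forall a b, g a b z = (D a b)%:E &
      forall a b, 0 <= D a b <= 1].
Variables (K : seq BG) (e : R).
Hypothesis e0 : 0 < e.

Let integral_on (B : set Z) a b : R := fine (\int[nu]_(z in B) g a b z).

(** The error is proportional to [nu B], so that it does not grow with the number of pieces of a
    partition. *)
Definition barycentric (B : set Z) := exists D, approximable (fine (nu B)) D /\
  {in K &, forall a b, `|D a b - integral_on B a b| <= e * fine (nu B)}.

Let g01 z a b : Z0 z -> (0 <= g a b z <= 1)%E.
Proof. by move=> /gD[D [_ -> D01]]; rewrite !lee_fin; exact: D01. Qed.

Let mgB (B : set Z) a b : measurable_fun B (g a b).
Proof. exact: measurable_funTS. Qed.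

Let integral_bounds B a b : measurable B -> B `<=` Z0 ->
  (0 <= \int[nu]_(z in B) g a b z <= nu B)%E.
Proof.
move=> mB BZ; apply/andP; split.
  by apply: integral_ge0 => z /BZ /(g01 a b)/andP[].
rewrite -[leRHS]mul1e -integral_cst//; apply: ge0_le_integral => //.
- by move=> z /BZ /(g01 a b)/andP[].
- by move=> z /BZ /(g01 a b)/andP[].
Qed.

Let integral_fin B a b : measurable B -> B `<=` Z0 ->
  (\int[nu]_(z in B) g a b z = (integral_on B a b)%:E)%E.
Proof.
move=> mB BZ; rewrite fineK//; have /andP[h0 h1] := integral_bounds a b mB BZ.
by rewrite ge0_fin_numE// (le_lt_trans h1)// -ge0_fin_numE// mass_fin_num.
Qed.

Lemma barycentricU B1 B2 : measurable B1 -> measurable B2 -> B1 `<=` Z0 ->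
  B2 `<=` Z0 -> B1 `&` B2 = set0 -> barycentric B1 -> barycentric B2 ->
  barycentric (B1 `|` B2).
Proof.
move=> m1 m2 Z1 Z2 B12 [D1 [ap1 h1]] [D2 [ap2 h2]].
exists (fun a b => D1 a b + D2 a b); rewrite massU//; split.
  exact: approximable_add.
move=> a b aK bK; have -> : integral_on (B1 `|` B2) a b =
    integral_on B1 a b + integral_on B2 a b.
  rewrite {1}/integral_on ge0_integral_setU//; last 2 first.
    by move=> z [/Z1|/Z2] /(g01 a b)/andP[].
    exact/eqP.
  by rewrite !integral_fin.
rewrite opprD addrACA mulrDr; apply: le_trans (ler_normD _ _) _.
by apply: lerD; [exact: h1|exact: h2].
Qed.

Lemma barycentric_null B : measurable B -> B `<=` Z0 -> nu B = 0%E -> barycentric B.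
Proof.
move=> mB BZ B0; exists (fun _ _ => 0); rewrite B0 /=; split.
  exact: approximable0.
move=> a b _ _; have /andP[h0 h1] := integral_bounds a b mB BZ.
have i0 : (\int[nu]_(z in B) g a b z = 0)%E.
  by apply/eqP; rewrite eq_le h0 -B0 h1.
by rewrite /integral_on i0 /= subr0 normr0 mulr0.
Qed.

(** Any single parameter in [B] represents all of them, with weight [nu B]. *)
Lemma barycentric_osc B : measurable B -> B `<=` Z0 ->
  {in K &, forall a b, forall y z, B y -> B z -> (g a b y <= g a b z + e%:E)%E} ->
  barycentric B.
Proof.
move=> mB BZ osc; have [B0|B0] := eqVneq (nu B) 0%E.
  exact: barycentric_null.
have [z Bz] : B !=set0.
  by apply/set0P/negP => /eqP BE; move: B0; rewrite BE measure0 eqxx.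
have [D [apD gDz D01]] := gD (BZ _ Bz).
exists (fun a b => fine (nu B) * D a b); split.
  by rewrite -[X in approximable X _]mulr1; apply: approximable_scale => //; exact: mass_ge0.
move=> a b aK bK; have nuB := fineK (mass_fin_num nu mB).
have g0 y : B y -> (0 <= g a b y)%E by move=> /BZ /(g01 a b)/andP[].
have /andP[D0 D1] := D01 a b.
have up : (\int[nu]_(y in B) g a b y <= (D a b + e)%:E * nu B)%E.
  rewrite -integral_cst//; apply: ge0_le_integral => //.
  - by move=> y By /=; rewrite EFinD -gDz; exact: osc.
have low : ((D a b)%:E * nu B <= \int[nu]_(y in B) g a b y + e%:E * nu B)%E.
  rewrite -!integral_cst// -ge0_integralD//; last by move=> y _; rewrite lee_fin ltW.
  apply: ge0_le_integral => //.
  - by apply: emeasurable_funD => //; exact: measurable_cst.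
  - by move=> y By /=; rewrite -gDz; exact: osc.
move: up low; rewrite integral_fin// -nuB -!EFinM -EFinD !lee_fin /=.
by move=> h1 h2; rewrite ler_distl; apply/andP; split; lra.
Qed.

(** Induction on the list [L] of pairs for which [g] may still oscillate. *)
Lemma barycentric_pairs (L : seq (BG * BG)) B : measurable B -> B `<=` Z0 ->
  {in K &, forall a b, (a, b) \notin L -> forall y z, B y -> B z ->
    (g a b y <= g a b z + e%:E)%E} ->
  barycentric B.
Proof.
elim: L B => [|[a0 b0] L IH] B mB BZ osc.
  by apply: barycentric_osc => // a b aK bK; exact: osc.
have [n ne] := rad_lt e0.
(* [B] is sliced along the levels [c j] of the distance of the pair [(a0, b0)]. Within a slice this
   distance varies by at most [rad n < e], so the pair leaves the list; the levels run from 0 to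
   above 1 and exhaust [B]. *)
pose c j : R := j%:R * rad R n.
have cS j : c j.+1 = c j + rad R n by rewrite /c -addn1 natrD mulrDl mul1r.
pose sl j := B `&` [set z | (g a0 b0 z < (c j)%:E)%E].
have msl j : measurable (sl j) by exact: emeasurable_fun_infty_o.
have slB j : sl j `<=` B by exact: subIsetl.
have slZ j : sl j `<=` Z0 by move=> z /slB /BZ.
have sl_mono j : sl j `<=` sl j.+1.
  move=> z [Bz gz]; split => //=; apply: lt_le_trans gz _.
  by rewrite lee_fin cS lerDl ltW// rad_gt0.
have bar_sl j : barycentric (sl j).
  elim: j => [|j IHj].
    rewrite (_ : sl 0%N = set0).
      by apply: barycentric_null => //; rewrite measure0.
    rewrite -subset0 => z [/BZ /(g01 a0 b0)/andP[z0 _]] /=.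
    by rewrite /c mul0r ltNge z0.
  rewrite -(setDUK (sl_mono j)); apply: barycentricU => //.
  - exact: measurableD.
  - by move=> z [/slZ].
  - by rewrite setDE setICA setICr setI0.
  apply: IH; first exact: measurableD.
    by move=> z [/slZ].
  move=> a b aK bK abL y z [[By gy] ny] [[Bz gz] nz].
  have [[-> ->]|neq] := eqVneq (a, b) (a0, b0).
    have : ((c j)%:E <= g a0 b0 z)%E.
      by rewrite leNgt; apply/negP => h; apply: nz.
    have [D [_ -> _]] := gD (BZ _ Bz); have [D' [_ gy' _]] := gD (BZ _ By).
    move: gy; rewrite /= gy' -EFinD lte_fin !lee_fin cS => h1 h2; lra.
  by apply: osc => //; rewrite inE negb_or neq.
have [j j1] : exists j, 1 < c j.
  exists (Num.bound (rad R n)^-1); rewrite /c -ltr_pdivrMr ?rad_gt0// div1r.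
  by rewrite archi_boundP// invr_ge0 ltW// rad_gt0.
rewrite (_ : B = sl j)//; apply/seteqP; split => [z Bz|z []//].
split => //=; have /andP[_ h] := g01 a0 b0 (BZ _ Bz).
by apply: le_lt_trans h _; rewrite lte_fin.
Qed.

Lemma barycentric_all : measurable Z0 -> barycentric Z0.
Proof.
move=> mZ0; apply: (@barycentric_pairs [seq (a, b) | a <- K, b <- K]) => //.
by move=> a b aK bK; rewrite (allpairs_f pair aK bK).
Qed.

End barycenters.

Section disintegrations.
Context (R : realType) (U : set_system nat).
Hypothesis freeU : free_ultrafilter U.
Context d (G : measurableGroupoidType d).
Hypothesis hG : discrete_measurable_groupoid R G.
Local Notation BG := (set_type (borel_full_semigroup G)).

Lemma sofic_disintegration d' (Z : measurableType d')
    (mu : probability (units G) R) (nu : probability Z R)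
    (p : R.-ker Z ~> units G) :
  pmp mu -> disintegration mu nu p -> ae_probability nu p (fun P => sofic U P) ->
  sofic U mu.
Proof.
move=> pmu dis [N [mN N0 NP]]; apply: approximable_sofic => //.
have mS (a b : BG) := measurable_src_setY a b pmu.
pose g (a b : BG) z := p z (src @` (val a `+` val b)).
have mg a b : measurable_fun setT (g a b) by exact: measurable_kernel.
have gD z : (~` N) z -> exists D : BG -> BG -> R, [/\ approximable 1 D,
    forall a b, g a b z = (D a b)%:E & forall a b, 0 <= D a b <= 1].
  move=> nN; have [P pP sP] : exists2 P : probability (units G) R,
      (forall A, measurable A -> p z A = P A) & sofic U P.
    by apply: contrapT => nP; apply: nN; exact: NP.
  exists (fs_dist P); split.
  - exact: sofic_approximable freeU _ _ _ sP.
  - by move=> a b; rewrite /g pP// /fs_dist /cdist fineK// mass_fin_num.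
  - by move=> a b; apply/andP; split; [exact: mass_ge0|exact: mass_le1].
have mN' : measurable (~` N) by exact: measurableC.
have N1 : nu (~` N) = 1%E by rewrite probability_setC// N0 sube0.
apply: approximable_close => K e e0.
have [D [apD DP]] := @barycentric_all _ _ _ _ _ nu _ _ mg gD K _ e0 mN'.
rewrite N1 /= in apD DP; exists 1, D; split => //.
  by rewrite subrr normr0 ltW.
move=> a b aK bK; have := DP a b aK bK; rewrite mulr1.
suff -> : (\int[nu]_(z in ~` N) g a b z = mu (src @` (val a `+` val b)))%E by [].
rewrite (dis _ (mS a b)) -[~` N]setTD -ge0_negligible_integral//.
Qed.

End disintegrations.

Lemma measure_bigcup_esum (R : realType) d (T : measurableType d)
    (m : {measure set T -> \bar R}) (I : countType) (F : I -> set T) :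
  (forall i, measurable (F i)) -> trivIset setT F ->
  m (\bigcup_i F i) = (\esum_(i in [set: I]) m (F i))%E.
Proof.
(* [pickle_inv] is used because each index must occur only once for the sets to remain disjoint. *)
move=> mF tF; pose F' n := if @pickle_inv I n is Some i then F i else set0.
have FF' i : F' (pickle i) = F i by rewrite /F' pickleK_inv.
rewrite (_ : \bigcup_i F i = \bigcup_n F' n); last first.
  apply/seteqP; split => [t [i _ Fi]|t [n _]]; first by exists (pickle i); rewrite ?FF'.
  by rewrite /F'; case: pickle_inv => // i Fi; exists i.
have mF' n : measurable (F' n) by rewrite /F'; case: pickle_inv.
rewrite measure_semi_bigcup//; last 2 first.
- move=> n k _ _ [t []]; rewrite /F'.
  have := @pickle_invK I n; have := @pickle_invK I k.
  case: (pickle_inv k) => [i|//]; case: (pickle_inv n) => [j|//] /= <- <- Fj Fi.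
  by congr pickle; apply: tF => //; exists t.
- exact: bigcup_measurable.
rewrite nneseries_esumT//.
rewrite (_ : (\esum_(i in [set: nat]) _)%E =
    (\esum_(n in [set: nat]) (if n \in range (@pickle I) then m (F' n) else 0))%E).
  rewrite -esum_mkcond (@reindex_esum R I nat setT (range pickle) pickle); last first.
    by split => [i _|i j _ _|n [i _ <-]];
      [exists i|exact: (pcan_inj pickleK)|exists i].
  by apply: eq_esum => i _; rewrite FF'.
apply: eq_esum => n _; case: ifPn => // /negP nr.
rewrite /F'; have := @pickle_invK I n; case: pickle_inv => [i /= in_|_]; last exact: measure0.
by exfalso; apply: nr; rewrite inE; exists i.
Qed.

(** * Subgroupoids and partitions *)

Section restriction_to_units.
Context (G : groupoidType).
Implicit Types (A : set G) (S : set (units G)).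

Lemma set_gmul_units A S : (forall g, A g -> S (src g)) ->
  set_gmul A (unit_val @` S) = A.
Proof.
move=> AS; apply/seteqP; split => [_ [g [_ [Ag [x Sx <-] gx ->]]]|g Ag].
  by rewrite rng_unit in gx; rewrite -gx mul_unit_src.
exists g, (unit_val (src g)); split => //; last by rewrite mul_unit_src.
- by exists (src g) => //; exact: AS.
- by rewrite rng_unit.
Qed.

Lemma set_units_gmul A S : (forall g, A g -> S (rng g)) ->
  set_gmul (unit_val @` S) A = A.
Proof.
move=> AS; apply/seteqP; split => [_ [_ [g [[x Sx <-] Ag xg ->]]]|g Ag].
  by rewrite src_unit in xg; rewrite xg mul_unit_rng.
exists (unit_val (rng g)), g; split => //; last by rewrite mul_unit_rng.
- by exists (rng g) => //; exact: AS.
- by rewrite src_unit.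
Qed.

End restriction_to_units.

Section subgroupoids.
Context (R : realType) (U : set_system nat).
Hypothesis freeU : free_ultrafilter U.
Context d (G : measurableGroupoidType d).
Hypothesis hG : discrete_measurable_groupoid R G.
Local Notation BG := (set_type (borel_full_semigroup G)).
Variable mu : probability (units G) R.

Section one_subgroupoid.
Variables (H : subgroupoid G) (H0 : non_null H mu).
Local Notation HT := (subgpd_type H).
Local Notation BH := (set_type (borel_full_semigroup HT)).
Local Notation v := (@subgpd_val d G H).
Local Notation mass := (fine (mu (subgpd_units H))).

Lemma measurable_subgpd_units : measurable (subgpd_units H).
Proof. by exists (subgpd_set H); [exact: subgpd_measurable|rewrite setTI]. Qed.

Lemma subgpd_mass_gt0 : 0 < mass.
Proof.
apply: fine_gt0; rewrite H0/=; apply: le_lt_trans (probability_le1 _ _) (ltry _).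
exact: measurable_subgpd_units.
Qed.

Lemma fine_subgpd_measure (A : set (units HT)) :
  measurable (@subgpd_unit_incl d G H @` A) ->
  fine (subgpd_measure H0 A) = fine (mu (@subgpd_unit_incl d G H @` A)) / mass.
Proof. by move=> mA; rewrite /subgpd_measure fineM// fin_num_measure. Qed.

Lemma good_subgpd_val (a : BH) : good measurable (v @` val a).
Proof.
have [ma ba] := borel_good a; split; first exact: measurable_subgpd_val_image.
exact/subgpd_val_bisection.
Qed.

Definition subgpd_push (a : BH) : BG := to_BG (good_subgpd_val a).

Lemma good_subgpd_one : good measurable (unit_val @` subgpd_units H : set G).
Proof.
split; last exact: bisection_units.
exact: (measurable_unit_image hG measurable_subgpd_units).
Qed.

Definition subgpd_one : BG := to_BG good_subgpd_one.

Lemma subgpd_unit_src (g : G) : subgpd_set H g -> subgpd_units H (src g).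
Proof.
move=> Hg; apply: (@subgpd_mul _ _ H (ginv g) g) => //; first exact: subgpd_inv.
by rewrite src_inv.
Qed.

Lemma subgpd_unit_rng (g : G) : subgpd_set H g -> subgpd_units H (rng g).
Proof. by move=> Hg; rewrite -src_inv; apply: subgpd_unit_src; exact: subgpd_inv. Qed.

Lemma subgpd_push_src (a : BH) g : val (subgpd_push a) g -> subgpd_units H (src g).
Proof. by move=> [x _ <-]; apply: subgpd_unit_src; exact: subgpd_valP. Qed.

Lemma subgpd_push_rng (a : BH) g : val (subgpd_push a) g -> subgpd_units H (rng g).
Proof. by move=> [x _ <-]; apply: subgpd_unit_rng; exact: subgpd_valP. Qed.

Lemma sofic_subgroupoid : sofic U mu -> sofic U (subgpd_measure H0).
Proof.
move=> sof; have pmu := sof.1; have ap := sofic_approximable freeU sof.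
have hH := subgpd_discrete_measurable H hG.
apply: (approximable_sofic freeU (subgpd_pmp hG H0 pmu)).
have re a : fs_dist mu (bmul (subgpd_push a) subgpd_one) (subgpd_push a) = 0.
  by apply: fs_dist_refl; rewrite (val_bmul hG) set_gmul_units//; exact: subgpd_push_src.
have le_ a : fs_dist mu (bmul subgpd_one (subgpd_push a)) (subgpd_push a) = 0.
  by apply: fs_dist_refl; rewrite (val_bmul hG) set_units_gmul//; exact: subgpd_push_rng.
have ee : fs_dist mu (bmul subgpd_one subgpd_one) subgpd_one = 0.
  apply: fs_dist_refl; rewrite (val_bmul hG) set_gmul_units// => _ [x Hx <-].
  by rewrite src_unit.
have hom a b : fs_dist mu (subgpd_push (bmul a b))
    (bmul (subgpd_push a) (subgpd_push b)) = 0.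
  apply: fs_dist_refl; rewrite (val_bmul hG) /= (val_bmul hH).
  exact: subgpd_val_set_gmul.
have := approximable_corner hG ap re le_ ee hom.
have k0 : 0 <= mass^-1 by rewrite invr_ge0 mass_ge0.
move=> /(approximable_scale k0).
have -> : mass^-1 * fs_dist mu subgpd_one (BG_zero G) = 1.
  rewrite /fs_dist cdist0 (_ : src @` _ = subgpd_units H).
    by rewrite mulVf// gt_eqF// subgpd_mass_gt0.
  rewrite image_comp (_ : _ \o _ = id) ?image_id//.
  by apply/funext => x; exact: src_unit.
suff -> : (fun a b : BH => mass^-1 * fs_dist mu (subgpd_push a) (subgpd_push b)) =
  fs_dist (subgpd_measure H0) by [].
apply/funext => a; apply/funext => b.
have inclE : @subgpd_unit_incl d G H @` (src @` (val a `+` val b)) =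
    src @` (val (subgpd_push a) `+` val (subgpd_push b)).
  by rewrite incl_src_image (image_setY _ _ (@subgpd_val_inj _ _ H)).
rewrite /fs_dist /cdist fine_subgpd_measure inclE; last exact: measurable_src_setY pmu.
by rewrite mulrC.
Qed.

End one_subgroupoid.

Lemma sofic_partition (I : countType) (H : I -> subgroupoid G)
    (H0 : forall i, non_null (H i) mu) :
  pmp mu -> trivIset setT (fun i => subgpd_set (H i)) ->
  \bigcup_i subgpd_set (H i) = setT ->
  (forall i, sofic U (subgpd_measure (H0 i))) -> sofic U mu.
Proof.
move=> pmu tH cH sof; apply: (approximable_sofic freeU pmu).
have tU i j x : subgpd_units (H i) x -> subgpd_units (H j) x -> i = j.
  by move=> Hi Hj; apply: tH => //; exists (unit_val x).
have cU g : exists i, subgpd_set (H i) g.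
  by have : setT g by []; rewrite -cH => -[i _ Hi]; exists i.
pose v i := @subgpd_val d G (H i).
have pull_good i (a : BG) : good measurable (v i @^-1` val a).
  have [ma ba] := borel_good a; split.
    by rewrite -[X in measurable X]setTI; exact: measurable_subgpd_val.
  apply/subgpd_val_bisection; rewrite subgpd_val_preimage.
  by apply: bisection_sub ba; exact: subIsetr.
pose pull i a := to_BG (pull_good i a).
have hH i := subgpd_discrete_measurable (H i) hG.
have ap i := sofic_approximable freeU (sof i).
have apD i : approximable 1 (fun a b =>
    fs_dist (subgpd_measure (H0 i)) (pull i a) (pull i b)).
  (* The corner of the unit is the whole piece: what is used is the transport of its approximations
     to [G] along [pull i]. *)
  have one_zero := fs_dist_one_zero (hH i) (subgpd_measure (H0 i)).
  rewrite -one_zero; apply: (approximable_corner (hH i) (ap i)).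
  - move=> a; apply: fs_dist_refl; rewrite (val_bmul (hH i)) /= unit_arrowsE.
    by rewrite set_gmul_units.
  - by move=> a; apply: fs_dist_refl; rewrite bmul_one.
  - by apply: fs_dist_refl; rewrite bmul_one.
  - move=> a b; apply: fs_dist_refl; rewrite (val_bmul (hH i)) /= (val_bmul hG).
    apply/seteqP; split => [x [g [h [ag bh gh xgh]]]|_ [x [y [ax bY xy ->]]]].
      (* Different pieces have disjoint sets of units. A product in piece i has the same source as
         its right factor, which is thus in piece i, and then so is the left factor. *)
      have [j Hj] := cU h.
      have ij : i = j.
        apply: (tU _ _ (src h)); last exact: subgpd_unit_src.
        by rewrite -(src_mul gh) -xgh; apply: subgpd_unit_src; exact: subgpd_valP.
      have Hh : subgpd_set (H i) h by rewrite ij.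
      have Hg : subgpd_set (H i) g.
        rewrite -(mulgK gh) -xgh; apply: subgpd_mul; first exact: subgpd_valP.
          exact: subgpd_inv.
        by rewrite xgh src_mul// rng_inv.
      have [y yh] := subgpd_val_surj Hh; have [z zg] := subgpd_val_surj Hg.
      have zy : src z = rng y by apply/subgpd_src_rng; rewrite yh zg.
      exists z, y; split => //=; rewrite ?/preimage/= /v ?zg ?yh//.
      by apply: subgpd_val_inj; rewrite subgpd_val_mul// zg yh.
    exists (v i x), (v i y); split => //; first exact/subgpd_src_rng.
    exact: subgpd_val_mul.
have t0 i : 0 <= fine (mu (subgpd_units (H i))) by exact: mass_ge0.
have mY a b := measurable_src_setY a b pmu.
have mR i (A : set (units G)) : measurable A -> measurable (A `&` subgpd_units (H i)).
  by move=> mA; apply: measurableI => //; exact: measurable_subgpd_units.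
have splitA (A : set (units G)) : measurable A ->
    mu A = \esum_(i in [set: I]) mu (A `&` subgpd_units (H i)).
  move=> mA; rewrite -measure_bigcup_esum.
  - rewrite -setI_bigcupr; congr (mu _); apply/esym/setIidl => x _.
    by have [i Hi] := cU (unit_val x); exists i.
  - by move=> i; exact: mR.
  - by move=> i j _ _ [x [[_ Hi] [_ Hj]]]; exact: tU Hi Hj.
apply: (approximable_esum t0 _ _ _ apD).
- rewrite -(probability_setT mu) splitA//; apply: eq_esum => i _.
  by rewrite setTI fineK// fin_num_measure//; exact: measurable_subgpd_units.
- move=> i a b; apply/andP; split; first exact: mass_ge0.
  exact: mass_le1 (measurable_src_setY _ _ (sof i).1).
- move=> a b; rewrite fineK ?fin_num_measure// splitA//; apply: eq_esum => i _.
  rewrite -[LHS]fineK ?fin_num_measure//; last exact: mR.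
  congr (_%:E); rewrite /fs_dist /cdist.
  (* The source of an arrow is a unit of the piece that contains the arrow, and of no other
     piece. *)
  have E : src @` (val a `+` val b) `&` subgpd_units (H i) =
      @subgpd_unit_incl d G (H i) @` (src @` (val (pull i a) `+` val (pull i b))).
    rewrite incl_src_image /= (_ : v i @^-1` val a `+` v i @^-1` val b =
      v i @^-1` (val a `+` val b)) ?subgpd_val_preimage//.
    apply/seteqP; split => [_ [[g abg <-] Hg]|_ [g [Hg abg] <-]].
      have [j Hj] := cU g; exists g => //; split => //.
      by rewrite (tU i j (src g))//; exact: subgpd_unit_src.
    by split; [exists g|exact: subgpd_unit_src].
  have mass_neq0 : fine (mu (subgpd_units (H i))) != 0.
    by rewrite gt_eqF// (subgpd_mass_gt0 (H0 i)).
  rewrite fine_subgpd_measure -E; last exact: mR.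
  by rewrite mulrCA mulfV// mulr1.
Qed.

End subgroupoids.

(** * Absolutely continuous measures *)

Lemma density_level_bounds (R : realType) d (T : measurableType d)
    (nu mu : probability T R) : nu `<< mu -> exists f : T -> R,
  [/\ measurable_fun setT f,
      forall q A, measurable A -> A `<=` [set x | f x < q] ->
        fine (nu A) <= q * fine (mu A),
      forall q A, 0 <= q -> measurable A -> A `<=` [set x | q <= f x] ->
        q * fine (mu A) <= fine (nu A) &
      forall x, 0 <= f x].
Proof.
move=> numu; pose F := Radon_Nikodym_SigmaFinite.f nu mu.
have F0 x : (0 <= F x)%E by exact: Radon_Nikodym_SigmaFinite.f_ge0.
have Ff x : (fine (F x))%:E = F x.
  by rewrite fineK//; exact: Radon_Nikodym_SigmaFinite.f_fin_num.
have mF : measurable_fun setT F.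
  exact: measurable_int (Radon_Nikodym_SigmaFinite.f_integrable numu).
have FI A : measurable A -> nu A = (\int[mu]_(x in A) F x)%E.
  exact: Radon_Nikodym_SigmaFinite.f_integral.
have mFA A : measurable_fun A F by exact: measurable_funTS.
exists (fine \o F); split.
- exact: measurableT_comp.
- move=> q A mA Aq; rewrite -lee_fin EFinM !fineK ?mass_fin_num// FI//.
  rewrite -integral_cst//; apply: ge0_le_integral => //.
  by move=> x /Aq /= /ltW; rewrite -lee_fin Ff.
- move=> q A q0 mA Aq; rewrite -lee_fin EFinM !fineK ?mass_fin_num// FI//.
  rewrite -integral_cst//; apply: ge0_le_integral => //.
  by move=> x /Aq /=; rewrite -lee_fin Ff.
- by move=> x; exact: fine_ge0.
Qed.

Section invariant_sets.
Context (R : realType) d (G : measurableGroupoidType d).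
Hypothesis hG : discrete_measurable_groupoid R G.
Local Notation BG := (set_type (borel_full_semigroup G)).
Variable mu : probability (units G) R.
Hypotheses (pmu : pmp mu) (ap : approximable 1 (fs_dist mu)).

(** Invariance of [B] modulo null sets is expressed by the arrows that leave [B] having null sets of
    sources. *)
Definition exits (B : set (units G)) (a : set G) : set G :=
  [set g | [/\ a g, B (src g) & ~ B (rng g)]].

Variable B : set (units G).
Hypothesis mB : measurable B.
Hypothesis invB : forall a, good measurable a -> fine (mu (src @` exits B a)) = 0.

Definition cut (a : set G) : set G := a `&` (src @^-1` B `&` rng @^-1` B).

Lemma good_cut a : good measurable a -> good measurable (cut a).
Proof.
move=> [ma ba]; split; last by apply: bisection_sub ba; exact: subIsetl.
by apply: measurableI => //; apply: measurableI;
  [exact: (measurable_src_preimage hG)|exact: (measurable_rng_preimage hG)].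
Qed.

Lemma good_exits a : good measurable a -> good measurable (exits B a).
Proof.
move=> [ma ba]; split; last by apply: bisection_sub ba => g [].
rewrite (_ : exits B a = a `&` (src @^-1` B `\` rng @^-1` B)).
  by apply: measurableI => //; apply: measurableD;
    [exact: (measurable_src_preimage hG)|exact: (measurable_rng_preimage hG)].
by apply/seteqP; split => g; [case|case=> ? []].
Qed.

Lemma measurable_src_good (a : set G) : good measurable a -> measurable (src @` a).
Proof. by move=> [ma [sa _]]; exact: (measurable_src_image hG ma sa). Qed.

Lemma mass_null_subset (A C : set (units G)) : measurable A -> measurable C ->
  A `<=` C -> fine (mu C) = 0 -> fine (mu A) = 0.
Proof.
move=> mA mC AC C0; apply/eqP; rewrite eq_le mass_ge0 andbT -C0.
exact: mass_mono.
Qed.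

(** An arrow with source in [B] survives the cut unless it leaves [B], which is negligible. *)
Lemma fs_dist_cut (a b : BG) :
  fs_dist mu (to_BG (good_cut (borel_good a))) (to_BG (good_cut (borel_good b))) =
  fine (mu (B `&` src @` (val a `+` val b))).
Proof.
have [ga gb] := (borel_good a, borel_good b).
have ge1 := measurable_src_good (good_exits ga).
have ge2 := measurable_src_good (good_exits gb).
have mY := measurable_src_setY a b pmu.
pose ca := to_BG (good_cut ga); pose cb := to_BG (good_cut gb).
have mC : measurable (src @` (val ca `+` val cb)) by apply: (measurable_src_setY ca cb pmu).
have mBY : measurable (B `&` src @` (val a `+` val b)) by exact: measurableI.
rewrite /fs_dist /cdist -/ca -/cb.
have sub1 : src @` (val ca `+` val cb) `<=` B `&` src @` (val a `+` val b).
  rewrite !setY_def => _ [g + <-].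
  by rewrite /= /cut => -[[[ag [Bs Br]] n]|[[ag [Bs Br]] n]];
    split => //; exists g => //; [left|right]; split => // ?; apply: n; split.
have sub2 : B `&` src @` (val a `+` val b) `<=` src @` (val ca `+` val cb) `|`
    (src @` exits B (val a) `|` src @` exits B (val b)).
  rewrite !setY_def => x [Bs [g ab gx]]; rewrite -gx in Bs *.
  have [Br|nB] := pselect (B (rng g)).
    left; exists g => //; case: ab => -[ag n]; [left|right];
      by split; [split|case].
  by right; case: ab => -[ag n]; [left|right]; exists g.
apply/le_anti/andP; split; first exact: mass_mono.
apply: le_trans (mass_mono _ _ _ sub2) _ => //.
  by apply: measurableU => //; exact: measurableU.
apply: le_trans (mass_subU _ _ _) _ => //; first exact: measurableU.
have := mass_subU mu ge1 ge2; rewrite !invB//; lra.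
Qed.

Lemma approximable_invariant : approximable (fine (mu B))
  (fun a b => fine (mu (B `&` src @` (val a `+` val b)))).
Proof.
pose theta (a : BG) := to_BG (good_cut (borel_good a)).
have ge_ : good measurable (unit_val @` B : set G).
  split; last exact: bisection_units.
  exact: (measurable_unit_image hG).
pose e := to_BG ge_.
have re a : fs_dist mu (bmul (theta a) e) (theta a) = 0.
  by apply: fs_dist_refl; rewrite (val_bmul hG) set_gmul_units// => g [_ []].
have le_ a : fs_dist mu (bmul e (theta a)) (theta a) = 0.
  by apply: fs_dist_refl; rewrite (val_bmul hG) set_units_gmul// => g [_ []].
have ee : fs_dist mu (bmul e e) e = 0.
  apply: fs_dist_refl; rewrite (val_bmul hG) set_gmul_units// => _ [x Hx <-].
  by rewrite src_unit.
have hom a b : fs_dist mu (theta (bmul a b)) (bmul (theta a) (theta b)) = 0.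
  have gb := borel_good b; have mE := measurable_src_good (good_exits gb).
  have mC := measurable_src_setY (theta (bmul a b)) (bmul (theta a) (theta b)) pmu.
  apply: mass_null_subset (invB gb) => //.
  rewrite setY_def /= !(val_bmul hG) => _ [y + <-].
  (* A product that is kept although its factors are not both kept passes through a unit outside
     [B], so its right factor leaves [B]. The other inclusion is exact. *)
  move=> [[[[g [h [ag bh gh ->]]] [Bs Br]] n]|[[g [h [[ag Bg] [bh Bh] gh ->]]] n]].
    rewrite /preimage /= src_mul// in Bs; rewrite /preimage /= rng_mul// in Br.
    exists h; last by rewrite src_mul.
    split=> // Bh; apply: n; exists g, h; split => //; split => //; split => //=.
    by rewrite gh.
  exfalso; apply: n; split; first by exists g, h.
  by rewrite /preimage /= src_mul// rng_mul//; split; [case: Bh|case: Bg].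
have := approximable_corner hG ap re le_ ee hom.
have -> : fs_dist mu e (BG_zero G) = fine (mu B).
  rewrite /fs_dist cdist0 /= image_comp (_ : _ \o _ = id) ?image_id//.
  by apply/funext => x; exact: src_unit.
suff -> : (fun a b : BG => fs_dist mu (theta a) (theta b)) =
  (fun a b => fine (mu (B `&` src @` (val a `+` val b)))) by [].
by apply/funext => a; apply/funext => b; exact: fs_dist_cut.
Qed.

End invariant_sets.

Section absolute_continuity.
Context (R : realType) d (G : measurableGroupoidType d).
Hypothesis hG : discrete_measurable_groupoid R G.
Variables mu nu : probability (units G) R.
Hypotheses (pmu : pmp mu) (pnu : pmp nu).
Variable f : units G -> R.
Hypothesis mf : measurable_fun setT f.
Hypothesis f_lt : forall q A, measurable A -> A `<=` [set x | f x < q] ->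
  fine (nu A) <= q * fine (mu A).
Hypothesis f_ge : forall q A, 0 <= q -> measurable A -> A `<=` [set x | q <= f x] ->
  q * fine (mu A) <= fine (nu A).

Let level q := [set x | f x < q].

Lemma measurable_level q : measurable (level q).
Proof.
rewrite (_ : level q = setT `&` f @^-1` `]-oo, q[%classic); last first.
  by rewrite setTI; apply/seteqP; split => x; rewrite /= in_itv.
exact: mf.
Qed.

(** The common value of [nu] is at most [p] times, and at least [q] times, the common value of
    [mu]. *)
Lemma gap_null p q A B : 0 <= q -> p < q -> measurable A -> measurable B ->
  fine (mu A) = fine (mu B) -> fine (nu A) = fine (nu B) ->
  A `<=` level p -> B `<=` [set x | q <= f x] -> fine (mu A) = 0.
Proof.
move=> q0 pq mA mB muAB nuAB Ap Bq; have h1 := f_lt mA Ap.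
have h2 := f_ge q0 mB Bq; rewrite -muAB -nuAB in h2; have := mass_ge0 mu A.
by move=> h3; apply/eqP; rewrite eq_le h3 andbT; nra.
Qed.

(** [gap_null] needs a gap between the values of [f] at the two ends. The arrows are sorted by a gap
    [rad n] below [q]; each class is null because it preserves both measures. *)
Lemma crossing_null X q : good measurable X -> 0 <= q ->
  (forall g, X g -> f (src g) < q <= f (rng g)) \/
  (forall g, X g -> f (rng g) < q <= f (src g)) ->
  fine (mu (src @` X)) = 0.
Proof.
move=> gX q0 cross; pose L n := level (q - rad R n).
pose Xn n := X `&` (src @^-1` L n `|` rng @^-1` L n).
have gXn n : good measurable (Xn n).
  have [mX bX] := gX; split; last by apply: bisection_sub bX; exact: subIsetl.
  apply: measurableI => //; apply: measurableU.
    by apply: (measurable_src_preimage hG); exact: measurable_level.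
  by apply: (measurable_rng_preimage hG); exact: measurable_level.
have msrc n : measurable (src @` Xn n).
  by have [mX [sX _]] := gXn n; exact: (measurable_src_image hG mX sX).
have mrng n : measurable (rng @` Xn n).
  by have [mX [_ rX]] := gXn n; exact: (measurable_rng_image hG mX rX).
have XE : src @` X = \bigcup_n src @` Xn n.
  rewrite -image_bigcup; congr (_ @` _); apply/seteqP; split => [g Xg|g [n _ []//]].
  case: cross => /(_ g Xg)/andP[h1 h2].
    have [n nq] : exists n, rad R n < q - f (src g) by apply: rad_lt; rewrite subr_gt0.
    by exists n => //; split => //; left; rewrite /preimage /L /level /=; lra.
  have [n nq] : exists n, rad R n < q - f (rng g) by apply: rad_lt; rewrite subr_gt0.
  by exists n => //; split => //; right; rewrite /preimage /L /level /=; lra.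
suff mu0 n : mu (src @` Xn n) = 0%E by rewrite XE (null_bigcup msrc mu0).
rewrite -(fineK (mass_fin_num mu (msrc n))).
congr (_%:E).
have muE : fine (mu (src @` Xn n)) = fine (mu (rng @` Xn n)).
  by rewrite pmu.2//; apply/borel_full_semigroupP; exact: gXn.
have nuE : fine (nu (src @` Xn n)) = fine (nu (rng @` Xn n)).
  by rewrite pnu.2//; apply/borel_full_semigroupP; exact: gXn.
have pq : q - rad R n < q by have := rad_gt0 R n; lra.
case: cross => cr.
  apply: (gap_null q0 pq (msrc n) (mrng n)) => // _ [g [Xg Lg] <-].
    have /andP[_ h] := cr g Xg; case: Lg; rewrite /preimage /L /level //=.
    by have := rad_gt0 R n; lra.
  by have /andP[] := cr g Xg.
rewrite muE; apply: (gap_null q0 pq (mrng n) (msrc n)) => // _ [g [Xg Lg] <-].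
  have /andP[_ h] := cr g Xg; case: Lg; rewrite /preimage /L /level //=.
  by have := rad_gt0 R n; lra.
by have /andP[] := cr g Xg.
Qed.

Let invariant B :=
  forall a, good measurable a -> fine (mu (src @` exits B a)) = 0.

Lemma level_invariant q : 0 <= q -> invariant (level q).
Proof.
move=> q0 a ga; apply: (crossing_null (good_exits hG (measurable_level q) ga) q0).
left=> g [_]; rewrite /level /= => h1 /negP; rewrite -leNgt => h2.
by rewrite h1.
Qed.

(** Since [exits] looks in one direction only, complements are treated separately; both kinds are
    needed for the slices between two levels. *)
Lemma levelC_invariant q : 0 <= q -> invariant (~` level q).
Proof.
move=> q0 a ga.
apply: (crossing_null (good_exits hG (measurableC (measurable_level q)) ga) q0).
right=> g [_]; rewrite /level /= => /negP; rewrite -leNgt => h1 /contrapT h2.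
by rewrite h2.
Qed.

Lemma invariantI A B : measurable A -> measurable B ->
  invariant A -> invariant B -> invariant (A `&` B).
Proof.
move=> mA mB iA iB a ga.
have mC C : measurable C -> measurable (src @` exits C a).
  by move=> mC; exact: (measurable_src_good hG (good_exits hG mC ga)).
apply: (@mass_null_subset _ _ _ _ _ (src @` exits A a `|` src @` exits B a)).
- by apply: mC; exact: measurableI.
- by apply: measurableU; exact: mC.
- move=> _ [g [ag [Ag Bg] nAB] <-]; have [Ar|nA] := pselect (A (rng g)).
    by right; exists g => //; split => // Br; apply: nAB.
  by left; exists g.
- apply/eqP; rewrite eq_le mass_ge0 andbT.
  by apply: le_trans (mass_subU mu (mC _ mA) (mC _ mB)) _; rewrite iA// iB// addr0.
Qed.

Hypothesis f0 : forall x, 0 <= f x.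
Hypothesis ap : approximable 1 (fs_dist mu).

Lemma approximable_density : approximable 1 (fs_dist nu).
Proof.
(* One [eta] is for rounding the density down to its multiples, the other for the part where the
   density is large. *)
apply: approximable_close => K e e0; pose eta := e / 2.
have eta0 : 0 < eta by rewrite divr_gt0.
pose c j : R := j%:R * eta.
have c0 j : 0 <= c j by rewrite mulr_ge0// ltW.
have cS j : c j.+1 = c j + eta by rewrite /c -addn1 natrD mulrDl mul1r.
pose L j := level (c j); pose B j := L j.+1 `&` ~` L j.
have mL j : measurable (L j) by exact: measurable_level.
have mB j : measurable (B j) by apply: measurableI => //; exact: measurableC.
have LS j : L j.+1 = L j `|` B j.
  rewrite /B setUIr setUv setIT; apply/seteqP; split => x; first by right.
  by case=> //; rewrite /L /level /= cS; lra.
have LB j : L j `&` B j = set0 by rewrite /B setICA setICr setI0.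
have apB j : approximable (c j * fine (mu (B j)))
    (fun a b => c j * fine (mu (B j `&` src @` (val a `+` val b)))).
  apply: approximable_scale => //; apply: approximable_invariant => //.
  apply: invariantI => //; first exact: measurableC.
    exact: level_invariant.
  exact: levelC_invariant.
(* A lower sum for the integral of [f] over the part of [A] where [f] is below [c n]. *)
pose S n A := \sum_(0 <= j < n) c j * fine (mu (B j `&` A)).
have bounds n A : measurable A -> S n A <= fine (nu (L n `&` A)) <=
    S n A + eta * fine (mu (L n `&` A)).
  move=> mA; elim: n => [|n /andP[IH1 IH2]].
    have -> : L 0%N `&` A = set0.
      rewrite -subset0 => x [+ _]; rewrite /L /level /= /c mul0r.
      by have := f0 x; lra.
    by rewrite /S big_geq// !measure0 /= mulr0 addr0 lexx.
  have mBA : measurable (B n `&` A) by exact: measurableI.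
  have mLA : measurable (L n `&` A) by exact: measurableI.
  have LBA : (L n `&` A) `&` (B n `&` A) = set0 by rewrite setIACA LB set0I.
  rewrite LS setIUl !massU// /S big_nat_recr//= -/(S n A).
  have h1 : c n * fine (mu (B n `&` A)) <= fine (nu (B n `&` A)).
    apply: f_ge => // x [[_ nL] _]; rewrite /= leNgt; exact/negP.
  have h2 : fine (nu (B n `&` A)) <= c n.+1 * fine (mu (B n `&` A)).
    by apply: f_lt => // x [[]].
  rewrite cS in h2; apply/andP; split; move: IH1 IH2 h1 h2; lra.
have [n nn] : exists n, fine (nu (~` L n)) < eta.
  apply: mass_cvg0 => //.
  - by move=> k; exact: measurableC.
  - by move=> k; rewrite LS setCU; exact: subIsetl.
  - rewrite (_ : \bigcap_k ~` L k = set0) ?measure0// -subset0 => x xL.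
    have := xL (Num.bound (f x / eta)) I; apply; rewrite /L /level /= /c.
    by rewrite -ltr_pdivrMr// archi_boundP// divr_ge0// ltW.
have tail A : measurable A -> fine (nu A) <= fine (nu (L n `&` A)) + eta /\
    fine (nu (L n `&` A)) <= fine (nu A).
  move=> mA; have mLA : measurable (L n `&` A) by exact: measurableI.
  have mLC : measurable (~` L n) by exact: measurableC.
  split; last by apply: mass_mono => //; exact: subIsetr.
  apply: (@le_trans _ _ (fine (nu ((L n `&` A) `|` ~` L n)))).
    apply: mass_mono => //; first exact: measurableU.
    by move=> x Ax; have [Lx|Lx] := pselect (L n x); [left|right].
  by apply: le_trans (mass_subU nu mLA mLC) _; rewrite lerD2l ltW.
have close A : measurable A -> `|S n A - fine (nu A)| <= e.
  move=> mA; have /andP[h1 h2] := bounds n A mA; have [h3 h4] := tail A mA.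
  have h5 : eta * fine (mu (L n `&` A)) <= eta.
    by apply: ler_piMr (ltW eta0) _; apply: mass_le1; exact: measurableI.
  have eE : e = eta + eta by rewrite /eta; lra.
  by rewrite ler_distl eE; apply/andP; split; lra.
exists (S n setT), (fun a b => S n (src @` (val a `+` val b))); split.
- have -> : S n setT = \sum_(0 <= j < n) c j * fine (mu (B j)).
    by apply: eq_bigr => j _; rewrite setIT.
  exact: approximable_sum.
- by have := close _ measurableT; rewrite probability_setT distrC.
- by move=> a b _ _; apply: close; exact: measurable_src_setY pmu.
Qed.

End absolute_continuity.

Lemma sofic_abs_continuous (R : realType) (U : set_system nat) d
    (G : measurableGroupoidType d) (mu nu : probability (units G) R) :
  free_ultrafilter U -> nu `<< mu -> pmp nu -> sofic U mu -> sofic U nu.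
Proof.
move=> freeU numu pnu sof; apply: (approximable_sofic freeU pnu).
have [f [mf f_lt f_ge f0]] := density_level_bounds numu.
exact: (approximable_density sof.1.1 sof.1 pnu mf f_lt f_ge f0
  (sofic_approximable freeU sof)).
Qed.

Theorem theorem3p1 (R : realType) (U : set_system nat) (d : measure_display)
    (G : measurableGroupoidType d)
    (freeU : free_ultrafilter U) (measG : discrete_measurable_groupoid R G) :
  (forall (I : Type) (leI : I -> I -> Prop)
      (mu_ : I -> probability (units G) R) (mu : probability (units G) R),
    directed leI -> strong_limit leI mu_ mu ->
    (forall i, sofic U (mu_ i)) -> sofic U mu)
  /\
  (forall (I : countType) (t : I -> R)
      (mu_ : I -> probability (units G) R) (mu : probability (units G) R),
    convex_combination t mu_ mu ->
    (forall i, sofic U (mu_ i)) -> sofic U mu)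
  /\
  ((forall (mu nu : probability (units G) R) (p : R.-ker units G ~> units G),
     pmp mu -> disintegration mu nu p ->
     ae_probability nu p (fun P => sofic U P) -> sofic U mu)
   /\
   (forall (mu : probability (units G) R) (d' : measure_display)
      (Z : measurableType d') (nu : probability Z R) (p : R.-ker Z ~> units G),
     pmp mu -> ergodic_decomposition mu nu p ->
     ae_probability nu p (fun P => sofic U P) -> sofic U mu))
  /\
  (forall (mu : probability (units G) R) (H : subgroupoid G)
      (H0 : non_null H mu),
    sofic U mu -> sofic U (subgpd_measure H0))
  /\
  (forall mu nu : probability (units G) R,
    nu `<< mu -> pmp nu -> sofic U mu -> sofic U nu)
  /\
  (forall (mu : probability (units G) R) (I : countType)
      (H : I -> subgroupoid G) (H0 : forall i, non_null (H i) mu),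
    pmp mu ->
    trivIset [set: I] (fun i => subgpd_set (H i)) ->
    \bigcup_(i in [set: I]) subgpd_set (H i) = [set: G] ->
    (sofic U mu <-> forall i, sofic U (subgpd_measure (H0 i)))).

Proof.
split; first by move=> I leI mu_ mu; exact: (sofic_strong_limit freeU measG).
split; first by move=> I t mu_ mu; exact: (sofic_convex freeU measG).
split.
  split => [mu nu p|mu d' Z nu p pmu [dis _]]; exact: (sofic_disintegration freeU).
split; first by move=> mu H H0; exact: (sofic_subgroupoid freeU measG).
split; first by move=> mu nu; exact: sofic_abs_continuous.
move=> mu I H H0 pmu tH cH; split; last exact: (sofic_partition freeU measG).
by move=> sof i; exact: (sofic_subgroupoid freeU measG).
Qed.
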